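(* Let $Y\in\mathbb{C}^g$. The inner rank of a matrix $A$ over $\mathcal{O}^{\mathrm{a}}_Y$ (resp. over $\mathcal{O}^{\mathrm{ua}}_Y$) equals $$\max\left\{\frac{\operatorname{rk}A(X)}{n}\colon n\in\mathbb{N},\ X\in M_n(\mathbb{C})^g \text{ in a neighborhood of } Y\right\},$$ where ''in a neighborhood of $Y$'' means: $X\in\Omega$, for any sufficiently small nc set $\Omega\ni Y$ that is open in the disjoint union topology (resp. in the uniformly open topology) and on which the entries of $A$ are defined.
   Context: Let $\mathbb{C}^g_{\rm nc}=\bigsqcup_{n\in\mathbb{N}}M_n(\mathbb{C})^g$; direct sums and conjugations of tuples are taken componentwise, and $\oplus^nY$ is the direct sum of $n$ copies of $Y$. A subset $\Omega\subseteq\mathbb{C}^g_{\rm nc}$ is an nc set if it is closed under direct sums; $\Omega_n=\Omega\cap M_n(\mathbb{C})^g$. An nc function $f:\Omega\to\bigsqcup_n M_n(\mathbb{C})$ satisfies $f(\Omega_n)\subseteq M_n(\mathbb{C})$, $f(X\oplus X')=f(X)\oplus f(X')$, and $f(SXS^{-1})=Sf(X)S^{-1}$ whenever $X,SXS^{-1}\in\Omega_n$, $S\in GL_n(\mathbb{C})$. For $X\in M_n(\mathbb{C})^g$ let $\|X\|$ be the maximum of the operator norms of its components. Disjoint union topology: $\Omega$ is open iff every $\Omega_n$ is open in the Euclidean topology of $M_n(\mathbb{C})^g$. Uniformly open topology: a basis is given by the nc balls $\mathbb{B}_\varepsilon(Y)=\bigsqcup_n\{X\in M_{ns}(\mathbb{C})^g:\|X-\oplus^nY\|<\varepsilon\}$,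 for $s\in\mathbb{N}$, $Y\in M_s(\mathbb{C})^g$, $\varepsilon>0$. An nc function on an nc set open in the disjoint union (resp. uniformly open) topology is analytic (resp. uniformly analytic) if every point of its domain has a neighborhood in that topology on which $f$ is bounded. $\mathcal{O}^{\mathrm{a}}_Y$ (resp. $\mathcal{O}^{\mathrm{ua}}_Y$) is the $\mathbb{C}$-algebra of equivalence classes of analytic (resp. uniformly analytic) nc functions defined on nc neighborhoods of $Y$ open in the corresponding topology, where two functions are equivalent if they agree on some open nc neighborhood of $Y$ in that topology. For a $d\times e$ matrix $A$ over one of these algebras and $X\in M_n(\mathbb{C})^g$, $A(X)$ is the $dn\times en$ complex matrix obtained by evaluating $A$ entrywise. The inner rank of a $d\times e$ matrix $A$ over a ring $R$ is the smallest $r\in\mathbb{N}\cup\{0\}$ such that $A=BC$ for some $B\in R^{d\times r}$, $C\in R^{r\times e}$. *)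

(* Defs.v *)
From HB Require Import structures.
From mathcomp Require Import all_boot all_order all_algebra complex.
From mathcomp Require Import all_classical all_reals all_analysis.

Set Implicit Arguments.
Unset Strict Implicit.
Unset Printing Implicit Defensive.

Import Order.TTheory GRing.Theory Num.Theory.
Import ComplexField.Normc.
Import numFieldNormedType.Exports.

Local Open Scope classical_set_scope.
Local Open Scope complex_scope.
Local Open Scope ring_scope.
Local Open Scope quotient_scope.

(* The library declares the metric topology of a numClosedFieldType K only for *)
(* the copy K^o and for variables K.                                          *)
#[warning="-redundant-canonical-projection"]
HB.instance Definition _ (R : realType) := NormedModule.copy R[i] R[i]^o.
HB.instance Definition _ (R : realType) := Num.ClosedField.on R[i].

Section OperatorNorm.
Context {R : realType}.

Definition l2norm n (v : 'cV[R[i]]_n) : R :=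
  Num.sqrt (\sum_(i < n) normc (v i 0) ^+ 2).

Definition opnorm n (A : 'M[R[i]]_n) : R :=
  sup [set l2norm (A *m v) | v in [set v | l2norm v <= 1]].

Lemma l2norm_ge0 n (v : 'cV[R[i]]_n) : 0 <= l2norm v.
Proof. exact: sqrtr_ge0. Qed.

Lemma l2norm_sqr n (v : 'cV[R[i]]_n) :
  l2norm v ^+ 2 = \sum_(i < n) normc (v i 0) ^+ 2.
Proof. by rewrite sqr_sqrtr ?sumr_ge0// => i _; rewrite sqr_ge0. Qed.

Lemma normc_ge0 (z : R[i]) : 0 <= normc z.
Proof. by case: z => a b; exact: sqrtr_ge0. Qed.

Lemma l2norm0 n : l2norm (0 : 'cV[R[i]]_n) = 0.
Proof.
by rewrite /l2norm big1 ?sqrtr0// => i _; rewrite mxE normc0 expr0n.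
Qed.

Lemma l2normZ n (c : R[i]) (v : 'cV[R[i]]_n) :
  l2norm (c *: v) = normc c * l2norm v.
Proof.
rewrite /l2norm -[X in X * _]ger0_norm ?normc_ge0// -sqrtr_sqr -sqrtrM ?sqr_ge0//.
by rewrite mulr_sumr; congr Num.sqrt; apply: eq_bigr => i _; rewrite mxE normcM exprMn.
Qed.

Lemma le_normc_l2norm n (v : 'cV[R[i]]_n) i : normc (v i 0) <= l2norm v.
Proof.
rewrite -[leLHS]ger0_norm ?normc_ge0// -sqrtr_sqr; apply: ler_wsqrtr.
by rewrite (bigD1 i)//= lerDl sumr_ge0// => j _; rewrite sqr_ge0.
Qed.

Lemma l2norm_le_sum n (v : 'cV[R[i]]_n) : l2norm v <= \sum_i normc (v i 0).
Proof.
have h0 : 0 <= \sum_i normc (v i 0) by apply: sumr_ge0 => i _; exact: normc_ge0.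
rewrite -[leRHS]ger0_norm// -sqrtr_sqr; apply: ler_wsqrtr.
rewrite [leRHS]expr2 mulr_suml; apply: ler_sum => i _.
rewrite expr2 ler_wpM2l ?normc_ge0// (bigD1 i)//= lerDl.
by apply: sumr_ge0 => j _; exact: normc_ge0.
Qed.

Lemma le_normc_sum (I : finType) (F : I -> R[i]) :
  normc (\sum_i F i) <= \sum_i normc (F i).
Proof.
elim/big_ind2 : _ => //; first by rewrite normc0.
move=> x1 x2 y1 y2 h1 h2; apply: le_trans (lerD h1 h2).
exact: le_normcD.
Qed.

Lemma cauchy_schwarz (I : finType) (a b : I -> R) :
  (\sum_i a i * b i) ^+ 2 <= (\sum_i a i ^+ 2) * (\sum_i b i ^+ 2).
Proof.
have h : (\sum_i a i * b i) ^+ 2 *+ 2 <=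
    (\sum_i a i ^+ 2) * (\sum_i b i ^+ 2) *+ 2.
  have -> : (\sum_i a i ^+ 2) * (\sum_i b i ^+ 2) *+ 2 =
      \sum_i \sum_j (a i ^+ 2 * b j ^+ 2 + a j ^+ 2 * b i ^+ 2).
    under [RHS]eq_bigr => i _ do rewrite big_split/= -mulr_sumr -mulr_suml.
    rewrite big_split/= -mulr_suml -mulr_sumr mulr2n.
    by congr (_ + _); rewrite mulrC.
  rewrite expr2 mulr_suml -sumrMnl; apply: ler_sum => i _.
  rewrite mulr_sumr -sumrMnl; apply: ler_sum => j _.
  have := sqr_ge0 (a i * b j - a j * b i).
  rewrite sqrrB !exprMn addrAC subr_ge0 => h; apply: le_trans h.
  rewrite le_eqVlt; apply/orP; left; apply/eqP; congr (_ *+ 2).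
  by rewrite mulrACA [in RHS]mulrACA [b j * _]mulrC.
by move: h; rewrite -[X in X <= _]mulr_natr -[X in _ <= X]mulr_natr ler_pM2r ?ltr0n.
Qed.

Lemma l2normD n (u v : 'cV[R[i]]_n) : l2norm (u + v) <= l2norm u + l2norm v.
Proof.
rewrite -[leRHS]ger0_norm ?addr_ge0 ?l2norm_ge0// -sqrtr_sqr; apply: ler_wsqrtr.
rewrite sqrrD !l2norm_sqr.
apply: (@le_trans _ _ (\sum_i (normc (u i 0) + normc (v i 0)) ^+ 2)).
  apply: ler_sum => i _; rewrite mxE ler_pXn2r ?nnegrE ?addr_ge0 ?normc_ge0//.
  exact: le_normcD.
under eq_bigr do rewrite sqrrD.
rewrite !big_split/= lerD2r lerD2l -mulr2n lerMn2r/=.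
apply: le_trans (ler_norm _) _.
rewrite -sqrtr_sqr -sqrtrM ?sumr_ge0// => [|i _]; last exact: sqr_ge0.
by apply: ler_wsqrtr; exact: cauchy_schwarz.
Qed.

Lemma l2norm_eq0 n (v : 'cV[R[i]]_n) : l2norm v = 0 -> v = 0.
Proof.
move=> h; apply/colP => i; rewrite mxE; apply: eq0_normc.
by apply/eqP; rewrite eq_le normc_ge0 andbT -h le_normc_l2norm.
Qed.

Let ball1 n (A : 'M[R[i]]_n) :=
  [set l2norm (A *m v) | v in [set v | l2norm v <= 1]].

Lemma opnorm_has_sup n (A : 'M[R[i]]_n) : has_sup (ball1 A).
Proof.
split; first by exists (l2norm (A *m 0)), 0 => //=; rewrite l2norm0 ler01.
exists (\sum_i \sum_j normc (A i j)) => _ [v /= v1 <-].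
apply: le_trans (l2norm_le_sum _) _; apply: ler_sum => i _.
rewrite mxE; apply: le_trans (le_normc_sum _) _; apply: ler_sum => j _.
rewrite normcM ler_piMr ?normc_ge0//.
exact: le_trans (le_normc_l2norm _ _) v1.
Qed.

Lemma opnorm_ge0 n (A : 'M[R[i]]_n) : 0 <= opnorm A.
Proof.
apply: (@le_trans _ _ (l2norm (A *m 0))); first exact: l2norm_ge0.
by apply: ub_le_sup; [exact: (opnorm_has_sup A).2|exists 0 => //=; rewrite l2norm0].
Qed.

Lemma l2norm_mulmx n (A : 'M[R[i]]_n) v : l2norm (A *m v) <= opnorm A * l2norm v.
Proof.
have [/eqP/l2norm_eq0 ->|v0] := boolP (l2norm v == 0).
  by rewrite mulmx0 l2norm0 mulr0.
have vp : 0 < l2norm v by rewrite lt_neqAle eq_sym v0 l2norm_ge0.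
rewrite -ler_pdivrMr// mulrC.
have nc : normc ((l2norm v)^-1)%:C = (l2norm v)^-1.
  by rewrite /normc/= expr0n addr0 sqrtr_sqr ger0_norm// invr_ge0 l2norm_ge0.
rewrite -nc -l2normZ scalemxAr; apply: ub_le_sup; first exact: (opnorm_has_sup A).2.
by exists (((l2norm v)^-1)%:C *: v) => //=; rewrite l2normZ nc mulVf.
Qed.

Lemma opnorm_le n (A : 'M[R[i]]_n) M : 0 <= M ->
  (forall v, l2norm (A *m v) <= M * l2norm v) -> opnorm A <= M.
Proof.
move=> M0 h; apply: ge_sup; first exact: (opnorm_has_sup A).1.
move=> _ [v /= v1 <-]; apply: le_trans (h v) _.
by rewrite ler_piMr.
Qed.

Lemma opnorm0 n : opnorm (0 : 'M[R[i]]_n) = 0.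
Proof.
apply/eqP; rewrite eq_le opnorm_ge0 andbT; apply: opnorm_le => // v.
by rewrite mul0mx l2norm0 mul0r.
Qed.

Lemma opnorm1_le n : opnorm (1%:M : 'M[R[i]]_n) <= 1.
Proof. by apply: opnorm_le => // v; rewrite mul1mx mul1r. Qed.

Lemma opnormD n (A B : 'M[R[i]]_n) : opnorm (A + B) <= opnorm A + opnorm B.
Proof.
apply: opnorm_le => [|v]; first by rewrite addr_ge0 ?opnorm_ge0.
rewrite mulmxDl mulrDl; apply: le_trans (l2normD _ _) _.
by rewrite lerD ?l2norm_mulmx.
Qed.

Lemma opnormM n (A B : 'M[R[i]]_n) : opnorm (A *m B) <= opnorm A * opnorm B.
Proof.
apply: opnorm_le => [|v]; first by rewrite mulr_ge0 ?opnorm_ge0.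
rewrite -mulmxA -mulrA; apply: le_trans (l2norm_mulmx _ _) _.
by rewrite ler_wpM2l ?opnorm_ge0 ?l2norm_mulmx.
Qed.

Lemma opnormZ_le n c (A : 'M[R[i]]_n) : opnorm (c *: A) <= normc c * opnorm A.
Proof.
apply: opnorm_le => [|v]; first by rewrite mulr_ge0 ?normc_ge0 ?opnorm_ge0.
by rewrite -scalemxAl l2normZ -mulrA ler_wpM2l ?normc_ge0 ?l2norm_mulmx.
Qed.

Lemma l2norm_col_mx m n (u : 'cV[R[i]]_m) (v : 'cV[R[i]]_n) :
  l2norm (col_mx u v) ^+ 2 = l2norm u ^+ 2 + l2norm v ^+ 2.
Proof.
rewrite !l2norm_sqr big_split_ord/=.
by congr (_ + _); apply: eq_bigr => i _; rewrite ?col_mxEu ?col_mxEd.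
Qed.

Lemma opnorm_block m n (A : 'M[R[i]]_m) (B : 'M[R[i]]_n) M :
  opnorm A <= M -> opnorm B <= M -> opnorm (block_mx A 0 0 B) <= M.
Proof.
move=> AM BM; have M0 : 0 <= M := le_trans (opnorm_ge0 A) AM.
apply: opnorm_le => // v.
rewrite -[v]vsubmxK mul_block_col !mul0mx addr0 add0r.
rewrite -(@ler_pXn2r _ 2)// ?nnegrE ?mulr_ge0 ?l2norm_ge0//.
rewrite exprMn !l2norm_col_mx mulrDr -!exprMn.
by apply: lerD; rewrite ler_pXn2r ?nnegrE ?mulr_ge0 ?l2norm_ge0//;
  apply: le_trans (l2norm_mulmx _ _) _; rewrite ler_wpM2r ?l2norm_ge0.
Qed.

End OperatorNorm.

(* Sizes are positive: the point [existT _ n X] is a g-tuple of matrices of   *)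
(* size n.+1.  The topology inherited from the sigma type is the disjoint     *)
(* union topology: see [sigT_openP].                                          *)
Definition ncspace (R : realType) (g : nat) : Type :=
  {n : nat & {ptws 'I_g -> 'M[R[i]]_n.+1}}.

HB.instance Definition _ (R : realType) (g : nat) :=
  Topological.copy (ncspace R g) {n : nat & {ptws 'I_g -> 'M[R[i]]_n.+1}}.

Section NCSpace.
Context {R : realType} {g : nat}.
Local Notation C := R[i].
Local Notation ncspace := (ncspace R g).
Implicit Types (p q Y : ncspace) (U Omega : set ncspace).

Definition ncpoint n (X : 'I_g -> 'M[C]_n.+1) : ncspace := existT _ n X.

Definition ncsize p : nat := (tag p).+1.

Definition nccomp p (k : 'I_g) : 'M[C]_(ncsize p) := tagged p k.

Definition dsum_mx m n (A : 'M[C]_m) (B : 'M[C]_n) : 'M[C]_(m + n) :=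
  block_mx A 0 0 B.

Definition dsum p q : ncspace :=
  @ncpoint (tag p + ncsize q) (fun k => dsum_mx (nccomp p k) (nccomp q k)).

(* The direct sum of n.+1 copies of Y. *)
Fixpoint copies Y (n : nat) : ncspace :=
  if n is n'.+1 then dsum Y (copies Y n') else Y.

Definition tnorm n (X : 'I_g -> 'M[C]_n) : R :=
  \big[Num.max/0]_(k < g) opnorm (X k).

(* The summand n of the disjoint union defining the ball is indexed by the    *)
(* number n.+1 of copies of Y.                                                *)
Definition ncball Y (eps : R) : set ncspace :=
  [set p | exists n (X : 'I_g -> 'M[C]_(ncsize (copies Y n))),
     p = ncpoint X /\ tnorm (fun k => X k - nccomp (copies Y n) k) < eps].

End NCSpace.

Section NCBalls.
Context {R : realType} {g : nat}.
Local Notation C := R[i].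
Local Notation ncspace := (ncspace R g).
Implicit Types (p q Y : ncspace).

Lemma tnorm_lt n (X : 'I_g -> 'M[C]_n) e :
  tnorm X < e <-> 0 < e /\ forall k, opnorm (X k) < e.
Proof.
split=> [h|[e0 h]].
  split=> [|k].
    apply: le_lt_trans h; rewrite /tnorm.
    by elim/big_ind : _ => // [x y x0 y0|k _]; [rewrite le_max x0|exact: opnorm_ge0].
  by apply: le_lt_trans h; exact: (le_bigmax _ (fun k => opnorm (X k)) k).
rewrite /tnorm; elim/big_ind : _ => // x y xe ye.
by rewrite gt_max xe.
Qed.

Let near (e : R) p q := exists (n : nat) (X Z : 'I_g -> 'M[C]_n.+1),
  [/\ p = ncpoint X, q = ncpoint Z & forall k, opnorm (X k - Z k) < e].

Let ncballP Y e p : ncball Y e p <-> 0 < e /\ exists n, near e p (copies Y n).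
Proof.
split=> [[n [X [-> /tnorm_lt[e0 h]]]]|[e0 [n [m [X [Z [-> eZ h]]]]]]].
  split=> //; exists n, (tag (copies Y n)), X, (tagged (copies Y n)); split=> //.
  by case: (copies Y n).
exists n; rewrite eZ /=; exists X; split=> //.
exact/tnorm_lt.
Qed.

Lemma dsum_mxB m n (A A' : 'M[C]_m) (B B' : 'M[C]_n) :
  dsum_mx A B - dsum_mx A' B' = dsum_mx (A - A') (B - B').
Proof. by rewrite /dsum_mx opp_block_mx add_block_mx !subr0. Qed.

Let near_dsum e p q p' q' :
  near e p q -> near e p' q' -> near e (dsum p p') (dsum q q').
Proof.
move=> [n [X [Z [-> -> h]]]] [n' [X' [Z' [-> -> h']]]].
pose D m m' (A : 'I_g -> 'M[C]_m.+1) (B : 'I_g -> 'M[C]_m'.+1) k :=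
  dsum_mx (A k) (B k).
exists (n + n'.+1)%N, (D _ _ X X'), (D _ _ Z Z'); split=> // k.
rewrite (_ : _ - _ = D _ _ (fun k => X k - Z k) (fun k => X' k - Z' k) k);
  last exact: dsum_mxB.
apply: (@le_lt_trans _ _ (Num.max (opnorm (X k - Z k)) (opnorm (X' k - Z' k)))).
  by apply: (@opnorm_block _ n.+1 n'.+1); rewrite le_max lexx ?orbT.
by rewrite gt_max h h'.
Qed.

Let near_copies e p q n : near e p q -> near e (copies p n) (copies q n).
Proof. by move=> h; elim: n => //= n IH; exact: near_dsum. Qed.

Let near_trans d e p q r : near d p q -> near e q r -> near (d + e) p r.
Proof.
move=> [n [X [Z [-> -> h]]]] [m [X' [Z' [eZ -> h']]]].
have enm : n = m := congr1 (@tag _ _) eZ.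
subst m; have eX := eq_from_Tagged eZ; subst X'.
exists n, X, Z'; split=> // k.
rewrite -[X k](subrK (Z k)) -addrA.
by apply: le_lt_trans (opnormD _ _) _; rewrite ltrD.
Qed.

Lemma ncpoint_eq n m (X : 'I_g -> 'M[C]_n.+1) (Z : 'I_g -> 'M[C]_m.+1)
    (e : n.+1 = m.+1) :
  (forall k, Z k = castmx (e, e) (X k)) -> ncpoint X = ncpoint Z.
Proof.
have enm : n = m by case: e.
subst m; rewrite (eq_irrelevance e erefl) => h.
by congr ncpoint; apply/funext => k; rewrite h castmx_id.
Qed.

Lemma dsum_mxA m n l (A : 'M[C]_m) (B : 'M[C]_n) (D : 'M[C]_l) :
  dsum_mx (dsum_mx A B) D =
  castmx (addnA m n l, addnA m n l) (dsum_mx A (dsum_mx B D)).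
Proof.
have := @block_mxA _ m n l m n l A 0 0 0 B 0 0 0 D.
rewrite /= !row_mx0 !col_mx0 /dsum_mx => ->.
by rewrite castmxKV.
Qed.

Lemma dsumA p q r : dsum p (dsum q r) = dsum (dsum p q) r.
Proof.
by apply: (ncpoint_eq (e := addnA (ncsize p) (ncsize q) (ncsize r))) => k;
  exact: (@dsum_mxA (ncsize p) (ncsize q) (ncsize r)).
Qed.

Lemma copies_add Y m n : dsum (copies Y m) (copies Y n) = copies Y (m + n).+1.
Proof. by elim: m => //= m IH; rewrite -dsumA IH. Qed.

Lemma copies_copies Y m n : copies (copies Y n) m = copies Y (m * n.+1 + n).
Proof.
elim: m => [//|m IH]; rewrite [LHS]/= IH copies_add.
by congr copies; rewrite mulSn !addSn addnA.
Qed.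

Lemma ncball_join Y Y' e e' p : ncball Y e p -> ncball Y' e' p ->
  exists2 d, 0 < d & ncball p d `<=` ncball Y e `&` ncball Y' e'.
Proof.
suff inside Z a : ncball Z a p ->
    exists2 d, 0 < d & forall d', d' <= d -> ncball p d' `<=` ncball Z a.
  move=> /inside[d d0 hd] /inside[d' d'0 hd'].
  exists (Num.min d d'); first by rewrite lt_min d0.
  by move=> q hq; split; [apply: hd hq|apply: hd' hq]; rewrite ge_min lexx ?orbT.
move=> [n [X [-> hX]]].
set b := tnorm _ in hX; pose c := (b + a) / 2.
have [bc ca] : b < c /\ c < a by split; rewrite /c ?midf_lt.
have pc : near c (ncpoint X) (copies Z n).
  exists (tag (copies Z n)), X, (tagged (copies Z n)).
  split=> [//||k]; first by case: (copies Z n).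
  by have /tnorm_lt[_] := bc; apply.
exists (a - c); first by rewrite subr_gt0.
move=> d' hd' q /ncballP[d'0 [m hq]]; apply/ncballP; split.
  by have /tnorm_lt[c0 _] := bc; exact: lt_trans ca.
exists (m * n.+1 + n)%N; rewrite -copies_copies.
have [k [W [V [-> -> h]]]] := near_trans hq (near_copies m pc).
exists k, W, V; split=> // l; apply: lt_le_trans (h l) _.
by rewrite -lerBrDr.
Qed.

Lemma ncball_center Y e : 0 < e -> ncball Y e Y.
Proof.
move=> e0; apply/ncballP; split=> //; exists 0%N, (tag Y), (tagged Y), (tagged Y).
by split=> [||k]; [case: Y|case: Y|rewrite subrr opnorm0].
Qed.

End NCBalls.

(* The same set with the uniformly open topology. *)
Definition uncspace (R : realType) (g : nat) : Type := ncspace R g.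

HB.instance Definition _ (R : realType) (g : nat) :=
  Choice.copy (uncspace R g) (ncspace R g).

Definition ncballs (R : realType) (g : nat) : set (set (uncspace R g)) :=
  [set U | exists (Y : ncspace R g) (eps : R), 0 < eps /\ U = ncball Y eps].

Lemma ncballs_cover (R : realType) (g : nat) :
  \bigcup_(U in @ncballs R g) U = setT.
Proof.
apply/seteqP; split=> // p _; exists (ncball p 1); first by exists p, 1.
exact: ncball_center.
Qed.

Lemma ncballs_join (R : realType) (g : nat) (U V : set (uncspace R g)) p :
  ncballs U -> ncballs V -> U p -> V p ->
  exists W, [/\ ncballs W, W p & W `<=` U `&` V].
Proof.
move=> [Y [e [e0 ->]]] [Y' [e' [e'0 ->]]] Up Vp.
have [d d0 sub] := ncball_join Up Vp.
by exists (ncball p d); split=> //; [exists p, d|exact: ncball_center].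
Qed.

HB.instance Definition _ (R : realType) (g : nat) :=
  isBaseTopological.Build (uncspace R g)
    (@ncballs_cover R g) (@ncballs_join R g).

Inductive nctopology := DisjointUnion | UniformlyOpen.

Section NCFunctions.
Context {R : realType} {g : nat}.
Local Notation C := R[i].
Local Notation ncspace := (ncspace R g).
Implicit Types (t : nctopology) (p q Y : ncspace) (U Omega : set ncspace).

Definition ncopen t Omega : Prop :=
  match t with
  | DisjointUnion => open (Omega : set ncspace)
  | UniformlyOpen => open (Omega : set (uncspace R g))
  end.

Definition ncset Omega := forall p q, Omega p -> Omega q -> Omega (dsum p q).

Definition ncnbhd t Y Omega := [/\ ncset Omega, ncopen t Omega & Omega Y].

Definition conj_mx n (S A : 'M[C]_n) : 'M[C]_n := S *m A *m invmx S.

(* Only the values of f on Omega matter. *)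
Definition ncfunction Omega (f : forall p, 'M[C]_(ncsize p)) : Prop :=
  (forall p q, Omega p -> Omega q -> f (dsum p q) = dsum_mx (f p) (f q)) /\
  (forall n (X : 'I_g -> 'M[C]_n.+1) (S : 'M[C]_n.+1), S \in unitmx ->
    Omega (ncpoint X) -> Omega (ncpoint (fun k => conj_mx S (X k))) ->
    f (ncpoint (fun k => conj_mx S (X k))) = conj_mx S (f (ncpoint X))).

Definition locally_bounded t Omega (f : forall p, 'M[C]_(ncsize p)) : Prop :=
  forall p, Omega p -> exists U, [/\ ncopen t U, U p, U `<=` Omega &
    exists M : R, forall q, U q -> opnorm (f q) <= M].

(* An analytic (resp. uniformly analytic) nc function on a neighborhood of Y. *)
Record anafun t Y := AnaFun {
  ncdom : set ncspace;
  ncval :> forall p, 'M[C]_(ncsize p);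
  ncdom_nbhd : ncnbhd t Y ncdom;
  ncval_ncfunction : ncfunction ncdom ncval;
  ncval_bounded : locally_bounded t ncdom ncval
}.

Definition same_germ t Y (f h : anafun t Y) : Prop :=
  exists Omega, [/\ ncnbhd t Y Omega, Omega `<=` ncdom f, Omega `<=` ncdom h &
    forall p, Omega p -> f p = h p].

Lemma ncopenT t : ncopen t setT.
Proof. by case: t; exact: openT. Qed.

Lemma ncopenI t U V : ncopen t U -> ncopen t V -> ncopen t (U `&` V).
Proof. by case: t; exact: openI. Qed.

Lemma ncnbhdT t Y : ncnbhd t Y setT.
Proof. by split=> //; exact: ncopenT. Qed.

Lemma ncnbhdI t Y U V : ncnbhd t Y U -> ncnbhd t Y V -> ncnbhd t Y (U `&` V).
Proof.
move=> [sU oU UY] [sV oV VY]; split=> //; last exact: ncopenI.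
by move=> p q [Up Vp] [Uq Vq]; split; [exact: sU|exact: sV].
Qed.

Lemma same_germ_refl t Y (f : anafun t Y) : same_germ f f.
Proof. by exists (ncdom f); split=> //; exact: ncdom_nbhd. Qed.

Lemma same_germ_sym t Y (f h : anafun t Y) : same_germ f h -> same_germ h f.
Proof. by move=> [U [nU Uf Uh e]]; exists U; split=> // p /e. Qed.

Lemma same_germ_trans t Y (f h l : anafun t Y) :
  same_germ f h -> same_germ h l -> same_germ f l.
Proof.
move=> [U [nU Uf Uh e]] [V [nV Vh Vl e']]; exists (U `&` V).
split; [exact: ncnbhdI|by move=> p [/Uf]|by move=> p [_ /Vl]|].
by move=> p [Up Vp]; rewrite e// e'.
Qed.

End NCFunctions.

Section GermOperations.
Context {R : realType} {g : nat} (t : nctopology) (Y : ncspace R g).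
Local Notation C := R[i].
Local Notation anafun := (anafun t Y).
Implicit Types f h : anafun.

Lemma const_ncfunction (c : C) :
  @ncfunction R g setT (fun p => c%:M : 'M[C]_(ncsize p)).
Proof.
split=> [p q _ _|n X S uS _ _].
  exact: (@scalar_mx_block _ (ncsize p) (ncsize q) c).
by rewrite /conj_mx scalar_mxC -mulmxA mulmxV// mulmx1.
Qed.

Lemma const_bounded (c : C) :
  locally_bounded t setT (fun p : ncspace R g => c%:M : 'M[C]_(ncsize p)).
Proof.
move=> p _; exists setT; split=> //; first exact: ncopenT.
exists (normc c) => q _; rewrite -scalemx1; apply: le_trans (opnormZ_le _ _) _.
by rewrite ler_piMr ?normc_ge0 ?opnorm1_le.
Qed.

Definition ana_const c : anafun :=
  AnaFun (ncnbhdT t Y) (const_ncfunction c) (@const_bounded c).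

Lemma add_ncfunction f h :
  ncfunction (ncdom f `&` ncdom h) (fun p => f p + h p).
Proof.
have [[fD fJ] [hD hJ]] := (ncval_ncfunction f, ncval_ncfunction h).
split=> [p q [fp hp] [fq hq]|n X S uS [fX hX] [fX' hX']].
  rewrite fD// hD//; have := add_block_mx (f p) 0 0 (f q) (h p) 0 0 (h q).
  by rewrite !addr0.
by rewrite fJ// hJ// /conj_mx mulmxDr mulmxDl.
Qed.

Lemma add_bounded f h :
  locally_bounded t (ncdom f `&` ncdom h) (fun p => f p + h p).
Proof.
move=> p [fp hp].
have [U [oU Up Uf [M MU]]] := @ncval_bounded _ _ _ _ f p fp.
have [V [oV Vp Vh [N NV]]] := @ncval_bounded _ _ _ _ h p hp.
exists (U `&` V); split=> //; first exact: ncopenI.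
  by move=> q [/Uf ? /Vh].
exists (M + N) => q [/MU ? /NV ?]; apply: le_trans (opnormD _ _) _.
exact: lerD.
Qed.

Definition ana_add f h : anafun :=
  AnaFun (ncnbhdI (ncdom_nbhd f) (ncdom_nbhd h))
    (add_ncfunction f h) (@add_bounded f h).

Lemma mul_ncfunction f h :
  ncfunction (ncdom f `&` ncdom h) (fun p => f p *m h p).
Proof.
have [[fD fJ] [hD hJ]] := (ncval_ncfunction f, ncval_ncfunction h).
split=> [p q [fp hp] [fq hq]|n X S uS [fX hX] [fX' hX']].
  rewrite fD// hD//.
  have := mulmx_block (f p) 0 0 (f q) (h p) 0 0 (h q).
  by rewrite !mulmx0 !mul0mx !addr0 !add0r.
by rewrite fJ// hJ// /conj_mx !mulmxA mulmxKV.
Qed.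

Lemma mul_bounded f h :
  locally_bounded t (ncdom f `&` ncdom h) (fun p => f p *m h p).
Proof.
move=> p [fp hp].
have [U [oU Up Uf [M MU]]] := @ncval_bounded _ _ _ _ f p fp.
have [V [oV Vp Vh [N NV]]] := @ncval_bounded _ _ _ _ h p hp.
exists (U `&` V); split=> //; first exact: ncopenI.
  by move=> q [/Uf ? /Vh].
exists (M * N) => q [/MU ? /NV ?]; apply: le_trans (opnormM _ _) _.
by rewrite ler_pM ?opnorm_ge0.
Qed.

Definition ana_mul f h : anafun :=
  AnaFun (ncnbhdI (ncdom_nbhd f) (ncdom_nbhd h))
    (mul_ncfunction f h) (@mul_bounded f h).

Definition same_germb : rel anafun := fun f h => `[< same_germ f h >].

Lemma same_germb_refl : reflexive same_germb.
Proof. by move=> f; apply/asboolP; exact: same_germ_refl. Qed.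

Lemma same_germb_sym : symmetric same_germb.
Proof. by move=> f h; apply/asboolP/asboolP; exact: same_germ_sym. Qed.

Lemma same_germb_trans : transitive same_germb.
Proof.
move=> h f l /asboolP fh /asboolP hl; apply/asboolP.
exact: same_germ_trans hl.
Qed.

End GermOperations.

HB.instance Definition _ R g t (Y : ncspace R g) := gen_eqMixin (anafun t Y).
HB.instance Definition _ R g t (Y : ncspace R g) := gen_choiceMixin (anafun t Y).

Canonical same_germ_equiv R g t (Y : ncspace R g) :=
  EquivRel (@same_germb R g t Y) (@same_germb_refl R g t Y)
    (@same_germb_sym R g t Y) (@same_germb_trans R g t Y).

Definition germ R g t (Y : ncspace R g) : Type := {eq_quot @same_germb R g t Y}.

HB.instance Definition _ R g t (Y : ncspace R g) :=
  Choice.copy (germ t Y) {eq_quot @same_germb R g t Y}.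

Section GermAlgebra.
Context {R : realType} {g : nat} {t : nctopology} {Y : ncspace R g}.
Local Notation C := R[i].
Local Notation germ := (germ t Y).
Implicit Types (f h l : anafun t Y) (a b : germ).

Definition germ_of f : germ := \pi_{eq_quot @same_germb R g t Y} f.
Definition germ_repr a : anafun t Y := repr (a : {eq_quot @same_germb R g t Y}).

Lemma germ_reprK a : germ_of (germ_repr a) = a.
Proof. exact: reprK. Qed.

Lemma germ_ofP f h : germ_of f = germ_of h <-> same_germ f h.
Proof.
by split=> [/eqmodP/asboolP//|fh]; apply/eqmodP/asboolP.
Qed.

Lemma repr_germ_of f : same_germ (germ_repr (germ_of f)) f.
Proof. by apply/germ_ofP; exact: germ_reprK. Qed.

Lemma germ_ofW (P : germ -> Prop) : (forall f, P (germ_of f)) -> forall a, P a.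
Proof. by move=> h a; rewrite -(germ_reprK a). Qed.

Definition germ_const c : germ := germ_of (ana_const t Y c).
Definition germ_add a b := germ_of (ana_add (germ_repr a) (germ_repr b)).
Definition germ_mul a b := germ_of (ana_mul (germ_repr a) (germ_repr b)).
Definition germ_opp a := germ_mul (germ_const (-1)) a.
Definition germ_scale (c : C) a := germ_mul (germ_const c) a.

Lemma germ_addE f h : germ_add (germ_of f) (germ_of h) = germ_of (ana_add f h).
Proof.
apply/germ_ofP.
have [U [nU Uf' Uf e]] := repr_germ_of f.
have [V [nV Vh' Vh e']] := repr_germ_of h.
exists (U `&` V); split; [exact: ncnbhdI| | |].
- by move=> p [Up Vp]; split; [exact: Uf'|exact: Vh'].
- by move=> p [Up Vp]; split; [exact: Uf|exact: Vh].
- by move=> p [Up Vp] /=; rewrite e// e'.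
Qed.

Lemma germ_mulE f h : germ_mul (germ_of f) (germ_of h) = germ_of (ana_mul f h).
Proof.
apply/germ_ofP.
have [U [nU Uf' Uf e]] := repr_germ_of f.
have [V [nV Vh' Vh e']] := repr_germ_of h.
exists (U `&` V); split; [exact: ncnbhdI| | |].
- by move=> p [Up Vp]; split; [exact: Uf'|exact: Vh'].
- by move=> p [Up Vp]; split; [exact: Uf|exact: Vh].
- by move=> p [Up Vp] /=; rewrite e// e'.
Qed.

Lemma germ_of_eq f h : ncdom f = ncdom h ->
  (forall p, f p = h p) -> germ_of f = germ_of h.
Proof.
move=> fh e; apply/germ_ofP; exists (ncdom f); split=> //; first exact: ncdom_nbhd.
by rewrite fh.
Qed.

Lemma germ_addA : associative germ_add.
Proof.
elim/germ_ofW => f; elim/germ_ofW => h; elim/germ_ofW => l.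
by rewrite !germ_addE; apply: germ_of_eq => [|p] /=; [rewrite setIA|rewrite addrA].
Qed.

Lemma germ_addC : commutative germ_add.
Proof.
elim/germ_ofW => f; elim/germ_ofW => h.
by rewrite !germ_addE; apply: germ_of_eq => [|p] /=; [rewrite setIC|rewrite addrC].
Qed.

Lemma germ_add0 : left_id (germ_const 0) germ_add.
Proof.
elim/germ_ofW => f; rewrite germ_addE; apply: germ_of_eq => [|p] /=.
  by rewrite setTI.
by rewrite raddf0 add0r.
Qed.

Lemma germ_addN : left_inverse (germ_const 0) germ_opp germ_add.
Proof.
elim/germ_ofW => f; rewrite /germ_opp germ_mulE germ_addE; apply/germ_ofP.
exists (ncdom f); split=> //; first exact: ncdom_nbhd.
by move=> p _ /=; rewrite mul_scalar_mx scaleN1r addNr raddf0.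
Qed.

HB.instance Definition _ :=
  GRing.isZmodule.Build germ germ_addA germ_addC germ_add0 germ_addN.

Lemma germ_ofD f h : germ_of f + germ_of h = germ_of (ana_add f h).
Proof. exact: germ_addE. Qed.

Lemma germ_mulA : associative germ_mul.
Proof.
elim/germ_ofW => f; elim/germ_ofW => h; elim/germ_ofW => l.
by rewrite !germ_mulE; apply: germ_of_eq => [|p] /=; [rewrite setIA|rewrite mulmxA].
Qed.

Lemma germ_mul1l : left_id (germ_const 1) germ_mul.
Proof.
elim/germ_ofW => f; rewrite germ_mulE; apply: germ_of_eq => [|p] /=.
  by rewrite setTI.
by rewrite mul1mx.
Qed.

Lemma germ_mul1r : right_id (germ_const 1) germ_mul.
Proof.
elim/germ_ofW => f; rewrite germ_mulE; apply: germ_of_eq => [|p] /=.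
  by rewrite setIT.
by rewrite mulmx1.
Qed.

Lemma germ_mulDl : left_distributive germ_mul +%R.
Proof.
elim/germ_ofW => f; elim/germ_ofW => h; elim/germ_ofW => l.
rewrite (germ_ofD f h) germ_mulE (germ_mulE f l) (germ_mulE h l) germ_ofD;
  apply: germ_of_eq => [|p] /=.
  by rewrite setIIl.
by rewrite mulmxDl.
Qed.

Lemma germ_mulDr : right_distributive germ_mul +%R.
Proof.
elim/germ_ofW => f; elim/germ_ofW => h; elim/germ_ofW => l.
rewrite (germ_ofD h l) germ_mulE (germ_mulE f h) (germ_mulE f l) germ_ofD;
  apply: germ_of_eq => [|p] /=.
  by rewrite setIIr.
by rewrite mulmxDr.
Qed.

Lemma germ_oner_neq0 : germ_const 1 != (0 : germ).
Proof.
apply/eqP => /germ_ofP[U [[_ _ UY] _ _ /(_ _ UY)/=]].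
by move=> /matrixP/(_ ord0 ord0); rewrite !mxE => /eqP; rewrite oner_eq0.
Qed.

HB.instance Definition _ := GRing.Zmodule_isNzRing.Build germ
  germ_mulA germ_mul1l germ_mul1r germ_mulDl germ_mulDr germ_oner_neq0.

Lemma germ_ofM f h : germ_of f * germ_of h = germ_of (ana_mul f h).
Proof. exact: germ_mulE. Qed.

Lemma germ_constM c d : germ_const c * germ_const d = germ_const (c * d) :> germ.
Proof.
rewrite germ_ofM; apply: germ_of_eq => [|p] /=; first by rewrite setTI.
by rewrite scalar_mxM.
Qed.

Lemma germ_constD c d : germ_const (c + d) = germ_const c + germ_const d :> germ.
Proof.
rewrite germ_ofD; apply: germ_of_eq => [|p] /=; first by rewrite setTI.
by rewrite raddfD.
Qed.

Lemma germ_constC c a : germ_const c * a = a * germ_const c.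
Proof.
elim/germ_ofW: a => f.
rewrite !germ_ofM; apply: germ_of_eq => [|p] /=.
  by rewrite setTI setIT.
by rewrite scalar_mxC.
Qed.

Lemma germ_scaleE c a : germ_scale c a = germ_const c * a.
Proof. by []. Qed.

Lemma germ_scaleA c d a : germ_scale c (germ_scale d a) = germ_scale (c * d) a.
Proof. by rewrite !germ_scaleE -germ_constM mulrA. Qed.

Lemma germ_scale1 : left_id 1 germ_scale.
Proof. exact: mul1r. Qed.

Lemma germ_scaleDr : right_distributive germ_scale +%R.
Proof. by move=> c; exact: mulrDr. Qed.

Lemma germ_scaleDl a : {morph germ_scale^~ a : c d / c + d}.
Proof. by move=> c d; rewrite /germ_scale germ_constD; exact: mulrDl. Qed.

HB.instance Definition _ := GRing.Zmodule_isLmodule.Build C germ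
  germ_scaleA germ_scale1 germ_scaleDr germ_scaleDl.

Lemma germ_scaleAl c a b : c *: (a * b) = (c *: a) * b.
Proof. exact: mulrA. Qed.

HB.instance Definition _ := GRing.Lmodule_isLalgebra.Build C germ germ_scaleAl.

Lemma germ_scaleAr c a b : c *: (a * b) = a * (c *: b).
Proof.
change (germ_const c * (a * b) = a * (germ_const c * b)).
by rewrite mulrA germ_constC -mulrA.
Qed.

HB.instance Definition _ := GRing.Lalgebra_isAlgebra.Build C germ germ_scaleAr.

End GermAlgebra.

Section InnerRank.
Context {K : pzRingType} {d e : nat}.

Definition factors_through (A : 'M[K]_(d, e)) (r : nat) : Prop :=
  exists (B : 'M[K]_(d, r)) (D : 'M[K]_(r, e)), A = B *m D.

Lemma factors_through_ex (A : 'M[K]_(d, e)) : exists r, `[< factors_through A r >].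
Proof. by exists e; apply/asboolP; exists A, 1%:M; rewrite mulmx1. Qed.

Definition inner_rank (A : 'M[K]_(d, e)) : nat := ex_minn (factors_through_ex A).

End InnerRank.

Definition eval_mx (R : realType) (g : nat) (t : nctopology) (Y : ncspace R g)
    (d e : nat) (F : 'M[anafun t Y]_(d, e)) (p : ncspace R g) :=
  \mxblock_(i < d, j < e) (F i j p : 'M[R[i]]_(ncsize p)).

Definition is_max (T : porderType ring_display) (S : set T) (x : T) : Prop :=
  S x /\ ubound S x.

(* A point of C^g seen as a tuple of 1 x 1 matrices. *)
Definition scalar_point (R : realType) (g : nat) (y : 'I_g -> R[i]) : ncspace R g :=
  @ncpoint R g 0 (fun k => (y k)%:M).

(* Main.v *)
From HB Require Import structures.
Require Import Defs.
From mathcomp Require Import all_boot all_order all_algebra complex.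
From mathcomp Require Import all_classical all_reals all_analysis.
From mathcomp Require Import fingroup perm ring lra.
From mathcomp Require cyclic separable cyclotomic.

Set Implicit Arguments.
Unset Strict Implicit.
Unset Printing Implicit Defensive.

Import Order.TTheory GRing.Theory Num.Theory.
Import ComplexField.Normc.
Import numFieldNormedType.Exports.

Local Open Scope classical_set_scope.
Local Open Scope complex_scope.
Local Open Scope ring_scope.

(** Write O for the ring of germs at y, x_k for the k-th coordinate minus y_k,
    and m for the ideal of germs vanishing at y.  A factorization A = B D with r
    inner columns, evaluated at a point of size n, shows that the rank is at most
    r n.  The content of the theorem is the converse: a factorization with as few
    columns as the ranks of the values allow.

    The structure of O comes from one principle.  An nc function intertwines: if
    X_k S = S X'_k for all k, with S rectangular, then f(X) S = S f(X').  At block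
    triangular points this gives f = f(y) + sum_k x_k D_k f with unique and again
    analytic D_k f ([ana_left], [left_independence]).  Germs with f(y) <> 0 are
    units ([germ_inverse]), and a germ whose Taylor expansion is zero is zero
    ([flat_germ]); the latter rests on a maximum principle for functions on a
    disc that have polynomial expansions at every point ([flat_disc]).  These
    facts give a lemma of Nakayama type: if a left submodule N of O^e is spanned
    by F_1, ..., F_l modulo m N, then the F_s generate N ([nakayama]).

    On the side of ranks, the largest rank of A near y in size s, taken
    arbitrarily close to y, is a multiple of s ([regularity]).  Indeed a point of
    size s belongs to a family of matrices W(a, b), polynomial in a and b, for
    which multiplying a or b by a primitive s-th root of unity amounts to
    conjugation by a cyclic shift or by a diagonal matrix of roots of unity.
    Functions of W have the same symmetries; comparing lowest terms, such a matrix
    function is zero or has nonzero determinant ([division]), as in a cyclic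
    division algebra.  Block elimination then removes exactly s from the rank at
    each step ([elimination]).  Consequently the largest ratio of rank and size
    near y is an integer nu, and it is attained ([generic_rank]).

    Call a point good if the rank of A there is nu times its size.  Let N
    consist of the rows over O whose value at each good point lies in the row
    space of A.  Adding elements of N to A does not increase the ranks
    ([closure_rank]), and values at the points [[y, z], [0, p]] show that at most
    nu elements of N are independent modulo m N ([independent_bound]).  A maximal
    independent family therefore generates N, which contains the rows of A, and A
    factors through at most nu columns ([factors_generic]).  Good points exist
    arbitrarily close to y, and there the bound is attained. *)

(** * Norms and the two topologies *)

Section Topologies.
Context {R : realType} {g : nat}.
Local Notation C := R[i].
Local Notation ncspace := (ncspace R g).
Implicit Types (p q : ncspace) (Omega : set ncspace).

Lemma normcX (z : C) n : normc (z ^+ n) = normc z ^+ n.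
Proof. by elim: n => [|n IH]; rewrite ?expr0 ?normc1// !exprS normcM IH. Qed.

Lemma normc_gt0 (z : C) : z != 0 -> 0 < normc z.
Proof.
move=> z0; rewrite lt_neqAle normc_ge0 andbT eq_sym.
by apply: contra z0 => /eqP/eq0_normc ->.
Qed.

Lemma normc_real (x : R) : normc x%:C = `|x|.
Proof. by rewrite /normc/= expr0n addr0 sqrtr_sqr. Qed.

Definition near_pt p (e : R) : set ncspace :=
  [set q | exists X : 'I_g -> 'M[C]_(ncsize p), q = ncpoint X /\
     forall k, opnorm (X k - nccomp p k) < e].

Lemma normc_le_opnorm n (A : 'M[C]_n) i j : normc (A i j) <= opnorm A.
Proof.
pose v : 'cV[C]_n := delta_mx j 0.
have v1 : l2norm v <= 1.
  rewrite /l2norm -[leRHS]sqrtr1; apply: ler_wsqrtr.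
  rewrite (bigD1 j)//= big1 => [|l lj]; first by rewrite mxE !eqxx normc1 expr1n addr0.
  by rewrite mxE (negbTE lj) normc0 expr0n.
have -> : A i j = (A *m v) i 0.
  rewrite mxE (bigD1 j)//= big1 => [|l lj]; first by rewrite mxE !eqxx mulr1 addr0.
  by rewrite mxE (negbTE lj) mulr0.
apply: le_trans (le_normc_l2norm _ _) _; apply: le_trans (l2norm_mulmx _ _) _.
by rewrite ler_piMr ?opnorm_ge0.
Qed.

Lemma opnorm_le_sum n (A : 'M[C]_n) : opnorm A <= \sum_i \sum_j normc (A i j).
Proof.
have ge0 i : 0 <= \sum_j normc (A i j) by apply: sumr_ge0 => j _; exact: normc_ge0.
apply: opnorm_le => [|v]; first by apply: sumr_ge0 => i _.
apply: le_trans (l2norm_le_sum _) _; rewrite mulr_suml; apply: ler_sum => i _.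
rewrite mxE; apply: le_trans (le_normc_sum _) _; rewrite mulr_suml.
apply: ler_sum => j _; rewrite normcM ler_wpM2l ?normc_ge0//.
exact: le_normc_l2norm.
Qed.

Lemma ltc_normc (z : C) (e : R) : (`|z| < e%:C) = (normc z < e).
Proof.
have -> : `|z| = (normc z)%:C by [].
by rewrite ltcR.
Qed.

Lemma nbhs_opnorm n (X : 'M[C]_n.+1) (A : set 'M[C]_n.+1) :
  nbhs X A -> exists2 e : R, 0 < e & forall X', opnorm (X' - X) < e -> A X'.
Proof.
move=> [P hP PA].
have : forall ij : 'I_n.+1 * 'I_n.+1, exists e : R, 0 < e /\
    forall z, normc (z - X ij.1 ij.2) < e -> P ij.1 ij.2 z.
  move=> [i j] /=; have /nbhs_ballP[e e0 he] := hP i j.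
  case: e e0 he => a b /=; rewrite ltcE /= => /andP[/eqP -> a0] he.
  exists a; split=> // z hz; apply: he.
  by rewrite /ball/= distrC (ltc_normc _ a).
move=> /choice[e he].
exists (\big[Num.min/1]_ij e ij).
  by elim/big_ind : _ => // [x y x0 y0|ij _]; [rewrite lt_min x0|have [] := he ij].
move=> X' hX'; apply: PA => i j; have [_] := he (i, j); apply => /=.
apply: (@le_lt_trans _ _ (opnorm (X' - X))).
  by have := normc_le_opnorm (X' - X) i j; rewrite !mxE.
by apply: lt_le_trans hX' _; exact: bigmin_le_cond.
Qed.

Lemma opnorm_nbhs n (X : 'M[C]_n.+1) (e : R) : 0 < e ->
  nbhs X [set X' | opnorm (X' - X) < e].
Proof.
move=> e0; pose d := e / (n.+1 * n.+1).+1%:R.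
have d0 : 0 < d by rewrite divr_gt0.
exists (fun i j => [set z | normc (z - X i j) < d]) => [i j|X' /= hX'].
  apply/nbhs_ballP; exists d%:C; rewrite /= ?ltcR// => z.
  by rewrite /ball/= distrC ltc_normc.
apply: le_lt_trans (opnorm_le_sum _) _.
apply: (@le_lt_trans _ _ (\sum_(i < n.+1) \sum_(j < n.+1) d)).
  by apply: ler_sum => i _; apply: ler_sum => j _; rewrite !mxE ltW//; exact: hX'.
rewrite sumr_const card_ord sumr_const card_ord -mulrnA.
rewrite -[ltLHS]mulr_natr /d -mulrA -[ltRHS]mulr1 ltr_pM2l//.
by rewrite mulrC ltr_pdivrMr ?mul1r ?ltr_nat.
Qed.

Lemma open_nearP Omega : open Omega <->
  forall p, Omega p -> exists2 e : R, 0 < e & near_pt p e `<=` Omega.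
Proof.
split=> [oO [n X] pO|h].
  move: oO => /sigT_openP/(_ n) oO.
  have nX : nbhs (X : {ptws 'I_g -> 'M[C]_n.+1}) (existT _ n @^-1` Omega).
    exact: open_nbhs_nbhs.
  pose B (e : R) : set {ptws 'I_g -> 'M[C]_n.+1} :=
    [set X' : 'I_g -> 'M[C]_n.+1 | forall k, opnorm (X' k - X k) < e].
  pose F := filter_from [set e : R | 0 < e] B.
  have FF : Filter F.
    apply: filter_from_filter; first by exists 1 => /=.
    move=> e e' /= e0 e'0; exists (Num.min e e'); first by rewrite lt_min e0.
    by move=> X' hX'; split => k; apply: lt_le_trans (hX' k) _;
      rewrite ge_min lexx ?orbT.
  have FX : F --> (X : {ptws 'I_g -> 'M[C]_n.+1}).
    apply/cvg_sup => k A [_ [[W oW <-] WX WA]].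
    have [e e0 he] := nbhs_opnorm (open_nbhs_nbhs (conj oW WX)).
    by exists e => // X' hX'; apply: WA; apply: he; exact: hX'.
  have [e e0 he] := FX _ nX.
  by exists e => // q [X' [-> hX']]; exact: (he X').
apply/sigT_openP => n; rewrite openE => X OX.
have [e e0 he] := h _ OX.
apply: (@filterS _ _ _ [set X' : 'I_g -> 'M[C]_n.+1 | forall k,
    opnorm (X' k - X k) < e]) => [X' hX'|].
  by apply: he; exists X'.
suff hk k : nbhs (X : {ptws 'I_g -> 'M[C]_n.+1})
    [set X' : 'I_g -> 'M[C]_n.+1 | opnorm (X' k - X k) < e].
  exact: (@filter_forall _ 'I_g
    (fun k (X' : {ptws 'I_g -> 'M[C]_n.+1}) => opnorm (X' k - X k) < e)
    _ (nbhs_filter X) hk).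
have pk := @proj_continuous 'I_g (fun=> 'M[C]_n.+1) k X.
have nk : nbhs (proj k X) [set M | opnorm (M - X k) < e] by exact: opnorm_nbhs.
by have := pk _ nk; rewrite nbhs_simpl.
Qed.

Lemma uopen_ncballP Omega : open (Omega : set (uncspace R g)) <->
  forall p, Omega p -> exists2 e : R, 0 < e & ncball p e `<=` Omega.
Proof.
split=> [[D sD <-] p [U DU Up]|h].
  have [Y [e [e0 eU]]] := sD _ DU.
  rewrite eU in Up; have [d d0 sub] := ncball_join Up Up.
  by exists d => // q /sub[? _]; exists U => //; rewrite eU.
exists [set U | ncballs U /\ U `<=` Omega]; first by move=> U [].
apply/seteqP; split=> [p [U [_ UO] /UO]//|p /h[e e0 sub]].
by exists (ncball p e); [split=> //; exists p, e|exact: ncball_center].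
Qed.

Lemma near_pt_ncball p (e : R) : 0 < e -> near_pt p e `<=` ncball p e.
Proof.
by move=> e0 q [X [-> hX]]; exists 0%N, X; split=> //; apply/tnorm_lt.
Qed.

Lemma ncopen_near t Omega p : ncopen t Omega -> Omega p ->
  exists2 e : R, 0 < e & near_pt p e `<=` Omega.
Proof.
case: t => [/open_nearP|/uopen_ncballP] h /h// [e e0 sub].
by exists e => // q /(near_pt_ncball e0)/sub.
Qed.

End Topologies.

(** * Intertwining and block triangular points *)

Section Intertwining.
Context {R : realType} {g : nat}.
Local Notation C := R[i].
Local Notation ncspace := (ncspace R g).
Implicit Types (p q : ncspace) (Omega : set ncspace).
Implicit Types (f : forall p, 'M[C]_(ncsize p)).

(** For rectangular S this property unifies respect of direct sums and of
    similarities; values at block triangular points are read off from it. *)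
Definition intertwining Omega f := forall p q, Omega p -> Omega q ->
  forall S : 'M[C]_(ncsize p, ncsize q),
    (forall k, nccomp p k *m S = S *m nccomp q k) -> f p *m S = S *m f q.

(** The matrix [[1, S], [0, 1]] commutes with the direct sum of p and q exactly
    when S intertwines p and q, so the value at that direct sum commutes with
    it too. *)
Lemma ncfunction_intertwining Omega f :
  ncset Omega -> ncfunction Omega f -> intertwining Omega f.
Proof.
move=> sO [fD fJ] p q Op Oq S hS.
pose T : 'M[C]_(ncsize p + ncsize q) := block_mx 1%:M S 0 1%:M.
pose T' : 'M[C]_(ncsize p + ncsize q) := block_mx 1%:M (- S) 0 1%:M.
have TT' : T *m T' = 1%:M.
  by rewrite mulmx_block !mulmx1 !mul1mx !mulmx0 !mul0mx !addr0 add0r addNr -scalar_mx_block.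
have uT : T \in unitmx by case/mulmx1_unit: TT'.
have OD : Omega (dsum p q) by exact: sO.
have eD : (fun k => @conj_mx R (tag p + ncsize q).+1 T (dsum_mx (nccomp p k) (nccomp q k))) =
    fun k => dsum_mx (nccomp p k) (nccomp q k).
  apply/funext => k; rewrite /conj_mx; apply: (canLR (mulmxK uT)).
  change (T *m dsum_mx (nccomp p k) (nccomp q k) = dsum_mx (nccomp p k) (nccomp q k) *m T).
  rewrite /dsum_mx mulmx_block [RHS]mulmx_block !mulmx1 !mul1mx !mulmx0 !mul0mx.
  by rewrite !addr0 !add0r hS.
have := fJ _ (fun k => dsum_mx (nccomp p k) (nccomp q k)) T uT OD.
rewrite eD => /(_ OD); change (f (dsum p q) = conj_mx T (f (dsum p q)) -> f p *m S = S *m f q).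
rewrite fD// /conj_mx => e1.
have : dsum_mx (f p) (f q) *m T = T *m dsum_mx (f p) (f q) by rewrite {1}e1 mulmxKV.
rewrite /dsum_mx /T !mulmx_block !mulmx1 !mul1mx !mulmx0 !mul0mx.
by rewrite !addr0 !add0r => /eq_block_mx[].
Qed.

Definition ut p q (Z : 'I_g -> 'M[C]_(ncsize p, ncsize q)) : ncspace :=
  @ncpoint R g (tag p + ncsize q)
    (fun k => block_mx (nccomp p k) (Z k) 0 (nccomp q k)).

Definition urb p q (A : 'M[C]_(ncsize p + ncsize q)) : 'M[C]_(ncsize p, ncsize q) :=
  ursubmx A.

Lemma ut_mul_col p q Z k n (A : 'M[C]_(ncsize p, n)) (B : 'M[C]_(ncsize q, n)) :
  (nccomp (@ut p q Z) k : 'M[C]_(ncsize p + ncsize q)) *m col_mx A B =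
  col_mx (nccomp p k *m A + Z k *m B) (nccomp q k *m B).
Proof. by apply: etrans (mul_block_col _ _ _ _ _ _) _; rewrite mul0mx add0r. Qed.

Lemma row_mul_ut p q Z k n (A : 'M[C]_(n, ncsize p)) (B : 'M[C]_(n, ncsize q)) :
  row_mx A B *m (nccomp (@ut p q Z) k : 'M[C]_(ncsize p + ncsize q)) =
  row_mx (A *m nccomp p k) (A *m Z k + B *m nccomp q k).
Proof. by apply: etrans (mul_row_block _ _ _ _ _ _) _; rewrite mulmx0 addr0. Qed.

(** The inclusion of p and the projection onto q intertwine. *)
Lemma ut_val Omega f p q Z : intertwining Omega f ->
  Omega p -> Omega q -> Omega (ut Z) ->
  f (ut Z) = block_mx (f p) (@urb p q (f (ut Z))) 0 (f q)
     :> 'M[C]_(ncsize p + ncsize q).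
Proof.
move=> fI Op Oq OZ.
have h1 : (f (ut Z) : 'M[C]_(ncsize p + ncsize q)) *m col_mx 1%:M 0 = col_mx 1%:M 0 *m f p.
  apply: (fI (ut Z) p OZ Op (col_mx 1%:M 0 : 'M[C]_(ncsize p + ncsize q, ncsize p))) => k.
  apply: etrans (ut_mul_col _ _ _ _) _.
  apply: etrans; last exact/esym/mul_col_mx.
  by rewrite !mulmx1 !mulmx0 !mul0mx mul1mx !addr0.
have h2 : row_mx 0 1%:M *m (f (ut Z) : 'M[C]_(ncsize p + ncsize q)) = f q *m row_mx 0 1%:M.
  apply/esym; apply: (fI q (ut Z) Oq OZ (row_mx 0 1%:M : 'M[C]_(ncsize q, ncsize p + ncsize q))) => k.
  apply: etrans; last exact/esym/row_mul_ut.
  by apply: etrans (@mul_mx_row _ _ _ (ncsize p) (ncsize q) _ _ _) _; rewrite !mulmx1 !mulmx0 !mul0mx mul1mx !add0r.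
rewrite /urb; move: h1 h2; set A : 'M[C]_(ncsize p + ncsize q) := f (ut Z).
rewrite -[A]submxK; rewrite mul_block_col mul_row_block mul_col_mx mul_mx_row.
rewrite !mulmx1 !mulmx0 !mul1mx !mul0mx !addr0 !add0r block_mxKur.
by move=> /eq_col_mx[-> ->] /eq_row_mx[_ ->].
Qed.

Lemma dsum_val Omega f p q : intertwining Omega f ->
  Omega p -> Omega q -> Omega (dsum p q) -> f (dsum p q) = dsum_mx (f p) (f q).
Proof.
move=> fI Op Oq OD; rewrite /dsum_mx [LHS](ut_val fI Op Oq OD).
have h1 : row_mx 1%:M 0 *m (f (dsum p q) : 'M[C]_(ncsize p + ncsize q)) = f p *m row_mx 1%:M 0.
  apply/esym; apply: (fI p (dsum p q) Op OD (row_mx 1%:M 0 : 'M[C]_(ncsize p, ncsize p + ncsize q))) => k.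
  apply: etrans; last exact/esym/row_mul_ut.
  by apply: etrans (@mul_mx_row _ _ _ (ncsize p) (ncsize q) _ _ _) _; rewrite !mulmx1 !mulmx0 !mul0mx mul1mx !addr0.
move: h1; rewrite [X in _ *m X](ut_val fI Op Oq OD) mul_row_block mul_mx_row.
rewrite !mulmx1 !mulmx0 !mul1mx !mul0mx !addr0 => /eq_row_mx[_ h].
by rewrite h.
Qed.

Lemma intertwining_ncfunction Omega f :
  ncset Omega -> intertwining Omega f -> ncfunction Omega f.
Proof.
move=> sO fI; split=> [p q Op Oq|n X S uS OX OX'].
  by apply: (dsum_val fI) => //; exact: sO.
rewrite [RHS]/conj_mx; apply: (canRL (mulmxK uS)).
apply: (fI (ncpoint (fun k => conj_mx S (X k))) (ncpoint X)) => // k.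
by rewrite /nccomp/= /conj_mx mulmxKV.
Qed.

(** diag(T, S) intertwines the two triangular points, so the corner block is
    natural in both diagonal blocks and in Z. *)
Lemma urb_intertwine Omega f p q p' q' Z Z'
    (T : 'M[C]_(ncsize p, ncsize p')) (S : 'M[C]_(ncsize q, ncsize q')) :
  intertwining Omega f -> Omega p -> Omega q -> Omega p' -> Omega q' ->
  Omega (@ut p q Z) -> Omega (@ut p' q' Z') ->
  (forall k, nccomp p k *m T = T *m nccomp p' k) ->
  (forall k, nccomp q k *m S = S *m nccomp q' k) ->
  (forall k, Z k *m S = T *m Z' k) ->
  @urb p q (f (ut Z)) *m S = T *m @urb p' q' (f (ut Z')).
Proof.
move=> fI Op Oq Op' Oq' OZ OZ' hT hS hZ.
have := fI (ut Z) (ut Z') OZ OZ' (block_mx T 0 0 S : 'M[C]_(ncsize p + ncsize q, ncsize p' + ncsize q')).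
rewrite (ut_val fI Op Oq OZ) (ut_val fI Op' Oq' OZ').
rewrite /urb !block_mxKur => h.
have {h} : block_mx (f p) (@urb p q (f (ut Z))) 0 (f q) *m block_mx T 0 0 S =
   block_mx T 0 0 S *m block_mx (f p') (@urb p' q' (f (ut Z'))) 0 (f q').
  apply: h => k.
  apply: etrans (@mulmx_block _ (ncsize p) (ncsize q) (ncsize p) (ncsize q)
    (ncsize p') (ncsize q') _ _ _ _ _ _ _ _) _.
  apply: etrans; last exact/esym/(@mulmx_block _ (ncsize p) (ncsize q) (ncsize p') (ncsize q') (ncsize p') (ncsize q')).
  by rewrite !mulmx0 !mul0mx !addr0 !add0r hT hS hZ.
rewrite !mulmx_block !mulmx0 !mul0mx !addr0 !add0r.
by move=> /eq_block_mx[_ ->].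
Qed.

(** The column (c, 1) intertwines the triangular point with X'. The corner
    block is thus a difference quotient of f, without any limit. *)
Lemma urb_difference Omega f n (X X' : 'I_g -> 'M[C]_n.+1) (c : C) :
  intertwining Omega f -> Omega (ncpoint X) -> Omega (ncpoint X') ->
  let Z := @ut (ncpoint X) (ncpoint X') (fun k => c *: (X' k - X k)) in Omega Z ->
  @urb (ncpoint X) (ncpoint X') (f Z) = c *: (f (ncpoint X') - f (ncpoint X)).
Proof.
move=> fI OX OX' Z OZ.
have := fI Z (ncpoint X') OZ OX' (col_mx c%:M 1%:M : 'M[C]_(n.+1 + n.+1, n.+1)).
rewrite (ut_val fI OX OX' OZ) /urb block_mxKur => h.
have {h} : block_mx (f (ncpoint X)) (@urb (ncpoint X) (ncpoint X') (f Z)) 0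
    (f (ncpoint X')) *m col_mx c%:M 1%:M = col_mx c%:M 1%:M *m f (ncpoint X').
  apply: h => k; apply: etrans (ut_mul_col _ _ _ _) _.
  apply: etrans; last exact/esym/mul_col_mx.
  rewrite !mulmx1 mul1mx; congr col_mx.
  by rewrite mul_scalar_mx mul_mx_scalar -scalerDr addrCA subrr addr0.
rewrite mul_block_col mul_col_mx !mulmx1 => /eq_col_mx[h _].
apply: (@addrI _ (f (ncpoint X) *m c%:M)); rewrite h.
by rewrite scalerBr mul_scalar_mx mul_mx_scalar addrCA subrr addr0.
Qed.

End Intertwining.

(** * Balls around a scalar point *)

Section ScalarBalls.
Context {R : realType} {g : nat} (y : 'I_g -> R[i]).
Local Notation C := R[i].
Local Notation ncspace := (ncspace R g).
Local Notation Y := (scalar_point y).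
Implicit Types (p q : ncspace) (Omega : set ncspace) (t : nctopology).

Lemma opnormN n (A : 'M[C]_n) : opnorm (- A) <= opnorm A.
Proof.
rewrite -scaleN1r; apply: le_trans (opnormZ_le _ _) _.
by rewrite normcN normc1 mul1r.
Qed.

Lemma opnorm_ursubmx m n (A : 'M[C]_(m + n)) v :
  l2norm (ursubmx A *m v) <= opnorm A * l2norm v.
Proof.
have -> : l2norm v = l2norm (col_mx (0 : 'cV[C]_m) v).
  apply: (@pexpIrn _ 2) => //; rewrite ?nnegrE ?l2norm_ge0//.
  by rewrite l2norm_col_mx l2norm0 expr0n add0r.
apply: le_trans (l2norm_mulmx _ _).
rewrite -{2}[A]submxK mul_block_col !mulmx0 !add0r.
by rewrite -(@ler_pXn2r _ 2)// ?nnegrE ?l2norm_ge0// l2norm_col_mx lerDl sqr_ge0.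
Qed.

Lemma opnorm_urb (p q : ncspace) (A : 'M[C]_(ncsize p + ncsize p)) :
  opnorm (@urb R g p p A) <= opnorm A.
Proof. by apply: opnorm_le => [|v]; [exact: opnorm_ge0|exact: opnorm_ursubmx]. Qed.

Lemma opnorm_ut m n (A : 'M[C]_m) (B : 'M[C]_n) (Z : 'M[C]_(m, n)) M :
  opnorm A <= M -> opnorm B <= M ->
  opnorm (block_mx A Z 0 B) <= M + opnorm (block_mx 0 Z 0 0 : 'M[C]_(m + n)).
Proof.
move=> AM BM.
have -> : block_mx A Z 0 B = block_mx A 0 0 B + block_mx 0 Z 0 0.
  by rewrite add_block_mx !addr0 add0r.
by apply: le_trans (opnormD _ _) _; rewrite lerD2r; exact: opnorm_block.
Qed.

Definition sball (e : R) : set ncspace :=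
  [set p | forall k, opnorm (nccomp p k - (y k)%:M) < e].

Definition ypt (n : nat) : ncspace := @ncpoint R g n (fun k => (y k)%:M).

Lemma copies_scalar n : copies Y n = ypt n.
Proof.
elim: n => [//|n IH]; rewrite /= IH /dsum; congr ncpoint.
apply/funext => k; exact/esym/(@scalar_mx_block _ 1 n.+1).
Qed.

Lemma ypt_sball n e : 0 < e -> sball e (ypt n).
Proof. by move=> e0 k; rewrite subrr opnorm0. Qed.

Lemma ypt_in Omega n : ncset Omega -> Omega Y -> Omega (ypt n).
Proof.
move=> sO OY; rewrite -copies_scalar; elim: n => //= n IH; exact: sO.
Qed.

Lemma sball_ncball e : 0 < e -> ncball Y e = sball e.
Proof.
move=> e0; apply/seteqP; split=> [p [n]|[n X] hX].
  rewrite copies_scalar => -[X [-> /tnorm_lt[_ hX]]]; exact: hX.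
by exists n; rewrite copies_scalar; exists X; split=> //; apply/tnorm_lt.
Qed.

Lemma sball_dsum e : ncset (sball e).
Proof.
move=> p q hp hq k.
have -> : nccomp (dsum p q) k - (y k)%:M =
    dsum_mx (nccomp p k - (y k)%:M) (nccomp q k - (y k)%:M).
  by rewrite -dsum_mxB; congr (_ - _); exact: (@scalar_mx_block _ (ncsize p) (ncsize q)).
apply: (@le_lt_trans _ _ (Num.max (opnorm (nccomp p k - (y k)%:M))
    (opnorm (nccomp q k - (y k)%:M)))); last by rewrite gt_max hp hq.
by apply: (@opnorm_block R (ncsize p) (ncsize q)); rewrite le_max lexx ?orbT.
Qed.

Lemma near_sball p e : 0 < e -> sball e p ->
  exists2 d : R, 0 < d & near_pt p d `<=` sball e.
Proof.
move=> e0 hp; pose t := tnorm (fun k => nccomp p k - (y k)%:M).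
have te : t < e by apply/tnorm_lt.
exists (e - t); first by rewrite subr_gt0.
move=> q [X [-> hX]] k; rewrite /nccomp/= -(subrK (nccomp p k) (X k)) -addrA.
apply: le_lt_trans (opnormD _ _) _; rewrite -(subrK t e) ltr_leD//.
exact: (le_bigmax _ (fun k => opnorm (nccomp p k - (y k)%:M)) k).
Qed.

Lemma sball_nbhd t e : 0 < e -> ncnbhd t Y (sball e).
Proof.
move=> e0; split; [exact: sball_dsum| |exact: (@ypt_sball 0)].
case: t => /=; first by apply/open_nearP => p hp; exact: near_sball.
apply/uopen_ncballP => p; rewrite -sball_ncball// => hp.
by have [d d0 sub] := ncball_join hp hp; exists d => // q /sub[].
Qed.

Lemma unbhd_sball Omega : ncnbhd UniformlyOpen Y Omega ->
  exists2 e : R, 0 < e & sball e `<=` Omega.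
Proof.
move=> [_ /uopen_ncballP oO OY]; have [e e0 sub] := oO _ OY.
by exists e => //; rewrite -sball_ncball.
Qed.

(** Size of the strictly triangular part of [ut Z]. *)
Definition utn p q (Z : 'I_g -> 'M[C]_(ncsize p, ncsize q)) : R :=
  \sum_(k < g) opnorm (block_mx 0 (Z k) 0 0 : 'M[C]_(ncsize p + ncsize q)).

Lemma le_utn p q (Z : 'I_g -> 'M[C]_(ncsize p, ncsize q)) k :
  opnorm (block_mx 0 (Z k) 0 0 : 'M[C]_(ncsize p + ncsize q)) <= utn Z.
Proof. by rewrite /utn (bigD1 k)//= lerDl sumr_ge0// => j _; exact: opnorm_ge0. Qed.

Lemma utn_ge0 p q (Z : 'I_g -> 'M[C]_(ncsize p, ncsize q)) : 0 <= utn Z.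
Proof. by apply: sumr_ge0 => j _; exact: opnorm_ge0. Qed.

Lemma utnZ p q (Z : 'I_g -> 'M[C]_(ncsize p, ncsize q)) c :
  utn (fun k => c *: Z k) <= normc c * utn Z.
Proof.
rewrite /utn mulr_sumr; apply: ler_sum => k _.
have -> : block_mx 0 (c *: Z k) 0 0 = c *: (block_mx 0 (Z k) 0 0) :> 'M[C]_(ncsize p + ncsize q).
  by rewrite scale_block_mx !scaler0.
exact: opnormZ_le.
Qed.

Lemma ut_near (p q : ncspace) (X : 'I_g -> 'M[C]_(ncsize p))
    (X' : 'I_g -> 'M[C]_(ncsize q)) (Z : 'I_g -> 'M[C]_(ncsize p, ncsize q)) d e :
  (forall k, opnorm (X k - nccomp p k) < d) ->
  (forall k, opnorm (X' k - nccomp q k) < d) -> d + utn Z <= e ->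
  near_pt (dsum p q) e (@ut R g (ncpoint X) (ncpoint X') Z).
Proof.
move=> hX hX' de; exists (fun k => block_mx (X k) (Z k) 0 (X' k)); split=> // k.
change (opnorm (block_mx (X k) (Z k) 0 (X' k) -
  block_mx (nccomp p k) 0 0 (nccomp q k) : 'M[C]_(ncsize p + ncsize q)) < e).
rewrite opp_block_mx add_block_mx !subr0.
apply: (@le_lt_trans _ _ (Num.max (opnorm (X k - nccomp p k)) (opnorm (X' k - nccomp q k)) + utn Z)).
  set M := Num.max _ _.
  apply: (@le_trans _ _ (M + opnorm (block_mx 0 (Z k) 0 0 : 'M[C]_(ncsize p + ncsize q)))).
    by apply: opnorm_ut; rewrite le_max lexx ?orbT.
  by rewrite lerD2l le_utn.
by apply: lt_le_trans de; rewrite ltrD2r gt_max hX hX'.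
Qed.

Lemma ut_open t Omega p q Z : ncset Omega -> ncopen t Omega -> Omega p -> Omega q ->
  exists2 e : R, 0 < e & forall c : C, normc c < e ->
    Omega (@ut R g p q (fun k => c *: Z k)).
Proof.
move=> sO oO Op Oq; have [e e0 sub] := ncopen_near oO (sO _ _ Op Oq).
have Z1 : 0 < utn Z + 1 by rewrite ltr_wpDl ?utn_ge0.
exists (e / 2 / (utn Z + 1)); first by rewrite !divr_gt0.
move=> c hc; apply: sub; move: p q Op Oq Z Z1 hc => [m X] [n X'] Op Oq Z Z1 hc.
apply: (@ut_near (ncpoint X) (ncpoint X') _ _ _ (e / 2)) => [k|k|].
- by rewrite subrr opnorm0 divr_gt0.
- by rewrite subrr opnorm0 divr_gt0.
rewrite [leRHS]splitr lerD2l; apply: le_trans (utnZ _ _) _.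
move: hc; rewrite ltr_pdivlMr// => /ltW; apply: le_trans.
by rewrite ler_wpM2l ?normc_ge0// lerDl.
Qed.

End ScalarBalls.

(** * Difference quotients at the scalar point *)

Section Derivative.
Context {R : realType} {g : nat} (y : 'I_g -> R[i]).
Local Notation C := R[i].
Local Notation ncspace := (ncspace R g).
Local Notation Y := (scalar_point y).
Local Notation ypt := (@ypt R g y).
Implicit Types (p q : ncspace) (t : nctopology).

Lemma small_scalar (e : R) : 0 < e -> exists2 c : C, c != 0 & normc c < e.
Proof.
move=> e0; exists (e / 2)%:C.
  by rewrite eq_complex /= eqxx andbT; apply/negP => /eqP h; have := divr_gt0 e0 (ltr0n R 2); rewrite h ltxx.
rewrite normc_real ger0_norm ?divr_ge0 ?ltW//.
by rewrite ltr_pdivrMr// ltr_pMr// (ltr_nat R 1 2).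
Qed.

Lemma near_pt_self p e : 0 < e -> near_pt p e p.
Proof.
by move=> e0; exists (tagged p); split=> [|k]; [case: p|rewrite subrr opnorm0].
Qed.

Lemma near_pt_open p e : 0 < e -> open (near_pt p e).
Proof.
case: p => [n P] e0; apply/open_nearP => _ [X [-> hX]].
set p : ncspace := existT _ n P in hX *.
pose s := tnorm (fun k => X k - nccomp p k).
have se : s < e by apply/tnorm_lt.
exists (e - s); first by rewrite subr_gt0.
move=> q [X' [eq hX']]; exists X'; split; first exact: eq.
move=> k; rewrite -(subrK (X k) (X' k)) -addrA.
apply: le_lt_trans (opnormD _ _) _; rewrite -(subrK s e).
have h1 : opnorm (X' k - X k) < e - s := hX' k.
apply: ltr_leD h1 _.
exact: (le_bigmax _ (fun k => opnorm (X k - nccomp p k)) k).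
Qed.

Lemma locally_bounded_near t Omega (f : forall p, 'M[C]_(ncsize p)) p :
  locally_bounded t Omega f -> Omega p ->
  exists e M : R, [/\ 0 < e, near_pt p e `<=` Omega &
    forall q, near_pt p e q -> opnorm (f q) <= M].
Proof.
move=> bf /bf[U [oU Up UO [M hM]]]; have [e e0 sub] := ncopen_near oU Up.
by exists e, M; split=> // q /sub => [/UO|/hM].
Qed.

Lemma near_locally_bounded Omega (f : forall p, 'M[C]_(ncsize p)) :
  (forall p, Omega p -> exists e M : R, [/\ 0 < e, near_pt p e `<=` Omega &
    forall q, near_pt p e q -> opnorm (f q) <= M]) ->
  locally_bounded DisjointUnion Omega f.
Proof.
move=> h p /h[e [M [e0 sub hM]]]; exists (near_pt p e); split=> //.
- exact: near_pt_open.
- exact: near_pt_self.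
- by exists M.
Qed.

Section Construction.
Variables (t : nctopology) (Omega : set ncspace) (f : forall p, 'M[C]_(ncsize p)).
Hypotheses (sO : ncset Omega) (oO : ncopen t Omega) (OY : Omega Y).
Hypothesis fI : intertwining Omega f.

Let Oy n : Omega (ypt n). Proof. exact: ypt_in. Qed.

Definition dpt k q (c : C) : ncspace :=
  @ut R g (ypt (tag q)) q (fun j => c *: ((j == k)%:R%:M : 'M[C]_(ncsize q))).

(** The quotient below does not depend on the scalar, see [dleftE]; a scalar is
    chosen for each q because no scalar need suit a whole domain. *)
Definition dscal k q : C := xget 1 [set c | c != 0 /\ Omega (dpt k q c)].

(** The k-th left derivative at y: the corner block of f at [[y, c e_k], [0,
    q]], divided by c. *)
Definition dleft k q : 'M[C]_(ncsize q) :=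
  (dscal k q)^-1 *: @urb R g (ypt (tag q)) q (f (dpt k q (dscal k q))).

Lemma dscalP k q : Omega q -> dscal k q != 0 /\ Omega (dpt k q (dscal k q)).
Proof.
move=> Oq; rewrite /dscal.
have [e e0 he] := @ut_open R g t Omega (ypt (tag q)) q
  (fun j => (j == k)%:R%:M) sO oO (Oy (tag q)) Oq.
have [c c0 ce] := small_scalar e0.
by case: xgetP => [c' -> //|/(_ c)[]]; split=> //; exact: he.
Qed.

(** Every T intertwines scalar points, so the corner block is linear in the
    increment. *)
Lemma dleft_scale m n q Z E (T : 'M[C]_(m.+1, n.+1)) : Omega q ->
  Omega (@ut R g (ypt m) q Z) -> Omega (@ut R g (ypt n) q E) ->
  (forall k, Z k = T *m E k) ->
  @urb R g (ypt m) q (f (ut Z)) = T *m @urb R g (ypt n) q (f (ut E)).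
Proof.
move=> Oq OZ OE hZ.
have := @urb_intertwine R g Omega f (ypt m) q (ypt n) q Z E T 1%:M fI (Oy m) Oq (Oy n) Oq OZ OE.
rewrite mulmx1; apply=> k; first exact/esym/scalar_mxC.
  by rewrite mulmx1 mul1mx.
by rewrite mulmx1 hZ.
Qed.

Lemma dleftE k q c : Omega q -> c != 0 -> Omega (dpt k q c) ->
  dleft k q = c^-1 *: @urb R g (ypt (tag q)) q (f (dpt k q c)).
Proof.
move=> Oq c0 Oc; have [d0 Od] := dscalP k Oq; rewrite /dleft.
rewrite (@dleft_scale (tag q) (tag q) q _ (fun j => c *: (j == k)%:R%:M) (dscal k q / c)%:M)//.
  by rewrite mul_scalar_mx scalerA mulrA mulVf// mul1r.
by move=> j; rewrite mul_scalar_mx scalerA divfK.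
Qed.

Lemma dleft_intertwining k : intertwining Omega (dleft k).
Proof.
move=> p q Op Oq S hS; rewrite /dleft.
have [c0 Oc] := dscalP k Op; have [d0 Od] := dscalP k Oq.
have := @urb_intertwine R g Omega f (ypt (tag p)) p (ypt (tag q)) q _ _
  ((dscal k p / dscal k q) *: S) S fI (Oy _) Op (Oy _) Oq Oc Od.
move=> h; rewrite -scalemxAl h//.
- by rewrite -scalemxAl scalerA mulrA mulVf// mul1r scalemxAr.
- by move=> j; exact/esym/scalar_mxC.
- move=> j; rewrite -!scalemxAl -!scalemxAr scalerA divfK//.
  by congr (_ *: _); exact/esym/scalar_mxC.
Qed.

Lemma f_ypt n : f (ypt n) = (f Y 0 0)%:M.
Proof.
have h j : col j (f (ypt n)) = col j (f Y 0 0)%:M.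
  rewrite !colE mul_scalar_mx.
  have hS k : nccomp (ypt n) k *m (delta_mx j 0 : 'M[C]_(n.+1, 1)) =
    delta_mx j 0 *m nccomp Y k by exact/esym/scalar_mxC.
  have e := fI (Oy n) OY hS.
  refine (etrans e _).
  by apply: etrans (congr1 _ (@mx11_scalar _ (f Y))) _; rewrite mul_mx_scalar.
by apply/matrixP => i j; have /colP/(_ i) := h j; rewrite !mxE.
Qed.

(** The increment X - y is T times the column E that stacks all unit
    increments, so f(X) - f(y), a corner block by [urb_difference], is a linear
    combination of the corner blocks at the unit increments. *)
Lemma dleft_sum q : Omega q ->
  f q = (f Y 0 0)%:M + \sum_k (nccomp q k - (y k)%:M) *m dleft k q.
Proof.
move: q => [n X] Oq; set q := existT _ n X.
pose s := (\sum_(k < g) n.+1)%N.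
(* The zero row keeps the size positive when g = 0. *)
pose E (j : 'I_g) : 'M[C]_(1 + s, n.+1) :=
  col_mx 0 (\mxcol_(k < g) (j == k)%:R%:M).
pose Z (j : 'I_g) : 'M[C]_n.+1 := X j - (y j)%:M.
pose T (Z : 'I_g -> 'M[C]_n.+1) : 'M[C]_(n.+1, 1 + s) := row_mx 0 (\mxrow_(k < g) Z k).
have TE Z' j : T Z' *m E j = Z' j.
  rewrite /T /E mul_row_col mul0mx add0r mul_mxrow_mxcol (bigD1 j)//= eqxx mulmx1.
  by rewrite big1 ?addr0// => k kj; rewrite eq_sym (negbTE kj) mul_mx_scalar scale0r.
have [e e0 he] := @ut_open R g t Omega (ypt s) q E sO oO (Oy s) Oq.
have [c c0 /he Oc] := small_scalar e0.
have [e' e'0 he'] := @ut_open R g t Omega (ypt n) q Z sO oO (Oy n) Oq.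
have [c' c'0 /he' Oc'] := small_scalar e'0.
set D : 'M[C]_(1 + s, n.+1) := @urb R g (ypt s) q (f (@ut R g (ypt s) q (fun j => c *: E j))).
have dE k : dleft k q = c^-1 *: (T (fun j => (j == k)%:R%:M) *m D).
  have [d0 Od] := dscalP k Oq; rewrite /dleft.
  rewrite (@dleft_scale n s q _ (fun j => c *: E j)
    ((dscal k q / c) *: T (fun j => (j == k)%:R%:M)))//.
    by rewrite -scalemxAl scalerA mulrA mulVf// mul1r.
  by move=> j; rewrite -scalemxAl -scalemxAr TE scalerA divfK.
have := @urb_difference R g Omega f n (fun k => (y k)%:M) X c' fI (Oy n) Oq Oc'.
rewrite (@dleft_scale n s q _ (fun j => c *: E j) ((c' / c) *: T Z)) //; last first.
  by move=> j; rewrite -scalemxAl -scalemxAr TE scalerA divfK.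
rewrite -/D -[ncpoint (fun k => _)]/(ypt n) f_ypt => h.
have {}h : f q - (f Y 0 0)%:M = c^-1 *: (T Z *m D).
  apply: (scalerI c'0); apply: etrans (esym h) _.
  by rewrite -scalemxAl scalerA.
rewrite addrC; apply/eqP; rewrite -subr_eq; apply/eqP; apply: etrans h _.
under [RHS]eq_bigr do rewrite dE -scalemxAr mulmxA.
rewrite -scaler_sumr -mulmx_suml; congr (_ *: (_ *m _)).
have Tk k : Z k *m T (fun j => (j == k)%:R%:M) = T (fun j => Z k *m (j == k)%:R%:M).
  by rewrite /T mul_mx_row mulmx0 mul_mxrow.
apply: etrans (esym (eq_bigr _ (fun k _ => Tk k))).
pose B k : 'M[C]_(n.+1, s) := \mxrow_(j < g) (Z k *m ((j == k)%:R%:M : 'M[C]_n.+1)).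
have -> : \sum_k T (fun j => Z k *m (j == k)%:R%:M) =
    row_mx (0 : 'M[C]_(n.+1, 1)) (\sum_k B k).
  elim/big_ind2 : _ => [|A A' U U' -> ->|//]; first by rewrite (@row_mx0 _ _ 1 s).
  by rewrite add_row_mx addr0.
congr row_mx; rewrite /B -mxrow_sum; apply: eq_mxrow => j.
rewrite (bigD1 j)//= eqxx mulmx1 big1 ?addr0// => k kj.
by rewrite eq_sym (negbTE kj) mul_mx_scalar scale0r.
Qed.

Lemma dleft_bound k q c M : Omega q -> c != 0 -> Omega (dpt k q c) ->
  opnorm (f (dpt k q c)) <= M -> opnorm (dleft k q) <= normc c^-1 * M.
Proof.
move=> Oq c0 Oc hM; rewrite (dleftE Oq c0 Oc).
apply: le_trans (opnormZ_le _ _) _; rewrite ler_wpM2l ?normc_ge0//.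
by apply: le_trans hM; exact: (@opnorm_urb R g q q).
Qed.

End Construction.
End Derivative.

Section AnalyticDerivative.
Context {R : realType} {g : nat} (y : 'I_g -> R[i]).
Local Notation C := R[i].
Local Notation ncspace := (ncspace R g).
Local Notation Y := (scalar_point y).
Local Notation ypt := (@ypt R g y).
Implicit Types (p q : ncspace) (t : nctopology).

Lemma ana_intertwining t (f : anafun t Y) : intertwining (ncdom f) (ncval f).
Proof.
by have [sO _ _] := ncdom_nbhd f; exact: ncfunction_intertwining (ncval_ncfunction f).
Qed.
Arguments ana_intertwining {t} f.

Lemma intertwiningS Omega Omega' (f : forall p, 'M[C]_(ncsize p)) :
  Omega' `<=` Omega -> intertwining Omega f -> intertwining Omega' f.
Proof. by move=> sub fI p q /sub Op /sub Oq; exact: fI. Qed.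

Lemma opnorm_ur_scalar n (c : C) :
  opnorm (block_mx 0 c%:M 0 0 : 'M[C]_(n + n)) <= normc c.
Proof.
apply: opnorm_le => [|v]; first exact: normc_ge0.
rewrite -[v]vsubmxK mul_block_col !mul0mx add0r addr0 mul_scalar_mx.
rewrite -(@ler_pXn2r _ 2)// ?nnegrE ?mulr_ge0 ?normc_ge0 ?l2norm_ge0//.
rewrite exprMn !l2norm_col_mx l2norm0 expr0n addr0 l2normZ exprMn.
by rewrite ler_wpM2l ?sqr_ge0// lerDr sqr_ge0.
Qed.

Lemma utn_delta q k (c : C) :
  @utn R g (ypt (tag q)) q (fun j => c *: (j == k)%:R%:M) <= normc c.
Proof.
rewrite /utn (bigD1 k)//= eqxx big1 => [|j jk].
  rewrite addr0 scale_scalar_mx mulr1; exact: (@opnorm_ur_scalar (ncsize q)).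
rewrite (negbTE jk) scale_scalar_mx mulr0 raddf0.
have h : opnorm (block_mx 0 0 0 0 : 'M[C]_(ncsize q + ncsize q)) = 0.
  by rewrite block_mx0 opnorm0.
exact: h.
Qed.

(** One scalar c serves a whole neighborhood of p, so a bound of f near the
    triangular point bounds the derivative. *)
Lemma ana_left_DU (f : anafun DisjointUnion Y) k :
  locally_bounded DisjointUnion (ncdom f) (dleft y (ncdom f) (ncval f) k).
Proof.
have [sO oO OY] := ncdom_nbhd f; apply: near_locally_bounded => p Op.
have OD : ncdom f (dsum (ypt (tag p)) p) by exact: (sO _ _ (ypt_in (tag p) sO OY) Op).
have [e [M [e0 sub hM]]] := locally_bounded_near (@ncval_bounded _ _ _ _ f) OD.
have [d d0 dsub] := ncopen_near oO Op.
have e2 : 0 < e / 2 by rewrite divr_gt0.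
have [c c0 ce] := small_scalar e2.
exists (Num.min (e / 2) d), (normc c^-1 * M); split; first by rewrite lt_min e2.
  by move=> q [X [-> hX]]; apply: dsub; exists X; split=> // j;
    apply: lt_le_trans (hX j) _; rewrite ge_min lexx orbT.
move=> q [X [eq hX]]; rewrite eq.
have Oq : ncdom f (ncpoint X).
  by apply: dsub; exists X; split=> // j; apply: lt_le_trans (hX j) _; rewrite ge_min lexx orbT.
have nD : near_pt (dsum (ypt (tag p)) p) e (dpt y k (ncpoint X) c).
  apply: (@ut_near R g (ypt (tag p)) p (fun k => (y k)%:M) X _ (e / 2)).
  - by move=> j; rewrite subrr opnorm0.
  - by move=> j; apply: lt_le_trans (hX j) _; rewrite ge_min lexx.
  - rewrite [leRHS]splitr lerD2l; apply: le_trans (ltW ce).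
    exact: (utn_delta p).
apply: (@dleft_bound R g y DisjointUnion (ncdom f) f sO oO OY (ana_intertwining f) k (ncpoint X) c) => //.
- exact: sub.
- exact: hM.
Qed.

Lemma dpt_sball q k (c : C) (e : R) : sball y (e / 2) q -> normc c < e / 2 ->
  sball y e (dpt y k q c).
Proof.
move=> hq ce j.
have -> : nccomp (dpt y k q c) j - (y j)%:M =
    block_mx 0 (c *: (j == k)%:R%:M) 0 (nccomp q j - (y j)%:M) :> 'M[C]_(ncsize q + ncsize q).
  change ((block_mx (y j)%:M (c *: (j == k)%:R%:M) 0 (nccomp q j)
    : 'M[C]_(ncsize q + ncsize q)) - (y j)%:M =
    block_mx 0 (c *: (j == k)%:R%:M) 0 (nccomp q j - (y j)%:M)).
  by rewrite [X in _ - X]scalar_mx_block opp_block_mx add_block_mx !subrr !subr0.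
apply: (@le_lt_trans _ _ (opnorm (nccomp q j - (y j)%:M) + normc c)); last first.
  by rewrite [ltRHS]splitr ltrD.
set A := nccomp q j - (y j)%:M; set Z := c *: _.
have h0 : opnorm (0 : 'M[C]_(ncsize q)) <= opnorm A by rewrite opnorm0 opnorm_ge0.
have h1 := @opnorm_ut R (ncsize q) (ncsize q) 0 A Z (opnorm A) h0 (lexx _).
apply: (le_trans h1); rewrite lerD2l; apply: le_trans (utn_delta q k c).
exact: (@le_utn R g (ypt (tag q)) q (fun j => c *: (j == k)%:R%:M) j).
Qed.

Lemma unbhd_bounded (f : anafun UniformlyOpen Y) :
  exists e M : R, [/\ 0 < e, sball y e `<=` ncdom f &
    forall q, sball y e q -> opnorm (f q) <= M].
Proof.
have [sO oO OY] := ncdom_nbhd f.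
have [U [oU UY UO [M hM]]] := @ncval_bounded _ _ _ _ f _ OY.
have /uopen_ncballP/(_ _ UY)[e e0 sub] := oU.
exists e, M; split=> //.
  by move=> q; rewrite -(@sball_ncball R g y e e0) => /sub/UO.
by move=> q; rewrite -(@sball_ncball R g y e e0) => /sub/hM.
Qed.

Lemma globally_bounded t Omega (f : forall p, 'M[C]_(ncsize p)) M :
  ncopen t Omega -> (forall q, Omega q -> opnorm (f q) <= M) ->
  locally_bounded t Omega f.
Proof. by move=> oO hM p Op; exists Omega; split=> //; exists M. Qed.

Lemma sball_le e e' : e <= e' -> sball y e `<=` sball y e'.
Proof. by move=> le p hp k; exact: lt_le_trans (hp k) le. Qed.

(** Both topologies need a bound of the derivatives: locally, the triangular
    points stay near a given one; uniformly in the size, the ball is halved so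
    that a single c serves all sizes. *)
Lemma ana_left t (f : anafun t Y) :
  exists (h : 'I_g -> anafun t Y) Omega,
    [/\ ncnbhd t Y Omega, Omega `<=` ncdom f, forall k, Omega `<=` ncdom (h k) &
     forall p, Omega p -> f p =
       (f Y 0 0)%:M + \sum_k (nccomp p k - (y k)%:M) *m h k p].
Proof.
have [sO oO OY] := ncdom_nbhd f; have fI := ana_intertwining f.
have dI k := dleft_intertwining sO oO OY fI k.
have dE q := @dleft_sum R g y t (ncdom f) f sO oO OY fI q.
case: t f sO oO OY fI dI dE => f sO oO OY fI dI dE.
  exists (fun k => AnaFun (ncdom_nbhd f) (intertwining_ncfunction sO (dI k))
    (@ana_left_DU f k)), (ncdom f).
  by split; [exact: ncdom_nbhd|by []|by move=> k p|exact: dE].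
have [e [M [e0 sub hM]]] := unbhd_bounded f.
have e2 : 0 < e / 2 by rewrite divr_gt0.
have [sB oB BY] := sball_nbhd y UniformlyOpen e2.
have [c c0 ce] := small_scalar e2.
have sub2 : sball y (e / 2) `<=` ncdom f.
  by move=> q /(sball_le (ltW _))/sub; apply; rewrite ltr_pdivrMr// ltr_pMr// (ltr_nat R 1 2).
have bd k : locally_bounded UniformlyOpen (sball y (e / 2)) (dleft y (ncdom f) (ncval f) k).
  apply: (@globally_bounded _ _ _ (normc c^-1 * M)) => // q hq.
  have nq : sball y e (dpt y k q c) by exact: dpt_sball.
  by apply: (@dleft_bound R g y UniformlyOpen (ncdom f) f sO oO OY fI k q c) => //;
    [exact: sub2|exact: sub|exact: hM].
exists (fun k => AnaFun (sball_nbhd y UniformlyOpen e2)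
  (intertwining_ncfunction sB (intertwiningS sub2 (dI k))) (bd k)), (sball y (e / 2)).
by split; [exact: sball_nbhd|exact: sub2|by move=> k p|by move=> p /sub2; exact: dE].
Qed.

Lemma coord_intertwining k Omega :
  intertwining Omega (fun p : ncspace => nccomp p k - (y k)%:M).
Proof.
move=> p q _ _ S hS; rewrite mulmxBl mulmxBr hS; congr (_ - _).
exact/esym/scalar_mxC.
Qed.

Definition ana_coord t k : anafun t Y :=
  AnaFun (sball_nbhd y t ltr01)
    (intertwining_ncfunction (@sball_dsum R g y 1) (@coord_intertwining k _))
    (globally_bounded (let: And3 _ oB _ := sball_nbhd y t ltr01 in oB)
       (fun q hq => ltW (hq k))).

End AnalyticDerivative.
Arguments ana_intertwining {R g y t} f.

(** * Inverses of nc functions *)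

Section Inverse.
Context {R : realType} {g : nat} (y : 'I_g -> R[i]).
Local Notation C := R[i].
Local Notation ncspace := (ncspace R g).
Local Notation Y := (scalar_point y).
Local Notation ypt := (@ypt R g y).
Implicit Types (p q : ncspace) (t : nctopology).

Lemma unitmx_inj n (B : 'M[C]_n) :
  (forall v : 'cV_n, B *m v = 0 -> v = 0) -> B \in unitmx.
Proof.
move=> hB; rewrite -unitmx_tr -row_free_unit -kermx_eq0; apply/eqP/row_matrixP => i.
rewrite row0 -[row i _]trmxK -[RHS](@trmx0 C n 1); congr (_^T); apply: hB.
apply: trmx_inj; rewrite trmx_mul trmxK trmx0.
by apply/sub_kermxP; exact: row_sub.
Qed.

(** B is bounded below by half the lower bound of A. *)
Lemma perturb_inverse n (A B : 'M[C]_n) (K : R) : A \in unitmx -> 0 < K ->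
  opnorm (invmx A) <= K -> opnorm (B - A) <= (K * 2)^-1 ->
  B \in unitmx /\ opnorm (invmx B) <= K * 2.
Proof.
move=> uA K0 hA hBA.
have key v : l2norm v <= K * 2 * l2norm (B *m v).
  have h1 : l2norm v <= K * (l2norm (B *m v) + (K * 2)^-1 * l2norm v).
    rewrite -{1}(mulKmx uA v); apply: le_trans (l2norm_mulmx _ _) _.
    apply: (@le_trans _ _ (K * l2norm (A *m v))); first by rewrite ler_wpM2r ?l2norm_ge0.
    rewrite ler_wpM2l ?(ltW K0)//.
    have -> : A *m v = B *m v + (A - B) *m v by rewrite mulmxBl addrCA subrr addr0.
    apply: le_trans (l2normD _ _) _; apply: lerD; first exact: lexx.
    have hAB : opnorm (A - B) <= (K * 2)^-1.
      by apply: le_trans hBA; rewrite -opprB; exact: opnormN.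
    apply: le_trans (l2norm_mulmx _ _) _.
    exact: (ler_wpM2r (l2norm_ge0 v) hAB).
  rewrite mulrDr mulrA invfM mulrA divff ?gt_eqF// mul1r in h1.
  move: h1; rewrite -lerBlDr => h1.
  have e : l2norm v = (l2norm v - 2^-1 * l2norm v) * 2.
    rewrite mulrBl -mulrA [l2norm v * 2]mulrC mulrA mulVf ?pnatr_eq0// mul1r.
    by rewrite mulr_natl mulr2n addrK.
  by rewrite e [leRHS]mulrAC; exact: (ler_wpM2r (ler0n R 2) h1).
have uB : B \in unitmx.
  apply: unitmx_inj => v Bv; apply: l2norm_eq0; apply/eqP.
  by rewrite eq_le l2norm_ge0 andbT; have := key v; rewrite Bv l2norm0 mulr0.
split=> //; apply: opnorm_le => [|v]; first by rewrite mulr_ge0 ?(ltW K0).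
by apply: le_trans (key _) _; rewrite mulKVmx.
Qed.

Lemma opnorm_ur0 n (Z : 'M[C]_n) :
  opnorm (block_mx 0 Z 0 0 : 'M[C]_(n + n)) <= opnorm Z.
Proof.
apply: opnorm_le => [|v]; first exact: opnorm_ge0.
rewrite -[v]vsubmxK mul_block_col !mul0mx add0r addr0.
apply: (@le_trans _ _ (opnorm Z * l2norm (dsubmx v))).
  apply: le_trans (l2norm_mulmx _ _).
  rewrite -(@ler_pXn2r _ 2)// ?nnegrE ?l2norm_ge0//.
  by rewrite l2norm_col_mx l2norm0 expr0n addr0.
rewrite ler_wpM2l ?opnorm_ge0// -(@ler_pXn2r _ 2)// ?nnegrE ?l2norm_ge0//.
by rewrite l2norm_col_mx lerDr sqr_ge0.
Qed.

(** A bound at one triangular point is a Lipschitz estimate, since the corner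
    block is a difference quotient. *)
Lemma nc_lipschitz Omega (f : forall p, 'M[C]_(ncsize p)) n
    (X X' : 'I_g -> 'M[C]_n.+1) (c : C) M :
  intertwining Omega f -> Omega (ncpoint X) -> Omega (ncpoint X') -> c != 0 ->
  let Z := @ut R g (ncpoint X) (ncpoint X') (fun k => c *: (X' k - X k)) in Omega Z ->
  opnorm (f Z) <= M ->
  opnorm (f (ncpoint X') - f (ncpoint X)) <= normc c^-1 * M.
Proof.
move=> fI OX OX' c0 Z OZ hM.
have h := @urb_difference R g Omega f n X X' c fI OX OX' OZ.
have -> : f (ncpoint X') - f (ncpoint X) =
    c^-1 *: @urb R g (ncpoint X) (ncpoint X') (f Z).
  by rewrite h scalerA mulVf// scale1r.
apply: le_trans (opnormZ_le _ _) _; rewrite ler_wpM2l ?normc_ge0//.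
by apply: le_trans hM; exact: (@opnorm_urb R g (ncpoint X) (ncpoint X')).
Qed.

Lemma inverse_intertwining Omega (f : forall p, 'M[C]_(ncsize p)) :
  intertwining Omega f -> (forall p, Omega p -> f p \in unitmx) ->
  intertwining Omega (fun p => invmx (f p)).
Proof.
move=> fI uf p q Op Oq S hS.
apply: (canLR (mulKmx (uf _ Op))); rewrite mulmxA.
by apply: (canRL (mulmxK (uf _ Oq))); exact/esym/fI.
Qed.

Lemma scaled_scalar (K : R) : 0 < K -> exists2 c : C, c != 0 & normc c = K.
Proof.
move=> K0; exists K%:C; last by rewrite normc_real ger0_norm ?ltW.
by rewrite eq_complex /= eqxx andbT gt_eqF.
Qed.

(** The estimate [nc_lipschitz] with |c| = 2 K M' makes the oscillation of f
    less than half the lower bound 1 / K of f(p). *)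
Lemma inverse_near t (f : anafun t Y) p : ncdom f p -> f p \in unitmx ->
  locally_bounded DisjointUnion (ncdom f) (ncval f) ->
  exists e M : R, [/\ 0 < e, near_pt p e `<=` [set q | ncdom f q /\ f q \in unitmx] &
    forall q, near_pt p e q -> opnorm (invmx (f q)) <= M].
Proof.
case: p => n P; set p : ncspace := ncpoint P => Op up bf.
have [sO oO OY] := ncdom_nbhd f.
have [e [M [e0 sub hM]]] := locally_bounded_near bf (sO _ _ Op Op).
have [d d0 dsub] := ncopen_near oO Op.
pose K := opnorm (invmx (f p)) + 1.
have K0 : 0 < K by rewrite ltr_wpDl ?opnorm_ge0.
pose M' := Num.max M 1.
have M'0 : 0 < M' by rewrite lt_max ltr01 orbT.
have cK0 : 0 < K * 2 * M' by rewrite !mulr_gt0.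
have [c c0 cK] := scaled_scalar cK0.
pose b := e / 2 / (K * 2 * M' * g.+1%:R).
have b0 : 0 < b by rewrite !divr_gt0// mulr_gt0.
have key q : near_pt p (Num.min (e / 2) (Num.min b d)) q ->
    ncdom f q /\ f q \in unitmx /\ opnorm (invmx (f q)) <= K * 2.
  move=> [X [-> hX]].
  have hX1 k : opnorm (X k - P k) < e / 2.
    by apply: lt_le_trans (hX k) _; rewrite ge_min lexx.
  have hX2 k : opnorm (X k - P k) < b.
    by apply: lt_le_trans (hX k) _; rewrite ge_min ge_min lexx orbT.
  have Oq : ncdom f (ncpoint X).
    by apply: dsub; exists X; split=> // k; apply: lt_le_trans (hX k) _;
      rewrite ge_min ge_min lexx !orbT.
  split=> //.
  apply: (@perturb_inverse n.+1 (f (ncpoint P)) (f (ncpoint X)) K up K0).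
    by rewrite /K lerDl ler01.
  have nZ : near_pt (dsum (ncpoint P) (ncpoint P)) e
      (@ut R g (ncpoint P) (ncpoint X) (fun k => c *: (X k - P k))).
    have hP k : opnorm (P k - P k) < e / 2 by rewrite subrr opnorm0 divr_gt0.
    apply: (@ut_near R g (ncpoint P) (ncpoint P) P X _ (e / 2) e hP hX1).
    rewrite [leRHS]splitr lerD2l; apply: le_trans (@utnZ R g (ncpoint P) (ncpoint X) _ _) _.
    rewrite cK; apply: (@le_trans _ _ (K * 2 * M' * (g.+1%:R * b))); last first.
      by rewrite /b mulrA mulrC divfK// gt_eqF// mulr_gt0.
    rewrite ler_wpM2l ?(ltW cK0)//.
    apply: (@le_trans _ _ (\sum_(k < g) b)).
      by apply: ler_sum => k _; apply: le_trans (ltW (hX2 k)); exact: opnorm_ur0.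
    rewrite sumr_const card_ord -[leLHS]mulr_natl ler_wpM2r ?(ltW b0)//.
    by rewrite ler_nat.
  have hL := @nc_lipschitz (ncdom f) f n P X c M' (ana_intertwining f) Op Oq c0 (sub _ nZ).
  apply: le_trans (hL _) _; first by apply: le_trans (hM _ nZ) _; rewrite le_max lexx.
  by rewrite normcV cK invfM -mulrA mulVf ?mulr1// gt_eqF.
exists (Num.min (e / 2) (Num.min b d)), (K * 2); split.
- by rewrite !lt_min divr_gt0// b0 d0.
- by move=> q /key[? []].
- by move=> q /key[_ []].
Qed.

Lemma scalar_unit n (a : C) : a != 0 -> (a%:M : 'M[C]_n.+1) \in unitmx.
Proof. by move=> a0; rewrite unitmxE det_scalar unitrX// unitfE. Qed.

(** As [inverse_near], around all points y of all sizes at once: f(y) is the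
    same scalar in every size, so the radius does not depend on the size. *)
Lemma unbhd_inverse (f : anafun UniformlyOpen Y) : f Y 0 0 != 0 ->
  exists e M : R, [/\ 0 < e, sball y e `<=` [set q | ncdom f q /\ f q \in unitmx] &
    forall q, sball y e q -> opnorm (invmx (f q)) <= M].
Proof.
move=> a0; have [sO oO OY] := ncdom_nbhd f; have fI := ana_intertwining f.
have [e [M [e0 sub hM]]] := unbhd_bounded f.
set a := f Y 0 0 in a0.
have na0 := normc_gt0 a0.
pose K := (normc a)^-1; have K0 : 0 < K by rewrite invr_gt0.
pose M' := Num.max M 1.
have M'0 : 0 < M' by rewrite lt_max ltr01 orbT.
have cK0 : 0 < K * 2 * M' by rewrite !mulr_gt0.
have [c c0 cK] := scaled_scalar cK0.
pose b := e / 2 / (K * 2 * M').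
have b0 : 0 < b by rewrite !divr_gt0.
have key q : sball y (Num.min (e / 2) b) q ->
    ncdom f q /\ f q \in unitmx /\ opnorm (invmx (f q)) <= K * 2.
  move: q => [n X] hX.
  have hX1 k : opnorm (X k - (y k)%:M) < e / 2.
    by apply: lt_le_trans (hX k) _; rewrite ge_min lexx.
  have hX2 k : opnorm (X k - (y k)%:M) < b.
    by apply: lt_le_trans (hX k) _; rewrite ge_min lexx orbT.
  have Oq : ncdom f (ncpoint X).
    apply: sub => k; apply: lt_trans (hX1 k) _.
    by rewrite ltr_pdivrMr// ltr_pMr// (ltr_nat R 1 2).
  split=> //.
  have fy : f (ypt n) = a%:M by exact: (f_ypt sO OY fI).
  apply: (@perturb_inverse n.+1 (f (ypt n)) (f (ncpoint X)) K).
  - by rewrite fy scalar_unit.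
  - exact: K0.
  - rewrite fy invmx_scalar -scalemx1; apply: le_trans (opnormZ_le _ _) _.
    by rewrite normcV ler_piMr ?(ltW K0)// opnorm1_le.
  have nZ : sball y e (@ut R g (ypt n) (ncpoint X) (fun k => c *: (X k - (y k)%:M))).
    move=> k.
    change (opnorm ((block_mx (y k)%:M (c *: (X k - (y k)%:M)) 0 (X k)
      : 'M[C]_(n.+1 + n.+1)) - (y k)%:M) < e).
    rewrite [X in _ - X]scalar_mx_block opp_block_mx add_block_mx !subrr !subr0.
    set A := X k - (y k)%:M; set Z := c *: _.
    have h0 : opnorm (0 : 'M[C]_n.+1) <= opnorm A by rewrite opnorm0 opnorm_ge0.
    have h1 := @opnorm_ut R n.+1 n.+1 0 A Z (opnorm A) h0 (lexx _).
    apply: (le_lt_trans h1); rewrite [ltRHS]splitr; apply: ltr_leD; first exact: hX1.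
    apply: le_trans (opnorm_ur0 _) _; apply: le_trans (opnormZ_le _ _) _.
    rewrite cK; apply: (@le_trans _ _ (K * 2 * M' * b)).
      by rewrite ler_wpM2l ?(ltW cK0)// ltW// hX2.
    by rewrite /b mulrC divfK// gt_eqF.
  have hL := @nc_lipschitz (ncdom f) f n _ X c M' fI (ypt_in n sO OY) Oq c0 (sub _ nZ).
  apply: le_trans (hL _) _; first by apply: le_trans (hM _ nZ) _; rewrite le_max lexx.
  by rewrite normcV cK invfM -mulrA mulVf ?mulr1// gt_eqF.
exists (Num.min (e / 2) b), (K * 2); split.
- by rewrite !lt_min divr_gt0// b0.
- by move=> q /key[? []].
- by move=> q /key[_ []].
Qed.

Lemma ana_inverse t (f : anafun t Y) : f Y 0 0 != 0 ->
  exists (h : anafun t Y), ncdom h `<=` ncdom f /\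
    forall p, ncdom h p -> f p \in unitmx /\ h p = invmx (f p).
Proof.
move=> a0; have [sO oO OY] := ncdom_nbhd f; have fI := ana_intertwining f.
case: t f a0 sO oO OY fI => f a0 sO oO OY fI.
  pose D := [set q | ncdom f q /\ f q \in unitmx].
  have sD : ncset D.
    move=> p q [Op up] [Oq uq]; have OD := sO _ _ Op Oq; split=> //.
    rewrite (dsum_val fI Op Oq OD) /dsum_mx unitmxE.
    by rewrite [\det _](@det_ublock _ (ncsize p) (ncsize q)) unitrM -!unitmxE up uq.
  have bf := @ncval_bounded _ _ _ _ f.
  have oD : ncopen DisjointUnion D.
    apply/open_nearP => p [Op up]; have [e [M [e0 sub _]]] := inverse_near Op up bf.
    by exists e.
  have DY : D Y.
    split=> //; rewrite [f Y]mx11_scalar; exact: scalar_unit.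
  have bD : locally_bounded DisjointUnion D (fun p => invmx (f p)).
    by apply: near_locally_bounded => p [Op up]; exact: inverse_near.
  have iD : intertwining D (fun p => invmx (f p)).
    by apply: inverse_intertwining => [|p []//]; apply: intertwiningS fI => p [].
  exists (AnaFun (And3 sD oD DY) (intertwining_ncfunction sD iD) bD).
  by split=> [p []//|p /= []].
have [e [M [e0 sub hM]]] := unbhd_inverse a0.
have [sB oB BY] := sball_nbhd y UniformlyOpen e0.
have iD : intertwining (sball y e) (fun p => invmx (f p)).
  by apply: inverse_intertwining => [|p /sub[]//]; apply: intertwiningS fI => p /sub[].
exists (AnaFun (And3 sB oB BY) (intertwining_ncfunction sB iD) (globally_bounded oB hM)).
by split=> [p /sub[]//|p /= /sub[]].
Qed.

End Inverse.

(** * Transposition *)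

Section Transposition.
Context {R : realType} {g : nat} (y : 'I_g -> R[i]).
Local Notation C := R[i].
Local Notation ncspace := (ncspace R g).
Local Notation Y := (scalar_point y).
Implicit Types (p q : ncspace) (t : nctopology).

(** Duality: |u|^2 = (A w)^T v for u = A^T v and w the conjugate of u. *)
Lemma opnorm_tr n (A : 'M[C]_n) : opnorm A^T <= opnorm A.
Proof.
apply: opnorm_le => [|v]; first exact: opnorm_ge0.
have [->|v0] := eqVneq (l2norm (A^T *m v)) 0.
  by rewrite mulr_ge0 ?opnorm_ge0 ?l2norm_ge0.
have vp : 0 < l2norm (A^T *m v) by rewrite lt_neqAle eq_sym v0 l2norm_ge0.
set u := A^T *m v in v0 vp *.
pose w : 'cV[C]_n := \col_i (u i 0)^*.
have normJ (z : C) : normc z^* = normc z by exact/complexI/(norm_conjC z).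
have hz (z : C) : z^* * z = (normc z ^+ 2)%:C by rewrite mulrC -normCK rmorphXn.
have wu : l2norm w = l2norm u.
  by rewrite /l2norm; congr Num.sqrt; apply: eq_bigr => i _; rewrite mxE normJ.
have e1 : l2norm u ^+ 2 = normc ((w^T *m u) 0 0).
  have -> : (w^T *m u) 0 0 = (l2norm u ^+ 2)%:C.
    rewrite l2norm_sqr rmorph_sum mxE; apply: eq_bigr => i _.
    by apply: etrans (hz _); rewrite !mxE.
  by rewrite normc_real ger0_norm ?sqr_ge0.
have e2 : (w^T *m u) 0 0 = \sum_i (A *m w) i 0 * v i 0.
  have -> : w^T *m u = (A *m w)^T *m v by rewrite /u mulmxA trmx_mul.
  by rewrite mxE; apply: eq_bigr => i _; rewrite mxE.
have : l2norm u ^+ 2 <= opnorm A * l2norm v * l2norm u.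
  rewrite e1 e2; apply: le_trans (le_normc_sum _) _.
  under eq_bigr do rewrite normcM.
  apply: (@le_trans _ _ (l2norm (A *m w) * l2norm v)).
    have h := cauchy_schwarz (fun i => normc ((A *m w) i 0)) (fun i => normc (v i 0)).
    rewrite -!l2norm_sqr -exprMn in h.
    rewrite -(@ler_pXn2r _ 2)// ?nnegrE ?mulr_ge0 ?l2norm_ge0//.
    by apply: sumr_ge0 => i _; rewrite mulr_ge0 ?normc_ge0.
  rewrite mulrAC ler_wpM2r ?l2norm_ge0// -wu; exact: l2norm_mulmx.
by rewrite expr2 ler_pM2r.
Qed.

Definition tp p : ncspace := @ncpoint R g (tag p) (fun k => (nccomp p k)^T).

Lemma tpK p : tp (tp p) = p.
Proof.
by case: p => n X; congr (existT _ n _); apply/funext => k; exact: trmxK.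
Qed.

Lemma tp_dsum p q : tp (dsum p q) = dsum (tp p) (tp q).
Proof.
congr (existT _ _ _); apply/funext => k.
change ((block_mx (nccomp p k) 0 0 (nccomp q k))^T =
  block_mx (nccomp p k)^T 0 0 (nccomp q k)^T).
by rewrite tr_block_mx !trmx0.
Qed.

Lemma tp_copies p n : tp (copies p n) = copies (tp p) n.
Proof. by elim: n => //= n IH; rewrite tp_dsum IH. Qed.

Lemma tp_Y : tp Y = Y.
Proof. by congr (existT _ _ _); apply/funext => k; exact: tr_scalar_mx. Qed.

Lemma tp_near p e q : near_pt (tp p) e q -> near_pt p e (tp q).
Proof.
move=> [X [-> hX]]; exists (fun k => (X k)^T); split=> [|k]; first exact: erefl.
have -> : (X k)^T - nccomp p k = (X k - nccomp (tp p) k)^T.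
  by rewrite linearB /=; congr (_ - _); exact/esym/trmxK.
exact: le_lt_trans (opnorm_tr _) (hX k).
Qed.

Lemma tp_ncball p e q : ncball (tp p) e q -> ncball p e (tp q).
Proof.
move=> [n]; rewrite -tp_copies => -[X [-> /tnorm_lt[e0 hX]]].
exists n, (fun k => (X k)^T); split; [exact: erefl|apply/tnorm_lt; split=> [|k]; first exact: e0].
have -> : (X k)^T - nccomp (copies p n) k = (X k - nccomp (tp (copies p n)) k)^T.
  by rewrite linearB /=; congr (_ - _); exact/esym/trmxK.
exact: le_lt_trans (opnorm_tr _) (hX k).
Qed.

Lemma tp_open t (Omega : set ncspace) : ncopen t Omega -> ncopen t (tp @^-1` Omega).
Proof.
case: t => /=.
  move=> /open_nearP h; apply/open_nearP => p Op.
  have [e e0 sub] := h (tp p) Op; exists e; first exact: e0.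
  by move=> q hq; apply: sub; apply: tp_near; rewrite tpK.
move=> /uopen_ncballP h; apply/uopen_ncballP => p Op.
have [e e0 sub] := h (tp p) Op; exists e; first exact: e0.
by move=> q hq; apply: sub; apply: tp_ncball; rewrite tpK.
Qed.

Lemma tp_nbhd t (Omega : set ncspace) : ncnbhd t Y Omega -> ncnbhd t Y (tp @^-1` Omega).
Proof.
move=> [sO oO OY]; split; last by rewrite /= tp_Y.
- by move=> p q Op Oq; rewrite /= tp_dsum; exact: sO.
- exact: tp_open.
Qed.

Section Transpose.
Variables (t : nctopology) (f : anafun t Y).

Definition tpval p : 'M[C]_(ncsize p) := (f (tp p))^T.

Lemma tpval_intertwining : intertwining (tp @^-1` ncdom f) tpval.
Proof.
move=> p q Op Oq S hS; apply: trmx_inj; rewrite !trmx_mul /tpval !trmxK.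
apply/esym; apply: (ana_intertwining f (tp q) (tp p) Oq Op) => k.
by rewrite -!trmx_mul hS.
Qed.

Lemma tpval_bounded : locally_bounded t (tp @^-1` ncdom f) tpval.
Proof.
move=> p /(@ncval_bounded _ _ _ _ f)[U [oU Up UO [M hM]]].
exists (tp @^-1` U); split=> //; first exact: tp_open.
  by move=> q /UO.
by exists M => q /hM; apply: le_trans; exact: opnorm_tr.
Qed.

(** Transposition reverses products, so it exchanges factorizations with the
    coordinates on the left and on the right. *)
Definition ana_tr : anafun t Y :=
  let: And3 sD oD DY := tp_nbhd (ncdom_nbhd f) in
  AnaFun (And3 sD oD DY) (intertwining_ncfunction sD tpval_intertwining) tpval_bounded.

Lemma ana_trE p : ana_tr p = (f (tp p))^T.
Proof. by rewrite /ana_tr; case: (tp_nbhd _). Qed.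

End Transpose.
End Transposition.

(** * Polynomial expansions in one complex variable *)

Section Expansions.
Context {R : realType}.
Local Notation C := R[i].
Implicit Types (h k : C -> C) (p q : {poly C}) (L : nat).

Definition bigO L h := exists d M : R, [/\ 0 < d, 0 <= M &
  forall z, normc z < d -> normc (h z) <= M * normc z ^+ L].

(** Expansions to finite order replace holomorphy: they are stable under ring
    operations and suffice for the maximum principle. *)
Definition approx L h p := bigO L (fun z => h z - p.[z]).

Definition expands L h := exists p, approx L h p.

Lemma bigO_eq L h k : (exists2 d : R, 0 < d & forall z, normc z < d -> h z = k z) ->
  bigO L h -> bigO L k.
Proof.
move=> [e e0 hk] [d [M [d0 M0 hM]]]; exists (Num.min d e), M.
by split=> //; [rewrite lt_min d0|move=> z; rewrite lt_min => /andP[zd /hk <-]; exact: hM].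
Qed.

Lemma bigOD L h k : bigO L h -> bigO L k -> bigO L (fun z => h z + k z).
Proof.
move=> [d [M [d0 M0 hM]]] [e [N [e0 N0 hN]]]; exists (Num.min d e), (M + N).
split; [by rewrite lt_min d0|exact: addr_ge0|move=> z].
rewrite lt_min => /andP[zd ze]; rewrite mulrDl; apply: le_trans (le_normcD _ _) _.
by apply: lerD; [exact: hM|exact: hN].
Qed.

Lemma bigOM L L' h k : bigO L h -> bigO L' k -> bigO (L + L') (fun z => h z * k z).
Proof.
move=> [d [M [d0 M0 hM]]] [e [N [e0 N0 hN]]]; exists (Num.min d e), (M * N).
split; [by rewrite lt_min d0|exact: mulr_ge0|move=> z].
rewrite lt_min => /andP[zd ze]; rewrite normcM exprD mulrACA.
by apply: ler_pM; rewrite ?normc_ge0//; [exact: hM|exact: hN].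
Qed.

Lemma bigO_leq L L' h : (L' <= L)%N -> bigO L h -> bigO L' h.
Proof.
move=> LL' [d [M [d0 M0 hM]]]; exists (Num.min d 1), M.
split; [by rewrite lt_min d0 ltr01|by []|move=> z].
rewrite lt_min => /andP[zd z1]; apply: le_trans (hM _ zd) _.
by rewrite ler_wpM2l// ler_wiXn2l// ?normc_ge0// ltW.
Qed.

Lemma bigO_const c : bigO 0 (fun=> c).
Proof.
by exists 1, (normc c); split; rewrite ?normc_ge0// => z _; rewrite mulr1.
Qed.

Lemma bigO_id : bigO 1 id.
Proof. by exists 1, 1; split=> // z _; rewrite mul1r expr1. Qed.

Lemma bigO_poly p : bigO 0 (horner p).
Proof.
elim/poly_ind : p => [|p c IH].
  by apply: bigO_eq (bigO_const 0); exists 1 => // z _; rewrite horner0.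
have := bigOD (bigO_leq (leq0n 1) (bigOM IH bigO_id)) (bigO_const c).
by apply: bigO_eq; exists 1 => // z _; rewrite !hornerE.
Qed.

Lemma bigO_polyXn p L : bigO L (horner (p * 'X^L)).
Proof.
elim: L => [|L IH]; first by rewrite expr0 mulr1; exact: bigO_poly.
have := bigOM IH bigO_id; rewrite addn1.
by apply: bigO_eq; exists 1 => // z _; rewrite [in RHS]exprSr mulrA !hornerE.
Qed.

Lemma bigON L h : bigO L h -> bigO L (fun z => - h z).
Proof.
move=> hh; have := bigOM (bigO_const (-1)) hh; rewrite add0n.
by apply: bigO_eq; exists 1 => // z _; rewrite mulN1r.
Qed.

Lemma approx_eq L h k p : (exists2 d : R, 0 < d & forall z, normc z < d -> h z = k z) ->
  approx L h p -> approx L k p.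
Proof.
by move=> [d d0 hk]; apply: bigO_eq; exists d => // z zd; rewrite hk.
Qed.

Lemma approxD L h k p q : approx L h p -> approx L k q ->
  approx L (fun z => h z + k z) (p + q).
Proof.
move=> hp kq; apply: bigO_eq (bigOD hp kq); exists 1 => // z _.
by rewrite hornerD opprD addrACA.
Qed.

Lemma approx0 L h p : approx L h p -> bigO 0 h.
Proof.
move=> hp; have := bigOD (bigO_leq (leq0n L) hp) (bigO_poly p).
by apply: bigO_eq; exists 1 => // z _; rewrite subrK.
Qed.

Lemma approxM L h k p q : approx L h p -> approx L k q ->
  approx L (fun z => h z * k z) (p * q).
Proof.
move=> hp kq.
have h1 := bigOM hp (approx0 kq); have h2 := bigOM (bigO_poly p) kq.
rewrite addn0 in h1; rewrite add0n in h2.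
apply: bigO_eq (bigOD h1 h2); exists 1 => // z _.
by rewrite hornerM mulrBl mulrBr addrA subrK.
Qed.

Lemma approx_const L c : approx L (fun=> c) c%:P.
Proof.
exists 1, 0; split=> // z _; rewrite hornerC subrr normc0 mul0r//.
Qed.

Lemma approx_sum L (I : Type) (r : seq I) (h : I -> C -> C) (p : I -> {poly C}) :
  (forall i, approx L (h i) (p i)) ->
  approx L (fun z => \sum_(i <- r) h i z) (\sum_(i <- r) p i).
Proof.
move=> hp; elim: r => [|i r IH].
  rewrite big_nil; apply: (approx_eq _ (approx_const L 0)).
  by exists 1 => // z _; rewrite big_nil.
rewrite big_cons; apply: (approx_eq _ (approxD (hp i) IH)).
by exists 1 => // z _; rewrite big_cons.
Qed.

Lemma approx_prod L (I : Type) (r : seq I) (h : I -> C -> C) (p : I -> {poly C}) :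
  (forall i, approx L (h i) (p i)) ->
  approx L (fun z => \prod_(i <- r) h i z) (\prod_(i <- r) p i).
Proof.
move=> hp; elim: r => [|i r IH].
  rewrite big_nil; apply: (approx_eq _ (approx_const L 1)).
  by exists 1 => // z _; rewrite big_nil.
rewrite big_cons; apply: (approx_eq _ (approxM (hp i) IH)).
by exists 1 => // z _; rewrite big_cons.
Qed.

Lemma approx_det L n (A : C -> 'M[C]_n) (P : 'M[{poly C}]_n) :
  (forall i j, approx L (fun z => A z i j) (P i j)) ->
  approx L (fun z => \det (A z)) (\det P).
Proof.
move=> hA; rewrite /determinant; apply: approx_sum => s; apply: approxM.
  by have := approx_const L ((-1) ^+ perm.odd_perm s); rewrite rmorphXn /= rmorphN1.
by apply: approx_prod => i; exact: hA.
Qed.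

Lemma expandsM L h k : expands L h -> expands L k -> expands L (fun z => h z * k z).
Proof. by move=> [p hp] [q kq]; exists (p * q); exact: approxM. Qed.

Lemma expandsX L h n : expands L h -> expands L (fun z => h z ^+ n).
Proof.
move=> hL; elim: n => [|n IH]; first by exists 1%:P; exact: approx_const.
have [p hp] := expandsM hL IH; exists p; apply: (approx_eq _ hp).
by exists 1 => // z _; rewrite exprS.
Qed.

Lemma approx_take L h p : approx L h p -> approx L h (take_poly L p).
Proof.
move=> hp; have := bigOD hp (bigO_polyXn (drop_poly L p) L).
apply: bigO_eq; exists 1 => // z _.
rewrite -{1}[p](poly_take_drop L) hornerD opprD addrA subrK//.
Qed.

Lemma approx_value L h p : (0 < L)%N -> approx L h p -> h 0 = p.[0].
Proof.
move=> L0 [d [M [d0 M0 hM]]]; apply/eqP; rewrite -subr_eq0; apply/eqP.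
apply: eq0_normc; apply/eqP; rewrite eq_le normc_ge0 andbT.
by have := hM 0; rewrite normc0 expr0n gtn_eqF// mulr0; exact.
Qed.

Lemma expands_continuous L h : (0 < L)%N -> expands L h ->
  bigO 1 (fun z => h z - h 0).
Proof.
move=> L0 [p hp]; rewrite (approx_value L0 hp).
have h1 := bigO_leq L0 hp.
have /factor_theorem[q pq] : root (p - (p.[0])%:P) 0 by rewrite rootE !hornerE subrr.
have := bigOD h1 (bigO_polyXn q 1); rewrite expr1.
apply: bigO_eq; exists 1 => // z _.
rewrite polyC0 subr0 in pq; rewrite -pq hornerD hornerN hornerC.
by rewrite addrA subrK.
Qed.

Lemma expands_inv a : a != 0 -> expands 3 (fun z => (a + z)^-1).
Proof.
move=> a0; have na0 := normc_gt0 a0.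
pose p : {poly C} := (a^-1)%:P - (a^-1 ^+ 2) *: 'X + (a^-1 ^+ 3) *: 'X^2.
exists p, (normc a / 2), (normc (a^-1 ^+ 3) * (normc a / 2)^-1).
split; [by rewrite divr_gt0|by rewrite mulr_ge0 ?normc_ge0// invr_ge0 divr_ge0// ltW|move=> z hz].
have az : normc a / 2 <= normc (a + z).
  have := le_normcD (a + z) (- z); rewrite addrK normcN => h.
  rewrite -(lerD2r (normc z)); apply: le_trans h.
  by rewrite [leRHS]splitr lerD2l ltW.
have az0 : 0 < normc (a + z) by apply: lt_le_trans az; rewrite divr_gt0.
have az1 : a + z != 0 by apply: contraTN az0 => /eqP ->; rewrite normc0 ltxx.
have -> : (a + z)^-1 - p.[z] = - (a^-1 ^+ 3 * (a + z)^-1 * z ^+ 3).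
  rewrite /p !(hornerD, hornerN, hornerZ, hornerC, hornerX, hornerXn); field; rewrite az1 a0//.
have -> : normc (- (a^-1 ^+ 3 * (a + z)^-1 * z ^+ 3)) =
    normc (a^-1 ^+ 3) * (normc (a + z))^-1 * normc z ^+ 3.
  rewrite normcN normcM normcM normcV; congr (_ * _).
  by rewrite !exprS !expr0 !mulr1 !normcM.
rewrite ler_wpM2r ?exprn_ge0 ?normc_ge0// ler_wpM2l ?normc_ge0// lef_pV2 ?posrE//.
by rewrite divr_gt0.
Qed.

End Expansions.

(** * Maximum principle and flat functions on the disc *)

Section MaximumPrinciple.
Context {R : realType}.
Local Notation C := R[i].
Implicit Types (h k : C -> C).

Lemma sqr_normc_ReIm (z : C) :
  normc z ^+ 2 = complex.Re z ^+ 2 + complex.Im z ^+ 2.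
Proof. by case: z => a b; rewrite /normc sqr_sqrtr ?addr_ge0 ?sqr_ge0. Qed.

Lemma normc_le_ReIm (z : C) : normc z <= `|complex.Re z| + `|complex.Im z|.
Proof.
rewrite -(@ler_pXn2r _ 2)// ?nnegrE ?addr_ge0 ?normc_ge0//.
rewrite sqr_normc_ReIm sqrrD !real_normK ?num_real//.
by rewrite -addrA lerD2l lerDr mulrn_wge0// mulr_ge0.
Qed.

Lemma Re_le_normc (z : C) : `|complex.Re z| <= normc z /\ `|complex.Im z| <= normc z.
Proof.
split; rewrite -(@ler_pXn2r _ 2)// ?nnegrE ?normc_ge0// sqr_normc_ReIm
  real_normK ?num_real//; by rewrite ?lerDl ?lerDr sqr_ge0.
Qed.

(** Compactness of the closed unit disc. *)
Lemma disc_cluster (F : set_system C) : ProperFilter F ->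
  F [set z | normc z <= 1] ->
  exists2 a : C, normc a <= 1 &
    forall A (d : R), F A -> 0 < d -> exists2 z, A z & normc (z - a) < d.
Proof.
move=> FF FD.
pose K := [set v : 'rV[R]_2 | forall i, `[(-1 : R), 1]%classic (v ord0 i)].
have cK : compact K by apply: (@rV_compact _ _ (fun=> `[(-1 : R), 1]%classic)) => _; exact: segment_compact.
pose em (z : C) : 'rV[R]_2 := \row_i (if i == 0 then complex.Re z else complex.Im z).
have FK : (em @ F) K.
  apply: (@filterS _ F _ _ _ _ FD) => z /= z1 i.
  suff : -1 <= em z ord0 i <= 1 by [].
  rewrite /em mxE -ler_norml.
  by case: ifP => _; [have [h _] := Re_le_normc z|have [_ h] := Re_le_normc z];
    exact: le_trans h z1.
have [v [Kv cv]] := cK _ (fmap_proper_filter em FF) FK.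
pose a : C := v ord0 0 +i* v ord0 1.
have key A (d : R) : F A -> 0 < d -> exists2 z, A z & normc (z - a) < d.
  move=> FA d0; have d2 : 0 < d / 2 by rewrite divr_gt0.
  have FA' : (em @ F) [set em z | z in A].
    by apply: (@filterS _ F _ _ _ _ FA) => z Az /=; exists z.
  have nv : nbhs v [set w : 'rV[R]_2 | forall i, `|w ord0 i - v ord0 i| < d / 2].
    exists (fun _ i => [set x : R | `|x - v ord0 i| < d / 2]) => [i j|w hw i].
      apply/nbhs_ballP; exists (d / 2) => //= x; rewrite /ball /= distrC.
      by rewrite (ord1 i).
    exact: hw.
  have [w [[z Az <-] hw]] := cv _ _ FA' nv.
  exists z => //; apply: le_lt_trans (normc_le_ReIm _) _.
  rewrite [ltRHS]splitr; case: z hw {Az} => x y hw /=.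
  by apply: ltrD; [have := hw 0|have := hw 1]; rewrite /em /= !mxE.
exists a => //; rewrite leNgt; apply/negP => a1.
have [|z z1 hz] := key _ (normc a - 1) FD; first by rewrite subr_gt0.
have {}z1 : normc z <= 1 := z1.
have h := le_normcD (a - z) z; rewrite subrK in h.
have e : normc (a - z) = normc (z - a) by rewrite -normcN opprB.
by rewrite e in h; lra.
Qed.

Lemma disc_uniform (Q : R -> C -> Prop) :
  (forall d d' z, d' <= d -> Q d z -> Q d' z) ->
  (forall a, normc a <= 1 -> exists2 d : R, 0 < d &
     forall z, normc z <= 1 -> normc (z - a) < d -> Q d z) ->
  exists2 d : R, 0 < d & forall z, normc z <= 1 -> Q d z.
Proof.
move=> Qle hQ; apply: contrapT => hn.
pose B (d : R) := [set z : C | normc z <= 1 /\ ~ Q d z].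
pose F := filter_from [set d : R | 0 < d] B.
have FF : ProperFilter F.
  apply: filter_from_proper; last first.
    move=> d d0; apply: contrapT => h; apply: hn; exists d => // z z1.
    by apply: contrapT => nQ; apply: h; exists z.
  apply: filter_from_filter; first by exists 1 => /=.
  move=> d d' /= d0 d'0; exists (Num.min d d'); first by rewrite /= lt_min d0.
  move=> z [z1 nQ]; split; split=> //; apply: contra_not nQ; apply: Qle.
    by rewrite ge_min lexx.
  by rewrite ge_min lexx orbT.
have FD : F [set z | normc z <= 1] by exists 1 => //= z [].
have [a a1 ha] := disc_cluster FF FD.
have [d d0 hd] := hQ a a1.
have Bd : F (B d) by exists d.
by have [z [z1 nQ] za] := ha _ _ Bd d0; apply: nQ; exact: hd.
Qed.

(** The superlevel sets generate a filter; its cluster points are maxima by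
    upper semicontinuity. *)
Lemma disc_max (Phi : C -> R) :
  (forall a (e : R), normc a <= 1 -> 0 < e -> exists2 d : R, 0 < d &
     forall z, normc z <= 1 -> normc (z - a) < d -> Phi z < Phi a + e) ->
  exists2 a, normc a <= 1 & forall z, normc z <= 1 -> Phi z <= Phi a.
Proof.
move=> usc.
pose B (b : C) := [set z : C | normc z <= 1 /\ Phi b <= Phi z].
pose F := filter_from [set b : C | normc b <= 1] B.
have n0 : normc (0 : C) <= 1 by rewrite normc0 ler01.
have FF : ProperFilter F.
  apply: filter_from_proper; last by move=> b b1; exists b; split.
  apply: filter_from_filter; first by exists 0.
  move=> b b' /= b1 b'1; case: (leP (Phi b) (Phi b')) => bb'.
    by exists b' => // z [z1 h]; split; split=> //; exact: le_trans h.
  by exists b => // z [z1 h]; split; split=> //; apply: le_trans h; exact: ltW.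
have FD : F [set z | normc z <= 1] by exists 0 => //= z [].
have [a a1 ha] := disc_cluster FF FD.
exists a => // b b1; apply/ler_addgt0Pr => e e0.
have [d d0 hd] := usc a e a1 e0.
have Bb : F (B b) by exists b.
have [z [z1 bz] za] := ha _ _ Bb d0.
by apply: le_trans bz _; exact/ltW/hd.
Qed.

Lemma expands_near h a (e : R) L : (0 < L)%N -> expands L (fun z => h (a + z)) -> 0 < e ->
  exists2 d : R, 0 < d & forall z, normc (z - a) < d -> normc (h z - h a) < e.
Proof.
move=> L0 /(expands_continuous L0)[d [M [d0 M0 hM]]] e0.
exists (Num.min d (e / (M + 1))).
  by rewrite lt_min d0 divr_gt0// ltr_wpDl.
move=> z; rewrite lt_min => /andP[zd zM].
have := hM _ zd; rewrite subrKC addr0 expr1 => /le_lt_trans; apply.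
move: zM; rewrite ltr_pdivlMr ?ltr_wpDl// => h1.
apply: le_lt_trans h1; rewrite mulrDr mulr1 mulrC lerDl; exact: normc_ge0.
Qed.

(** Four points at distance r stand for the circle: the mean of |p|^2 over them
    already has no cross terms when p is quadratic. *)
Lemma four_points (c0 c1 c2 : C) (r : R) :
  let p (z : C) := c0 + c1 * z + c2 * z ^+ 2 in
  normc (p r%:C) ^+ 2 + normc (p (- r%:C)) ^+ 2 +
  normc (p (0 +i* r)) ^+ 2 + normc (p (0 +i* (- r))) ^+ 2 =
  4 * (normc c0 ^+ 2 + normc c1 ^+ 2 * r ^+ 2 + normc c2 ^+ 2 * r ^+ 4).
Proof.
move=> p; rewrite !sqr_normc_ReIm /p !expr2 {p}.
case: c0 => a0 b0; case: c1 => a1 b1; case: c2 => a2 b2 /=; ring.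
Qed.

(** Otherwise |k(z)|^2 + e |z|^2 has an interior maximum for small e. Its mean
    over four points at distance r exceeds the maximum by e r^2 up to an error
    of order r^3, by the quadratic expansion of k; no integral formula is
    needed. *)
Lemma maximum_principle k (M : R) :
  (forall a, normc a <= 1 -> expands 3 (fun z => k (a + z))) ->
  (forall a, normc a = 1 -> normc (k a) <= M) ->
  forall a, normc a <= 1 -> normc (k a) <= M.
Proof.
move=> hk hM a0 a01; rewrite leNgt; apply/negP => Mk.
have M0 : 0 <= M.
  by apply: le_trans (hM 1 _); [exact: normc_ge0|exact: normc1].
pose e := (normc (k a0) ^+ 2 - M ^+ 2) / 2.
have e0 : 0 < e by rewrite divr_gt0// subr_gt0 ltr_pXn2r// nnegrE ?normc_ge0.
pose Phi z := normc (k z) ^+ 2 + e * normc z ^+ 2.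
have usc (a : C) (d : R) : normc a <= 1 -> 0 < d -> exists2 b : R, 0 < b &
     forall z, normc z <= 1 -> normc (z - a) < b -> Phi z < Phi a + d.
  move=> a1 d0; pose N := normc (k a) + 1 + normc (k a).
  have N0 : 0 < N by rewrite ltr_wpDr ?normc_ge0// ltr_wpDl ?normc_ge0.
  pose eta := Num.min 1 (d / 2 / N).
  have eta0 : 0 < eta by rewrite lt_min ltr01 !divr_gt0.
  have [b b0 hb] := expands_near (isT : (0 < 3)%N) (hk a a1) eta0.
  exists (Num.min b (d / 2 / (e * 2))).
    by rewrite lt_min b0 !divr_gt0// mulr_gt0.
  move=> z z1; rewrite lt_min => /andP[/hb]; rewrite lt_min => /andP[h1 h2] h3.
  have t1 : normc (k z) <= normc (k a) + normc (k z - k a).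
    by have := le_normcD (k a) (k z - k a); rewrite subrKC.
  have t2 : normc z <= normc a + normc (z - a).
    by have := le_normcD a (z - a); rewrite subrKC.
  have e2 : 0 < e * 2 by exact: mulr_gt0.
  move: h2 h3; rewrite (ltr_pdivlMr _ _ N0) (ltr_pdivlMr _ _ e2) => h2 h3.
  have p1 := normc_ge0 (k z); have p2 := normc_ge0 (k a).
  have p3 := normc_ge0 (k z - k a); have p4 := normc_ge0 (z - a).
  have p5 := normc_ge0 z; have p6 := normc_ge0 a.
  have s1 : normc (k z) ^+ 2 - normc (k a) ^+ 2 <= normc (k z - k a) * N.
    have -> : normc (k z) ^+ 2 - normc (k a) ^+ 2 =
      (normc (k z) - normc (k a)) * (normc (k z) + normc (k a)) by ring.
    have [le|lt] := leP (normc (k z)) (normc (k a)).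
      apply: (@le_trans _ _ 0); last by rewrite mulr_ge0// ltW.
      by rewrite mulr_le0_ge0// ?addr_ge0// subr_le0.
    by apply: ler_pM; rewrite ?subr_ge0 ?addr_ge0// ?(ltW lt)//; rewrite /N; lra.
  have s2 : normc z ^+ 2 - normc a ^+ 2 <= normc (z - a) * 2.
    have -> : normc z ^+ 2 - normc a ^+ 2 =
      (normc z - normc a) * (normc z + normc a) by ring.
    have [le|lt] := leP (normc z) (normc a).
      apply: (@le_trans _ _ 0); last by rewrite mulr_ge0.
      by rewrite mulr_le0_ge0// ?addr_ge0// subr_le0.
    by apply: ler_pM; rewrite ?subr_ge0 ?addr_ge0// ?(ltW lt)//; lra.
  rewrite /Phi.
  have s3 : e * (normc z ^+ 2 - normc a ^+ 2) <= e * (normc (z - a) * 2).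
    by rewrite ler_wpM2l// ltW.
  have s4 : e * (normc (z - a) * 2) = normc (z - a) * (e * 2) by ring.
  lra.
have [a a1 amax] := disc_max usc.
have aint : normc a < 1.
  rewrite lt_neqAle a1 andbT; apply/eqP => ea.
  have h1 := amax a0 a01; have h2 := hM a ea.
  have h3 : normc (k a) ^+ 2 <= M ^+ 2 by rewrite ler_pXn2r ?nnegrE ?normc_ge0.
  have h4 : 0 <= e * normc a0 ^+ 2 by rewrite mulr_ge0 ?sqr_ge0// ltW.
  rewrite /Phi ea expr1n mulr1 in h1.
  have : normc (k a0) ^+ 2 - M ^+ 2 = e * 2 by rewrite /e divfK.
  lra.
clearbody e.
have [p0 /approx_take hp] := hk a a1.
set p := take_poly 3 p0 in hp.
have pE z : p.[z] = p`_0 + p`_1 * z + p`_2 * z ^+ 2.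
  rewrite (@horner_coef_wide _ 3) ?size_take_poly// !big_ord_recl big_ord0 /=.
  by rewrite addr0 addrA expr0 mulr1 expr1.
have [d [N [d0 N0 hN]]] := hp.
pose B := normc p`_0 + normc p`_1 + normc p`_2.
have B0 : 0 <= B by rewrite !addr_ge0 ?normc_ge0.
pose r := Num.min (Num.min (d / 2) ((1 - normc a) / 2)) (Num.min 1 (e / (2 * B * N + 1))).
have D0 : 0 < 2 * B * N + 1 by rewrite ltr_wpDl// !mulr_ge0.
have r0 : 0 < r.
  have a2 : 0 < 1 - normc a by rewrite subr_gt0.
  by rewrite !lt_min ltr01 !divr_gt0.
have [rd ra r1 re] : [/\ r < d, normc a + r <= 1, r <= 1 & r * (2 * B * N + 1) <= e].
  split.
  - apply: (@le_lt_trans _ _ (d / 2)); last lra.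
    by rewrite /r !ge_min lexx.
  - have : r <= (1 - normc a) / 2 by rewrite /r !ge_min lexx orbT.
    lra.
  - by rewrite /r !ge_min lexx !orbT.
  - by rewrite -ler_pdivlMr// /r !ge_min lexx !orbT.
have ka : k a = p`_0.
  by have := approx_value (isT : (0 < 3)%N) hp; rewrite addr0 pE mulr0 expr0n /= mulr0 !addr0.
have key z : normc z = r ->
    normc p.[z] ^+ 2 - 2 * B * N * r ^+ 3 + e * normc (a + z) ^+ 2 <= Phi a.
  move=> zr; have az1 : normc (a + z) <= 1.
    by apply: le_trans (le_normcD _ _) _; rewrite zr.
  apply: le_trans (amax _ az1); rewrite /Phi lerD2r.
  have h1 := hN z; rewrite zr in h1; have {}h1 := h1 rd.
  have h2 : normc p.[z] <= normc (k (a + z)) + normc (k (a + z) - p.[z]).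
    have := le_normcD (k (a + z)) (p.[z] - k (a + z)); rewrite subrKC.
    by rewrite -[X in _ + X]normcN opprB.
  have h3 : normc p.[z] <= B.
    rewrite pE /B; apply: le_trans (le_normcD _ _) _; apply: lerD.
      apply: le_trans (le_normcD _ _) _; rewrite lerD2l normcM zr ler_piMr ?normc_ge0//.
    rewrite normcM expr2 normcM zr ler_piMr ?normc_ge0// -expr2.
    by rewrite exprn_ile1 // ltW.
  set P := normc p.[z] in h2 h3 *; set Kz := normc (k (a + z)) in h2 *.
  have P0 : 0 <= P := normc_ge0 _; have K0 : 0 <= Kz := normc_ge0 _.
  set E := N * r ^+ 3 in h1.
  have h4 : P <= Kz + E by apply: le_trans h2 _; rewrite lerD2l.
  have E0 : 0 <= E by rewrite mulr_ge0// exprn_ge0// ltW.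
  have -> : 2 * B * N * r ^+ 3 = 2 * B * E by rewrite /E; ring.
  have [PE|PE] := leP P E; first by nra.
  have : (P - E) ^+ 2 <= Kz ^+ 2 by rewrite ler_pXn2r ?nnegrE//; lra.
  nra.
have n1 : normc r%:C = r by rewrite normc_real ger0_norm// ltW.
have n2 : normc (- r%:C) = r by rewrite normcN.
have n3 : normc (0 +i* r) = r.
  by rewrite /normc expr0n add0r sqrtr_sqr ger0_norm// ltW.
have n4 : normc (0 +i* (- r)) = r.
  by rewrite /normc expr0n add0r sqrtr_sqr normrN ger0_norm// ltW.
have k1 := key _ n1; have k2 := key _ n2; have k3 := key _ n3; have k4 := key _ n4.
have f1 := four_points p`_0 p`_1 p`_2 r.
have f2 := four_points a 1 0 r.
cbv zeta in f1, f2.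
rewrite -!pE in f1; rewrite !mul0r !addr0 !mul1r normc0 normc1 in f2.
rewrite /Phi ka in k1 k2 k3 k4.
have c1 : 0 <= normc p`_1 ^+ 2 * r ^+ 2 by rewrite mulr_ge0 ?sqr_ge0.
have c2 : 0 <= normc p`_2 ^+ 2 * r ^+ 4.
  by rewrite mulr_ge0 ?sqr_ge0// exprn_ge0// ltW.
have : 4 * e * r ^+ 2 <= 4 * (2 * B * N) * r ^+ 3.
  rewrite expr0n mul0r addr0 expr1n mul1r in f2.
  have f3 := congr1 (fun x => e * x) f2; rewrite /= !mulrDr in f3.
  lra.
have r2 : 0 < r ^+ 2 by rewrite exprn_gt0.
have -> : 4 * (2 * B * N) * r ^+ 3 = 4 * (r * (2 * B * N)) * r ^+ 2 by ring.
rewrite ler_pM2r//; move: re; rewrite mulrDr mulr1; lra.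
Qed.

(** Schwarz's lemma for every order: h / z^L still has expansions because h is
    flat at 0, so the maximum principle gives |h(a)| <= M |a|^L for all L. *)
Lemma flat_disc h : (forall a, normc a <= 1 -> expands 3 (fun z => h (a + z))) ->
  (forall L, bigO L h) -> forall a, normc a <= 1 -> h a = 0.
Proof.
move=> hh hflat.
have [b b1 bmax] : exists2 b, normc b <= 1 & forall z, normc z <= 1 -> normc (h z) <= normc (h b).
  apply: disc_max => a e a1 e0.
  have [d d0 hd] := expands_near (isT : (0 < 3)%N) (hh a a1) e0.
  exists d => // z _ /hd zd; apply: le_lt_trans (_ : _ <= normc (h a) + normc (h z - h a)) _.
    by have := le_normcD (h a) (h z - h a); rewrite subrKC.
  by rewrite ltrD2l.
set M := normc (h b) in bmax.
have h0 : h 0 = 0.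
  have [d [N [d0 N0 hN]]] := hflat 1%N; apply: eq0_normc; apply/eqP.
  by rewrite eq_le normc_ge0 andbT; have := hN 0; rewrite normc0 expr1 mulr0; exact.
have bound L a : normc a <= 1 -> normc (h a) <= M * normc a ^+ L.
  move=> a1; pose k z := h z * z^-1 ^+ L.
  have hk : forall c, normc c <= 1 -> expands 3 (fun z => k (c + z)).
    move=> c c1; have [->|c0] := eqVneq c 0.
      exists 0; have [d [N [d0 N0 hN]]] := hflat (3 + L)%N.
      exists d, N; split=> // z zd; rewrite add0r horner0 subr0 /k.
      have [->|z0] := eqVneq z 0.
        by rewrite h0 mul0r normc0 expr0n mulr0.
      have nz0 := normc_gt0 z0.
      rewrite normcM normcX normcV exprVn ler_pdivrMr ?exprn_gt0// -mulrA -exprD.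
      exact: hN.
    by apply: expandsM; [exact: hh|exact/expandsX/expands_inv].
  have hM c : normc c = 1 -> normc (k c) <= M.
    move=> c1; rewrite normcM normcX normcV c1 invr1 expr1n mulr1.
    by apply: bmax; rewrite c1.
  have := maximum_principle hk hM a1; rewrite normcM normcX normcV exprVn.
  have [->|a0] := eqVneq a 0.
    by rewrite h0 normc0 mul0r => M0; rewrite mulr_ge0// exprn_ge0.
  have na0 := normc_gt0 a0.
  by rewrite ler_pdivrMr// exprn_gt0.
have inner a : normc a < 1 -> h a = 0.
  move=> a1; apply: eq0_normc; apply/eqP; rewrite eq_le normc_ge0 andbT.
  rewrite leNgt; apply/negP => p0.
  have M1 : 0 < M + 1 by rewrite ltr_wpDl// normc_ge0.
  have cv : (GRing.exp (normc a) : R^nat) @ \oo --> 0.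
    by apply: cvg_expr; rewrite ger0_norm// normc_ge0.
  have q0 : 0 < normc (h a) / (M + 1) by rewrite divr_gt0.
  have [L _ /(_ L (leqnn L))] := cvgr_lt _ cv _ q0.
  rewrite /= ltr_pdivlMr// => h1.
  have : M * normc a ^+ L <= normc a ^+ L * (M + 1).
    by rewrite mulrDr mulr1 mulrC lerDl exprn_ge0// normc_ge0.
  by have := bound L a (ltW a1); lra.
move=> a a1; have [a1'|a1'] := boolP (normc a < 1); first exact: inner.
apply: eq0_normc; apply/eqP; rewrite eq_le normc_ge0 andbT.
apply/ler_addgt0Pr => e e0; rewrite add0r.
have [d d0 hd] := expands_near (isT : (0 < 3)%N) (hh a a1) e0.
have ea : normc a = 1 by apply/eqP; rewrite eq_le a1 leNgt.
pose s := Num.min 1 (d / 2).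
have s0 : 0 < s by rewrite lt_min ltr01 divr_gt0.
have s1 : s <= 1 by rewrite ge_min lexx.
have sd : s < d.
  by apply: (@le_lt_trans _ _ (d / 2)); [rewrite ge_min lexx orbT|lra].
have nz : normc ((1 - s)%:C * a) = 1 - s.
  by rewrite normcM ea mulr1 normc_real ger0_norm// subr_ge0.
have := hd ((1 - s)%:C * a); rewrite inner; last by rewrite nz; lra.
rewrite sub0r normcN => h1; apply/ltW/h1.
have -> : (1 - s)%:C * a - a = - (s%:C * a) by rewrite rmorphB rmorph1; ring.
by rewrite normcN normcM ea mulr1 normc_real ger0_norm// ltW.
Qed.

End MaximumPrinciple.

(** * Nc functions along lines and discs *)

Section LineExpansions.
Context {R : realType} {g : nat}.
Local Notation C := R[i].
Local Notation ncspace := (ncspace R g).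
Implicit Types (p q : ncspace) (t : nctopology).

Lemma line_near n (X W : 'I_g -> 'M[C]_n.+1) (e : R) : 0 < e ->
  exists2 d : R, 0 < d & forall z : C, normc z < d ->
    forall k, opnorm (X k + z *: W k - X k) < e.
Proof.
move=> e0; pose s := tnorm W; have s0 : 0 <= s.
  by rewrite /s /tnorm; elim/big_ind : _ => // [x u x0 u0|k _]; [rewrite le_max x0|exact: opnorm_ge0].
exists (e / (s + 1)); first by rewrite divr_gt0// ltr_wpDl.
move=> z; rewrite ltr_pdivlMr ?ltr_wpDl// => hz k.
rewrite addrC addKr; apply: le_lt_trans (opnormZ_le _ _) _; apply: le_lt_trans hz.
rewrite ler_wpM2l ?normc_ge0//.
apply: (@le_trans _ _ s); last by rewrite lerDl.
exact: (le_bigmax _ (fun k => opnorm (W k)) k).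
Qed.

Section OneFunction.
Variables (t : nctopology) (Omega : set ncspace) (f : forall p, 'M[C]_(ncsize p)).
Hypotheses (sO : ncset Omega) (oO : ncopen t Omega) (fI : intertwining Omega f).
Hypothesis bf : locally_bounded t Omega f.

(** f(X + zW) - f(X) is z times a corner block of the value of f at a point of
    double size on another line; each such step gains one order. *)
Lemma line_expands L n (X W : 'I_g -> 'M[C]_n.+1) : Omega (ncpoint X) ->
  forall i j : 'I_n.+1,
  expands L (fun z => f (ncpoint (fun k => X k + z *: W k)) i j).
Proof.
elim: L n X W => [|L IH] n X W OX i j.
  have [e [M [e0 sub hM]]] := locally_bounded_near bf OX.
  have [d d0 hd] := line_near X W e0.
  have M0 : 0 <= M.
    by apply: le_trans (opnorm_ge0 _) (hM _ (near_pt_self _ e0)).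
  exists 0; exists d, M; split=> // z /hd hz.
  rewrite horner0 subr0 mulr1; apply: le_trans (normc_le_opnorm _ _ _) _.
  by apply: hM; exists (fun k => X k + z *: W k).
have [e1 e10 h1] := @ut_open R g t Omega (ncpoint X) (ncpoint X) W sO oO OX OX.
have [c c0 /h1 Oc] := small_scalar e10.
pose X2 k : 'M[C]_(n.+1 + n.+1) := block_mx (X k) (c *: W k) 0 (X k).
pose W2 k : 'M[C]_(n.+1 + n.+1) := block_mx (W k) 0 0 0.
have [e e0 sub] := ncopen_near oO OX.
have [e' e'0 sub'] := ncopen_near oO Oc.
have [d d0 hd] := line_near X W e0.
have [d' d'0 hd'] := @line_near (n + n.+1) X2 W2 e' e'0.
have [p hp] := IH (n + n.+1)%N X2 W2 Oc (lshift n.+1 i) (rshift n.+1 j).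
exists ((f (ncpoint X) i j)%:P + c^-1 *: (p * 'X)).
have := bigOM (bigOM bigO_id (bigO_const (c^-1))) hp.
rewrite addn0 add1n; apply: bigO_eq.
exists (Num.min d d'); first by rewrite lt_min d0.
move=> z; rewrite lt_min => /andP[zd zd'].
rewrite !(hornerD, hornerC, hornerZ, hornerM, hornerX).
have [->|z0] := eqVneq z 0.
  rewrite !mul0r mulr0 mulr0 addr0.
  have -> : (fun k => X k + 0 *: W k) = X by apply/funext => k; rewrite scale0r addr0.
  by rewrite subrr.
pose X1 k := X k + z *: W k.
have OX1 : Omega (ncpoint X1) by apply: sub; exists X1; split=> // k; exact: hd.
(* This scalar makes the corner of the double point equal to c W for every z.
   *)
pose c1 := - (c / z).
have eF : (fun k => block_mx (X1 k) (c1 *: (X k - X1 k)) 0 (X k)) =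
    (fun k => X2 k + z *: W2 k) :> ('I_g -> 'M[C]_(n.+1 + n.+1)).
  apply/funext => k.
  have eB : c1 *: (X k - X1 k) = c *: W k.
    rewrite /c1 /X1 opprD addrA subrr add0r.
    by rewrite scaleNr scalerN opprK scalerA divfK.
  by rewrite eB /X2 /W2 scale_block_mx add_block_mx !scaler0 !addr0.
have OZ : Omega (@ncpoint R g (n + n.+1)
    (fun k => block_mx (X1 k) (c1 *: (X k - X1 k)) 0 (X k))).
  rewrite eF; apply: sub'; exists (fun k => X2 k + z *: W2 k); split=> // k; exact: hd'.
have key : f (@ncpoint R g (n + n.+1)
    (fun k => block_mx (X1 k) (c1 *: (X k - X1 k)) 0 (X k)))
    (lshift n.+1 i) (rshift n.+1 j) = c1 * (f (ncpoint X) i j - f (ncpoint X1) i j).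
  have /matrixP/(_ i j) := @urb_difference R g Omega f n X1 X c1 fI OX1 OX OZ.
  by rewrite /urb mxE mxE [in X in _ = X -> _]mxE [in X in _ = X -> _]mxE
    [in X in _ = X -> _]mxE.
rewrite eF in key; rewrite key /c1 mulNr -mulrN opprB -/(X1).
have E (a b r : C) : z * c^-1 * (c / z * (b - a) - r) = b - (a + c^-1 * (r * z)).
  by field; rewrite z0 c0.
by rewrite E.
Qed.

End OneFunction.
End LineExpansions.

Section StarCore.
Context {R : realType} {g : nat} (y : 'I_g -> R[i]).
Local Notation C := R[i].
Local Notation ncspace := (ncspace R g).
Local Notation Y := (scalar_point y).
Local Notation ypt := (@ypt R g y).
Implicit Types (p q : ncspace) (t : nctopology).

Definition ray p (z : C) : ncspace :=
  @ncpoint R g (tag p) (fun k => (y k)%:M + z *: (nccomp p k - (y k)%:M)).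

(** The points joined to y by a complex disc inside Omega; a disc, because the
    principle [flat_disc] is about discs. *)
Definition star_core (Omega : set ncspace) : set ncspace :=
  [set p | forall z, normc z <= 1 -> Omega (ray p z)].

Lemma ray1 p : ray p 1 = p.
Proof.
case: p => n X; congr (existT _ _ _); apply/funext => k.
by rewrite scale1r addrC subrK.
Qed.

Lemma ray_dsum p q z : ray (dsum p q) z = dsum (ray p z) (ray q z).
Proof.
congr (existT _ _ _); apply/funext => k.
change (((y k)%:M : 'M[C]_(ncsize p + ncsize q)) +
  z *: (block_mx (nccomp p k) 0 0 (nccomp q k) - (y k)%:M) =
  block_mx ((y k)%:M + z *: (nccomp p k - (y k)%:M)) 0 0
    ((y k)%:M + z *: (nccomp q k - (y k)%:M))).
by rewrite scalar_mx_block opp_block_mx add_block_mx scale_block_mx add_block_mx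
  !subr0 !scaler0 !addr0.
Qed.

Lemma star_core_sub Omega : star_core Omega `<=` Omega.
Proof. by move=> p /(_ 1); rewrite ray1 normc1; exact. Qed.

(** The disc of a point is compact. *)
Lemma star_core_open Omega : ncopen DisjointUnion Omega ->
  ncopen DisjointUnion (star_core Omega).
Proof.
move=> oO; apply/open_nearP => -[n X] Op; set p : ncspace := existT _ n X in Op *.
have [d d0 hd] : exists2 d : R, 0 < d & forall z, normc z <= 1 ->
    near_pt (ray p z) d `<=` Omega.
  apply: disc_uniform => [d d' z dd' sub q [X' [-> hX']]|a a1].
    by apply: sub; exists X'; split=> // k; exact: lt_le_trans (hX' k) dd'.
  have [e e0 sub] := ncopen_near oO (Op _ a1).
  have e2 : 0 < e / 2 by rewrite divr_gt0.
  have [d d0 hd] := line_near (fun k => nccomp (ray p a) k) (fun k => X k - (y k)%:M) e2.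
  exists (Num.min d (e / 2)); first by rewrite lt_min d0.
  move=> z _; rewrite lt_min => /andP[/hd hz _] q [X' [-> hX']].
  apply: sub; exists X'; split=> // k.
  rewrite -(subrK (nccomp (ray p z) k) (X' k)) -addrA.
  apply: le_lt_trans (opnormD _ _) _; rewrite [ltRHS]splitr.
  apply: ltrD; first by apply: lt_le_trans (hX' k) _; rewrite ge_min lexx orbT.
  have -> : nccomp (ray p z) k - nccomp (ray p a) k =
      nccomp (ray p a) k + (z - a) *: (X k - (y k)%:M) - nccomp (ray p a) k.
    rewrite /nccomp /= [RHS]addrAC subrr add0r opprD addrACA subrr add0r.
    by rewrite -scalerBl.
  exact: hz.
exists d => //  q [X' [-> hX']] z z1; apply: (hd z z1).
exists (fun k => (y k)%:M + z *: (X' k - (y k)%:M)); split=> [|k]; first exact: erefl.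
have -> : (y k)%:M + z *: (X' k - (y k)%:M) - nccomp (ray p z) k =
    z *: (X' k - nccomp p k).
  by rewrite /nccomp /= opprD addrACA subrr add0r -scalerBr opprB addrA subrK.
apply: le_lt_trans (opnormZ_le _ _) _; apply: le_lt_trans (hX' k).
by rewrite ler_piMl ?opnorm_ge0.
Qed.

Lemma star_core_nbhd t Omega : ncnbhd t Y Omega ->
  exists2 Omega', ncnbhd t Y Omega' & Omega' `<=` star_core Omega.
Proof.
case: t => nO; last first.
  have [e e0 sub] := unbhd_sball nO; exists (sball y e); first exact: sball_nbhd.
  move=> p hp z z1; apply: sub => k; rewrite /nccomp /= addrC addKr.
  apply: le_lt_trans (opnormZ_le _ _) _; apply: le_lt_trans (hp k).
  by rewrite ler_piMl ?opnorm_ge0.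
have [sO oO OY] := nO; exists (star_core Omega) => //; split.
- by move=> p q Op Oq z z1; rewrite ray_dsum; apply: sO; [exact: Op|exact: Oq].
- exact: star_core_open.
- move=> z z1; suff -> : ray Y z = Y by [].
  by congr (existT _ _ _); apply/funext => k; rewrite subrr scaler0 addr0.
Qed.

Lemma flat_zero t Omega (f : forall p, 'M[C]_(ncsize p)) :
  ncset Omega -> ncopen t Omega -> intertwining Omega f -> locally_bounded t Omega f ->
  (forall n (W : 'I_g -> 'M[C]_n.+1) (i j : 'I_n.+1) L,
     bigO L (fun z => f (ncpoint (fun k => (y k)%:M + z *: W k)) i j)) ->
  forall p, star_core Omega p -> f p = 0.
Proof.
move=> sO oO fI bf flat [n X] Op; apply/matrixP => i j; rewrite mxE.
pose h z := f (ncpoint (fun k => (y k)%:M + z *: (X k - (y k)%:M))) i j.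
have <- : h 1 = f (existT _ n X) i j.
  rewrite /h; suff -> : (fun k => (y k)%:M + 1 *: (X k - (y k)%:M)) = X by [].
  by apply/funext => k; rewrite scale1r addrC subrK.
apply: (@flat_disc _ h) => [a a1|L|]; last by rewrite normc1.
  have Oa := Op _ a1.
  have := @line_expands R g t Omega f sO oO fI bf 3 n
    (fun k => (y k)%:M + a *: (X k - (y k)%:M)) (fun k => X k - (y k)%:M) Oa i j.
  move=> [p hp]; exists p; apply: (approx_eq _ hp); exists 1 => // z _.
  rewrite /h; suff -> : (fun k => (y k)%:M + a *: (X k - (y k)%:M) + z *: (X k - (y k)%:M)) =
    (fun k => (y k)%:M + (a + z) *: (X k - (y k)%:M)) by [].
  by apply/funext => k; rewrite -addrA -scalerDl.
exact: (flat n (fun k => X k - (y k)%:M) i j L).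
Qed.

End StarCore.

(** * The ring of germs at a scalar point *)

Section GermRing.
Context {R : realType} {g : nat} (t : nctopology) (y : 'I_g -> R[i]).
Local Notation C := R[i].
Local Notation ncspace := (ncspace R g).
Local Notation Y := (scalar_point y).
Local Notation ypt := (@ypt R g y).
Local Notation O := (germ t Y).
Implicit Types (p q : ncspace) (a b : O) (P Q : set ncspace).

(** Eventually near y in the topology t, in the sense of nc neighborhoods:
    identities between germs are identities of values on such sets. *)
Definition tev P := exists2 Omega, ncnbhd t Y Omega & Omega `<=` P.

Lemma tevS P Q : P `<=` Q -> tev P -> tev Q.
Proof. by move=> PQ [U nU UP]; exists U => // p /UP/PQ. Qed.

Lemma tevI P Q : tev P -> tev Q -> tev (P `&` Q).
Proof.
move=> [U nU UP] [V nV VQ]; exists (U `&` V); first exact: ncnbhdI.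
by move=> p [/UP ? /VQ].
Qed.

Lemma tevT P : (forall p, P p) -> tev P.
Proof. by move=> h; exists setT => //; exact: ncnbhdT. Qed.

Lemma tev_all (I : finType) (P : I -> set ncspace) :
  (forall i, tev (P i)) -> tev [set p | forall i, P i p].
Proof.
move=> h; suff : forall s : seq I, tev [set p | forall i, i \in s -> P i p].
  by move=> /(_ (enum I)); apply: tevS => p hp i; apply: hp; rewrite mem_enum.
elim=> [|i s IH]; first exact: tevT.
apply: tevS (tevI (h i) IH) => p [hi hs] j; rewrite inE => /orP[/eqP -> //|]; exact: hs.
Qed.

Lemma tev_Y P : tev P -> P Y.
Proof. by move=> [U [_ _ UY] UP]; exact: UP. Qed.

Definition val a : forall p, 'M[C]_(ncsize p) := germ_repr a.

Definition dom a : set ncspace := ncdom (germ_repr a).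

Lemma dom_nbhd a : ncnbhd t Y (dom a).
Proof. exact: ncdom_nbhd. Qed.

Lemma tev_dom a : tev (dom a).
Proof. by exists (dom a) => //; exact: dom_nbhd. Qed.

Lemma val_intertwining a : intertwining (dom a) (val a).
Proof. exact: ana_intertwining. Qed.

Lemma val_germ_of (f : anafun t Y) : tev [set p | val (germ_of f) p = f p].
Proof. by have [U [nU _ _ e]] := repr_germ_of f; exists U. Qed.

Lemma germ_eqP a b : tev [set p | val a p = val b p] -> a = b.
Proof.
move=> [U nU e]; rewrite -(germ_reprK a) -(germ_reprK b); apply/germ_ofP.
exists (U `&` (dom a `&` dom b)); split.
- by apply: ncnbhdI => //; apply: ncnbhdI; exact: dom_nbhd.
- by move=> p [_ []].
- by move=> p [_ []].
- by move=> p [/e].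
Qed.

Lemma valD a b : tev [set p | val (a + b) p = val a p + val b p].
Proof.
have := val_germ_of (ana_add (germ_repr a) (germ_repr b)).
by rewrite -germ_ofD !germ_reprK.
Qed.

Lemma valM a b : tev [set p | val (a * b) p = val a p *m val b p].
Proof.
have := val_germ_of (ana_mul (germ_repr a) (germ_repr b)).
by rewrite -germ_ofM !germ_reprK.
Qed.

Lemma val_const c : tev [set p | val (germ_const c : O) p = c%:M].
Proof. exact: val_germ_of. Qed.

Lemma val0 : tev [set p | val 0 p = 0].
Proof. by apply: tevS (val_const 0) => p /= ->; rewrite raddf0. Qed.

Lemma val1 : tev [set p | val 1 p = 1%:M].
Proof. exact: val_const. Qed.

Lemma germ_const_alg c : c%:A = germ_const c :> O.
Proof. exact: mulr1. Qed.

Lemma valZ c a : tev [set p | val (c *: a) p = c *: val a p].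
Proof.
have := tevI (valM (germ_const c) a) (val_const c).
by apply: tevS => p /= [-> ->]; rewrite mul_scalar_mx.
Qed.

Lemma val_sum (I : finType) (F : I -> O) :
  tev [set p | val (\sum_i F i) p = \sum_i val (F i) p].
Proof.
elim: (index_enum I) => [|i s IH].
  by apply: tevS val0 => p /= e; rewrite !big_nil.
rewrite big_cons; apply: tevS (tevI (valD (F i) (\sum_(j <- s) F j)) IH) => p /= [-> ->].
by rewrite big_cons.
Qed.

Definition ev a : C := val a Y 0 0.

Fact ev_is_zmod_morphism : zmod_morphism ev.
Proof.
move=> a b; have := tev_Y (tevI (valD (a - b) b) (val_const 0)).
move=> [/= h _]; rewrite subrK in h; rewrite /ev.
by have := congr1 (fun A : 'M[C]_1 => A 0 0) h; rewrite mxE => ->; rewrite addrK.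
Qed.

HB.instance Definition _ := GRing.isZmodMorphism.Build O C ev ev_is_zmod_morphism.

Fact ev_is_monoid_morphism : monoid_morphism ev.
Proof.
split; first by rewrite /ev (tev_Y val1) mxE.
move=> a b; rewrite /ev; have /= -> := tev_Y (valM a b).
by rewrite mxE big_ord1.
Qed.

HB.instance Definition _ := GRing.isMonoidMorphism.Build O C ev ev_is_monoid_morphism.

Lemma evZ c a : ev (c *: a) = c * ev a.
Proof. by rewrite /ev (tev_Y (valZ c a)) mxE. Qed.

Definition coord k : O := germ_of (ana_coord y t k).

Lemma val_coord k : tev [set p | val (coord k) p = nccomp p k - (y k)%:M].
Proof. exact: val_germ_of. Qed.

Lemma ev_coord k : ev (coord k) = 0.
Proof. by rewrite /ev (tev_Y (val_coord k)) subrr mxE. Qed.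

Lemma left_decomposition a : exists h : 'I_g -> O,
  a = (ev a)%:A + \sum_k coord k * h k.
Proof.
have [h [U [nU Uf Uh e]]] := ana_left (germ_repr a).
exists (fun k => germ_of (h k)); apply: germ_eqP.
have h1 := tev_all (fun k => valM (coord k) (germ_of (h k))).
have h2 := tev_all (fun k => val_germ_of (h k)).
have h3 := tev_all val_coord.
have h4 := val_sum (fun k => coord k * germ_of (h k)).
have h5 := valD (ev a)%:A (\sum_k coord k * germ_of (h k)).
have h6 : tev [set p | val (ev a)%:A p = (ev a)%:M] by rewrite germ_const_alg; exact: val_const.
have h7 : tev U by exists U.
apply: tevS (tevI h1 (tevI h2 (tevI h3 (tevI h4 (tevI h5 (tevI h6 h7)))))).
move=> p /= [e1 [e2 [e3 [e4 [e5 [e6 Up]]]]]].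
rewrite e5 e6 e4 /val e //; congr (_ + _); apply: eq_bigr => k _.
by have := e1 k; rewrite /val => ->; have := e2 k; rewrite /val => ->;
  have := e3 k; rewrite /val => ->.
Qed.

(** At [[y, c e_k], [0, q]] the upper right block of the sum is c h_k(q). *)
Lemma left_independence (h : 'I_g -> O) :
  \sum_k coord k * h k = 0 -> forall k, h k = 0.
Proof.
move=> h0 k; apply: germ_eqP.
have h1 := tev_all (fun k => valM (coord k) (h k)).
have h3 := tev_all val_coord.
have h4 := val_sum (fun k => coord k * h k).
have h7 := tev_all (fun k => tev_dom (h k)).
have [U [sU oU UY] sub] := tevI h1 (tevI h3 (tevI h4 (tevI h7 val0))).
exists U => // q Uq /=.
have [_ [_ [_ [_ /= ->]]]] := sub _ Uq.
have [e e0 he] := @ut_open R g t U (ypt (tag q)) q (fun j => (j == k)%:R%:M) sU oU (ypt_in _ sU UY) Uq.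
have [c c0 /he Uc] := small_scalar e0.
set p := ut _ in Uc.
have [/= e1 [/= e3 [/= e4 [/= dp /= ep]]]] := sub _ Uc.
rewrite h0 ep in e4.
have hrow j : row_mx 0 1%:M *m (val (h j) p : 'M[C]_(ncsize q + ncsize q)) =
    val (h j) q *m row_mx 0 1%:M.
  have dq : dom (h j) q by have [_ [_ [_ [/= d _]]]] := sub _ Uq; exact: d.
  apply/esym; apply: (val_intertwining dq (dp j) (S := row_mx 0 1%:M : 'M[C]_(ncsize q, ncsize q + ncsize q))) => l.
  apply: etrans; last exact/esym/row_mul_ut.
  by apply: etrans (@mul_mx_row _ _ _ (ncsize q) (ncsize q) _ _ _) _;
    rewrite !mulmx1 !mulmx0 !mul0mx mul1mx !add0r.
have prow j : row_mx 1%:M 0 *m (nccomp p j - (y j)%:M : 'M[C]_(ncsize q + ncsize q)) =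
    (c *: (j == k)%:R%:M) *m row_mx 0 1%:M.
  change (row_mx 1%:M 0 *m ((block_mx (y j)%:M (c *: (j == k)%:R%:M) 0 (nccomp q j)
    : 'M[C]_(ncsize q + ncsize q)) - (y j)%:M) = (c *: (j == k)%:R%:M) *m row_mx 0 1%:M).
  rewrite [X in _ - X]scalar_mx_block opp_block_mx add_block_mx !subrr !subr0.
  by rewrite mul_row_block mul_mx_row !mul1mx !mul0mx !mulmx0 !mulmx1 !addr0.
have : row_mx 1%:M 0 *m (\sum_j val (coord j * h j) p : 'M[C]_(ncsize q + ncsize q)) = 0.
  by rewrite -e4 mulmx0.
rewrite mulmx_sumr (bigD1 k)//= big1 => [|j jk].
  rewrite addr0 e1 e3 mulmxA prow eqxx -mulmxA hrow mulmxA scale_scalar_mx mulr1.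
  rewrite mul_scalar_mx mul_mx_row mulmx0 mulmx1 => hh.
  have /eq_row_mx[_ /(congr1 (fun A => c^-1 *: A))] :
      row_mx (0 : 'M[C]_(ncsize q)) (c *: val (h k) q) = row_mx 0 0 by rewrite row_mx0.
  by rewrite scalerA mulVf// scale1r scaler0.
by rewrite e1 e3 mulmxA prow (negbTE jk) -mulmxA raddf0 scaler0 mul0mx.
Qed.

Lemma germ_inverse a : ev a != 0 -> exists b, a * b = 1 /\ b * a = 1.
Proof.
move=> a0; have [h [_ hE]] := ana_inverse a0.
have th : tev (ncdom h) by exists (ncdom h) => //; exact: ncdom_nbhd.
have h1 := tevI th (tevI (val_germ_of h) val1).
exists (germ_of h); split; apply: germ_eqP.
  apply: tevS (tevI h1 (valM a (germ_of h))) => p /= [[/hE[up hp] [e ->]] ->].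
  by rewrite e hp mulmxV.
apply: tevS (tevI h1 (valM (germ_of h) a)) => p /= [[/hE[up hp] [e ->]] ->].
by rewrite e hp mulVmx.
Qed.

Definition tr a : O := germ_of (ana_tr (germ_repr a)).

Lemma tev_tp P : tev P -> tev [set p | P (tp p)].
Proof.
move=> [U nU UP]; exists (tp @^-1` U); first exact: tp_nbhd.
by move=> p /UP.
Qed.

Lemma val_tr a : tev [set p | val (tr a) p = (val a (tp p))^T].
Proof. by apply: tevS (val_germ_of (ana_tr (germ_repr a))) => p /= ->; rewrite ana_trE. Qed.

Lemma trD a b : tr (a + b) = tr a + tr b.
Proof.
apply: germ_eqP; have h := tevI (val_tr (a + b)) (tevI (val_tr a) (val_tr b)).
apply: tevS (tevI h (tevI (valD (tr a) (tr b)) (tev_tp (valD a b)))).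
by move=> p /= [[-> [ea eb]] [-> ->]]; rewrite ea eb linearD.
Qed.

Lemma trM a b : tr (a * b) = tr b * tr a.
Proof.
apply: germ_eqP; have h := tevI (val_tr (a * b)) (tevI (val_tr a) (val_tr b)).
apply: tevS (tevI h (tevI (valM (tr b) (tr a)) (tev_tp (valM a b)))).
by move=> p /= [[-> [ea eb]] [-> ->]]; rewrite ea eb trmx_mul.
Qed.

Lemma val_tpK a p : val a (tp (tp p)) = val a p :> 'M[C]_(ncsize p).
Proof.
case: p => n X.
have e : (fun k => ((X k)^T)^T) = X by apply/funext => k; exact: trmxK.
change (val a (ncpoint (fun k => ((X k)^T)^T)) = val a (ncpoint X) :> 'M[C]_n.+1).
by rewrite e.
Qed.

Lemma val_tpY a : val a (tp Y) = val a Y :> 'M[C]_1.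
Proof.
have e : (fun k => (((y k)%:M : 'M[C]_1))^T) = (fun k => (y k)%:M).
  by apply/funext => k; exact: tr_scalar_mx.
change (val a (@ncpoint R g 0 (fun k => ((y k)%:M)^T)) = val a (ncpoint (fun k => (y k)%:M)) :> 'M[C]_1).
by rewrite e.
Qed.

Lemma trK a : tr (tr a) = a.
Proof.
apply: germ_eqP; apply: tevS (tevI (val_tr (tr a)) (tev_tp (val_tr a))).
by move=> p /= [-> ->]; rewrite trmxK; exact: val_tpK.
Qed.

Lemma tr_coord k : tr (coord k) = coord k.
Proof.
apply: germ_eqP; apply: tevS (tevI (val_tr (coord k)) (tevI (val_coord k) (tev_tp (val_coord k)))).
move=> p /= [-> [-> ->]]; rewrite linearB /=; congr (_ - _); first exact: trmxK.
exact: tr_scalar_mx.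
Qed.

Lemma tr_const c : tr c%:A = c%:A.
Proof.
rewrite germ_const_alg; apply: germ_eqP.
apply: tevS (tevI (val_tr (germ_const c)) (tevI (val_const c) (tev_tp (val_const c)))).
by move=> p /= [-> [-> ->]]; rewrite tr_scalar_mx.
Qed.

Lemma ev_tr a : ev (tr a) = ev a.
Proof.
by rewrite /ev (tev_Y (val_tr a)) mxE val_tpY.
Qed.

Lemma tr_sum (I : finType) (F : I -> O) : tr (\sum_i F i) = \sum_i tr (F i).
Proof.
have tr0 : tr 0 = 0 by rewrite -(scale0r 1) tr_const.
by apply: (big_morph tr trD tr0).
Qed.

End GermRing.

(** * Left and right derivatives, Taylor expansion *)

Section Derivatives.
Context {R : realType} {g : nat} (t : nctopology) (y : 'I_g -> R[i]).
Local Notation C := R[i].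
Local Notation ncspace := (ncspace R g).
Local Notation Y := (scalar_point y).
Local Notation ypt := (@ypt R g y).
Local Notation O := (germ t Y).
Local Notation x := (@coord R g t y).
Local Notation ev := (@ev R g t y).
Local Notation val := (@val R g t y).
Local Notation tr := (@tr R g t y).
Local Notation tev := (@tev R g t y).
Implicit Types (a b : O) (k : 'I_g) (w : seq 'I_g).

Definition D k a : O := sval (cid (left_decomposition a)) k.

Lemma DE a : a = (ev a)%:A + \sum_k x k * D k a.
Proof. exact: svalP (cid (left_decomposition a)). Qed.

(** By [left_independence]; the rules for D follow by exhibiting
    decompositions. *)
Lemma D_unique a c (h : 'I_g -> O) :
  a = c%:A + \sum_k x k * h k -> c = ev a /\ forall k, D k a = h k.
Proof.
move=> e; have c_ev : c = ev a.
  rewrite e rmorphD /= evZ rmorph1 mulr1 rmorph_sum big1 ?addr0// => k _ /=.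
  by rewrite rmorphM /= ev_coord mul0r.
split=> // k; apply/eqP; rewrite -subr_eq0; apply/eqP.
apply: (@left_independence R g t y (fun k => D k a - h k)).
under eq_bigr do rewrite mulrBr.
rewrite sumrB; apply/eqP; rewrite subr_eq0; apply/eqP.
by apply: (@addrI _ (ev a)%:A); rewrite -DE {1}e c_ev.
Qed.

Lemma D_is_zmod_morphism k : zmod_morphism (D k).
Proof.
move=> a b.
suff /D_unique[_ ->] : a - b = (ev a - ev b)%:A + \sum_k x k * (D k a - D k b) by [].
under eq_bigr do rewrite mulrBr.
by rewrite sumrB scalerBl addrACA -opprD -!DE.
Qed.

HB.instance Definition _ k := GRing.isZmodMorphism.Build O O (D k) (D_is_zmod_morphism k).

Lemma D_mul k a b : D k (a * b) = D k a * b + ev a *: D k b.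
Proof.
suff /D_unique[_ ->] : a * b = (ev a * ev b)%:A +
  \sum_k x k * (D k a * b + ev a *: D k b) by [].
rewrite {1}[a]DE mulrDl mulr_algl {1}[b in ev a *: b]DE scalerDr scalerA -addrA; congr (_ + _).
rewrite scaler_sumr mulr_suml -big_split; apply: eq_bigr => j _ /=.
by rewrite mulrDr -scalerAr mulrA addrC.
Qed.

Lemma D_const k c : D k c%:A = 0.
Proof.
suff /D_unique[_ ->] : c%:A = c%:A + \sum_k x k * 0 :> O by [].
by rewrite big1 ?addr0// => j _; rewrite mulr0.
Qed.

Lemma D_scale k c a : D k (c *: a) = c *: D k a.
Proof.
suff /D_unique[_ ->] : c *: a = (c * ev a)%:A + \sum_k x k * (c *: D k a) by [].
rewrite {1}[a]DE scalerDr scalerA scaler_sumr; congr (_ + _).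
by apply: eq_bigr => j _; rewrite -scalerAr.
Qed.

Lemma D_coord_sum k (h : 'I_g -> O) : D k (\sum_j x j * h j) = h k.
Proof. by apply: (proj2 (@D_unique _ 0 h _)); rewrite scale0r add0r. Qed.

Lemma D_coord j k : D j (x k) = (j == k)%:R.
Proof.
suff /D_unique[_ ->] : x k = 0%:A + \sum_j x j * (j == k)%:R by [].
rewrite scale0r add0r (bigD1 k)//= eqxx mulr1 big1 ?addr0// => i ik.
by rewrite (negbTE ik) mulr0.
Qed.

(** D removes a first letter, Dr a last letter. *)
Definition Dr k a : O := tr (D k (tr a)).

Lemma DrE a : a = (ev a)%:A + \sum_k Dr k a * x k.
Proof.
rewrite -{1}[a]trK [tr a]DE trD tr_const ev_tr tr_sum; congr (_ + _).
by apply: eq_bigr => k _; rewrite trM tr_coord.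
Qed.

Lemma Dr_unique a c (h : 'I_g -> O) :
  a = c%:A + \sum_k h k * x k -> c = ev a /\ forall k, Dr k a = h k.
Proof.
move=> e; have /D_unique[-> h1] : tr a = c%:A + \sum_k x k * tr (h k).
  rewrite e trD tr_const tr_sum; congr (_ + _); apply: eq_bigr => k _.
  by rewrite trM tr_coord.
by rewrite ev_tr; split=> // k; rewrite /Dr h1 trK.
Qed.

Lemma Dr_mul k a b : Dr k (a * b) = a * Dr k b + ev b *: Dr k a.
Proof.
suff /Dr_unique[_ ->] : a * b = (ev a * ev b)%:A +
  \sum_k (a * Dr k b + ev b *: Dr k a) * x k by [].
rewrite {1}[b]DrE mulrDr mulr_algr {1}[a in ev b *: a]DrE scalerDr scalerA (mulrC (ev b)).
rewrite -addrA; congr (_ + _).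
rewrite scaler_sumr mulr_sumr -big_split; apply: eq_bigr => j _ /=.
by rewrite mulrDl -scalerAl mulrA addrC.
Qed.

Lemma Dr_is_zmod_morphism k : zmod_morphism (Dr k).
Proof.
move=> a b.
suff /Dr_unique[_ ->] : a - b = (ev a - ev b)%:A + \sum_k (Dr k a - Dr k b) * x k by [].
under eq_bigr do rewrite mulrBl.
by rewrite sumrB scalerBl addrACA -opprD -!DrE.
Qed.

HB.instance Definition _ k := GRing.isZmodMorphism.Build O O (Dr k) (Dr_is_zmod_morphism k).

Lemma D_Dr j a : ev (D j a) = ev (Dr j a) /\ forall k, Dr k (D j a) = D j (Dr k a).
Proof.
suff /Dr_unique[] : D j a = (ev (Dr j a))%:A + \sum_k D j (Dr k a) * x k by move=> <- h; split=> // k; exact: h.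
rewrite {1}[a]DrE raddfD /= D_const add0r raddf_sum /=.
under eq_bigr do rewrite D_mul D_coord.
rewrite big_split addrC; congr (_ + _); rewrite (bigD1 j)//= eqxx big1 ?addr0// => k kj.
by rewrite eq_sym (negbTE kj) scaler0.
Qed.

(** The coefficient of the word w in the Taylor expansion at y. *)
Fixpoint coef w a : C := if w is k :: w' then coef w' (D k a) else ev a.

Lemma coef_rcons w k a : coef (rcons w k) a = coef w (Dr k a).
Proof.
elim: w a => [|j w IH] a /=; first by case: (D_Dr k a).
by rewrite IH; have [_ ->] := D_Dr j a.
Qed.

(** The homogeneous part of degree l of the Taylor expansion. Its matrix
    argument may have entries in any commutative ring Q, so that polynomial
    families of matrices are covered. *)
Fixpoint hom (Q : comPzRingType) (phi : C -> Q) n (W : 'I_g -> 'M[Q]_n) l a : 'M[Q]_n :=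
  if l is l'.+1 then \sum_k W k *m hom phi W l' (D k a) else (phi (ev a))%:M.

Lemma hom_flat (Q : comPzRingType) (phi : {rmorphism C -> Q}) n (W : 'I_g -> 'M[Q]_n) l a :
  (forall w, coef w a = 0) -> hom phi W l a = 0.
Proof.
elim: l a => [|l IH] a ca /=; first by rewrite [ev a](ca [::]) rmorph0 raddf0.
by rewrite big1// => k _; rewrite IH ?mulmx0// => w; exact: (ca (k :: w)).
Qed.

Lemma tev_line P n (W : 'I_g -> 'M[C]_n.+1) : tev P ->
  exists2 d : R, 0 < d & forall z, normc z < d ->
    P (ncpoint (fun k => (y k)%:M + z *: W k)).
Proof.
move=> [U [sU oU UY] UP]; have [e e0 sub] := ncopen_near oU (ypt_in n sU UY).
have [d d0 hd] := line_near (fun k => (y k)%:M) W e0.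
exists d => // z zd; apply: UP; apply: sub.
by exists (fun k => (y k)%:M + z *: W k); split=> [|k]; [exact: erefl|exact: hd].
Qed.

Lemma val_left a : tev [set p | val a p =
  (ev a)%:M + \sum_k (nccomp p k - (y k)%:M) *m val (D k a) p].
Proof.
have h1 := tev_all (fun k => valM (x k) (D k a)).
have h3 := tev_all (@val_coord R g t y).
have h4 := val_sum (fun k => x k * D k a).
have h5 := valD (ev a)%:A (\sum_k x k * D k a).
have h6 : tev [set p | val (ev a)%:A p = (ev a)%:M] by rewrite germ_const_alg; exact: val_const.
apply: tevS (tevI h1 (tevI h3 (tevI h4 (tevI h5 h6)))).
move=> p /= [e1 [e3 [e4 [e5 e6]]]].
rewrite {1}[a]DE e5 e6 e4; congr (_ + _); apply: eq_bigr => k _.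
by rewrite e1 e3.
Qed.

Lemma approx_mulX L (h : C -> C) (p : {poly C}) : approx L h p ->
  approx L.+1 (fun z => z * h z) ('X * p).
Proof.
move=> hp; have := bigOM bigO_id hp; rewrite add1n.
by apply: bigO_eq; exists 1 => // z _; rewrite hornerM hornerX mulrBr.
Qed.

(** Iterate a = a(y) + sum_k x_k D_k a. *)
Lemma taylor L n (W : 'I_g -> 'M[C]_n.+1) a (i j : 'I_n.+1) :
  approx L (fun z => val a (ncpoint (fun k => (y k)%:M + z *: W k)) i j)
    (\poly_(l < L) (hom id W l a i j)).
Proof.
elim: L a i j => [|L IH] a i j.
  have [sU oU UY] := dom_nbhd a.
  have bU := @ncval_bounded _ _ _ _ (germ_repr a).
  have [e [M [e0 sub hM]]] := locally_bounded_near bU (ypt_in n sU UY).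
  have [d d0 hd] := line_near (fun k => (y k)%:M) W e0.
  have M0 : 0 <= M.
    by apply: le_trans (opnorm_ge0 _) (hM _ (near_pt_self _ e0)).
  exists d, M; split=> // z /hd hz.
  rewrite poly_def big_ord0 horner0 subr0 mulr1; apply: le_trans (normc_le_opnorm _ _ _) _.
  by apply: hM; exists (fun k => (y k)%:M + z *: W k).
have [d d0 hd] := tev_line W (val_left a).
pose h z := (ev a *+ (i == j)) + \sum_k \sum_l W k i l *
   (z * val (D k a) (ncpoint (fun k => (y k)%:M + z *: W k)) l j).
pose P : {poly C} := (ev a *+ (i == j))%:P + \sum_k \sum_l (W k i l)%:P *
   ('X * \poly_(m < L) (hom id W m (D k a) l j)).
have hP : approx L.+1 h P.
  apply: approxD; first exact: approx_const.
  apply: approx_sum => k; apply: approx_sum => l; apply: approxM; first exact: approx_const.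
  by apply: approx_mulX; exact: IH.
have -> : \poly_(l < L.+1) (hom id W l a i j) = P.
  apply/polyP => m; rewrite coef_poly coefD coefC coef_sum.
  under eq_bigr do rewrite coef_sum.
  under eq_bigr do under eq_bigr do rewrite coefCM coefXM coef_poly.
  case: m => [|m] /=.
    rewrite mxE big1 ?addr0// => k _; rewrite big1// => l _; exact: mulr0.
  rewrite add0r ltnS; case: ifP => mL; last first.
    by rewrite big1// => k _; rewrite big1// => l _; exact: mulr0.
  by rewrite summxE; apply: eq_bigr => k _; rewrite mxE.
apply: (approx_eq _ hP); exists d => // z zd.
have /= e := hd z zd.
have -> A : (A : 'M[C]_n.+1) i j = A i j by [].
rewrite e /h mxE mxE summxE; congr (_ + _); apply: eq_bigr => k _.
rewrite mxE; apply: eq_bigr => l _.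
have -> : (nccomp (ncpoint (fun k => (y k)%:M + z *: W k)) k - (y k)%:M) i l = z * W k i l.
  by rewrite /nccomp /= addrC addKr mxE.
by rewrite mulrCA mulrA.
Qed.

(** Without homogeneous parts, the germ is flat at y along every line. *)
Theorem flat_germ a : (forall w, coef w a = 0) -> a = 0.
Proof.
move=> ca; apply: germ_eqP.
have [U nU Usub] := star_core_nbhd (dom_nbhd a).
have tU : tev U by exists U.
apply: tevS (tevI tU (@val0 R g t y)) => p /= [/Usub Up ->].
have [sD oD DY] := dom_nbhd a.
apply: (flat_zero sD oD (@val_intertwining R g t y a) (@ncval_bounded _ _ _ _ (germ_repr a)) _ Up).
move=> n W i j L; apply: bigO_eq (taylor L W a i j); exists 1 => // z _.
have -> : \poly_(l < L) hom id W l a i j = 0.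
  apply/polyP => m; rewrite coef_poly coef0; case: ifP => // _.
  by rewrite (@hom_flat C idfun) ?mxE.
by rewrite horner0 subr0.
Qed.

End Derivatives.

(** * Generation modulo the maximal ideal *)

Section NakayamaLemma.
Context {R : realType} {g : nat} (t : nctopology) (y : 'I_g -> R[i]).
Local Notation C := R[i].
Local Notation Y := (scalar_point y).
Local Notation O := (germ t Y).
Local Notation x := (@coord R g t y).
Local Notation ev := (@ev R g t y).

Lemma Dr_scale k c (a : O) : Dr k (c *: a) = c *: Dr k a.
Proof.
suff /Dr_unique[_ ->] : c *: a = (c * ev a)%:A + \sum_k (c *: Dr k a) * x k by [].
rewrite {1}[a]DrE scalerDr scalerA scaler_sumr; congr (_ + _).
by apply: eq_bigr => j _; rewrite scalerAl.
Qed.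

Definition submodule (I : Type) (N : (I -> O) -> Prop) :=
  [/\ N (fun=> 0), forall f h, N f -> N h -> N (fun i => f i + h i) &
      forall b f, N f -> N (fun i => b * f i)].

(** Spanning modulo the maximal ideal: the x_k generate it as a right ideal, so
    the sums of the x_k n_k fill its product with N. *)
Definition spans_mod (I : Type) (N : (I -> O) -> Prop) m (F : 'I_m -> I -> O) :=
  forall f, N f -> exists (c : 'I_m -> C) (n : 'I_g -> I -> O),
    (forall k, N (n k)) /\
    forall i, f i = \sum_s c s *: F s i + \sum_k x k * n k i.

Lemma ev_spans (I : Type) (N : (I -> O) -> Prop) m (F : 'I_m -> I -> O) f i :
  spans_mod N F -> (forall s, ev (F s i) = 0) -> N f -> ev (f i) = 0.
Proof.
move=> sF F0 /sF[c [n [_ ->]]]; rewrite rmorphD !rmorph_sum /= !big1 ?addr0// => k _.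
  by rewrite rmorphM /= ev_coord mul0r.
by rewrite evZ F0 mulr0.
Qed.

(** Nakayama's lemma without a finiteness assumption on N. If an entry of F is
    a unit, clearing its column leaves a submodule generated modulo the maximal
    ideal by one element less. If all entries of F vanish at y, so do those of
    N, and taking right derivatives keeps the hypotheses, lowers the order of
    vanishing of F and loses nothing. If F = 0 or no generator is left, then N
    equals its product with the maximal ideal, so all coefficients of its
    elements vanish and N = 0. *)
Theorem nakayama m (I : Type) (N : (I -> O) -> Prop) (F : 'I_m -> I -> O) :
  submodule N -> (forall s, N (F s)) -> spans_mod N F ->
  forall f, N f -> exists h : 'I_m -> O, forall i, f i = \sum_s h s * F s i.
Proof.
elim: m I N F => [|m IHm] I N F sN NF sF.
  have c0 w : forall f i, N f -> coef w (f i) = 0.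
    elim: w => [|k w IH] f i Nf /=; first by apply: (ev_spans sF) => // -[].
    have [c [n [Nn ->]]] := sF _ Nf.
    by rewrite big_ord0 add0r D_coord_sum; exact: IH.
  move=> f Nf; exists (fun=> 0) => i; rewrite big_ord0.
  by apply: flat_germ => w; exact: c0.
(* The case of a unit u = G s0 i0: M2 consists of the elements of M whose entry
   at i0 is cleared. *)
have pivot (J : Type) (M : (J -> O) -> Prop) (G : 'I_m.+1 -> J -> O) (s0 : 'I_m.+1) (i0 : J) :
    submodule M -> (forall s, M (G s)) -> spans_mod M G -> ev (G s0 i0) != 0 ->
    forall f, M f -> exists h : 'I_m.+1 -> O, forall i, f i = \sum_s h s * G s i.
  move=> sM MG sG u0 f Mf; have [M0 MA MM] := sM.
  have [v [uv vu]] := germ_inverse u0.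
  set u := G s0 i0 in u0 uv vu.
  pose red (f : J -> O) i := f i - f i0 * v * G s0 i.
  have Mred h : M h -> M (red h).
    move=> Mh; have -> : red h = (fun i => h i + - (h i0 * v) * G s0 i).
      by apply/funext => i; rewrite mulNr.
    by apply: MA => //; exact: MM.
  have red0 h : red h i0 = 0 by rewrite /red -mulrA vu mulr1 subrr.
  pose M2 h := M h /\ h i0 = 0.
  have sM2 : submodule M2.
    split; first by split.
      by move=> h h' [Mh h0] [Mh' h'0]; split; [exact: MA|rewrite h0 h'0 addr0].
    by move=> b h [Mh h0]; split; [exact: MM|rewrite h0 mulr0].
  have redE h i : h i = red h i + h i0 * v * G s0 i by rewrite subrK.
  have rG0 i : red (G s0) i = 0 by rewrite /red uv mul1r subrr.
  have [|||h hE] := IHm J M2 (fun s => red (G (lift s0 s))) sM2 _ _ (red f).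
  - by move=> s; split; [exact: Mred|exact: red0].
  - move=> f2 [Mf2 f20]; have [c [n [Mn f2E]]] := sG _ Mf2.
    exists (fun s => c (lift s0 s)), (fun k => red (n k)); split.
      by move=> k; split; [exact: Mred|exact: red0].
    pose th := \sum_s c s *: (G s i0 * v) + \sum_k x k * (n k i0 * v).
    have f2E' i : f2 i = \sum_s c s *: red (G s) i + \sum_k x k * red (n k) i + th * G s0 i.
      rewrite f2E; under eq_bigr do rewrite (redE (G _)) scalerDr.
      under [X in _ + X = _]eq_bigr do rewrite (redE (n _)) mulrDr.
      rewrite !big_split /= addrACA; congr (_ + _).
      rewrite /th mulrDl !mulr_suml; congr (_ + _); apply: eq_bigr => k _.
        by rewrite scalerAl.
      by rewrite mulrA.
    have th0 : th = 0.
      have := f2E' i0; rewrite f20 !big1 => [|k _|s _]; first last.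
      - by rewrite red0 scaler0.
      - by rewrite red0 mulr0.
      rewrite !add0r => e.
      by rewrite -[th]mulr1 -uv mulrA -e mul0r.
    move=> i; rewrite f2E' th0 mul0r addr0; congr (_ + _).
    by rewrite (bigD1_ord s0)//= rG0 scaler0 add0r.
  - by split; [exact: Mred|exact: red0].
  exists (fun s => if unlift s0 s is Some s' then h s'
    else f i0 * v - \sum_s' h s' * (G (lift s0 s') i0 * v)).
  move=> i; rewrite (redE f) hE (bigD1_ord s0)//= unlift_none mulrBl -addrA [LHS]addrC.
  congr (_ + _); under [X in _ = _ + X]eq_bigr do rewrite liftK.
  rewrite mulr_suml -sumrN -big_split; apply: eq_bigr => s _ /=.
  by rewrite /red mulrBr addrC !mulrA.
have key n : forall (J : Type) (M : (J -> O) -> Prop) (G : 'I_m.+1 -> J -> O) s0 i0 w,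
    size w = n -> submodule M -> (forall s, M (G s)) -> spans_mod M G ->
    coef w (G s0 i0) != 0 ->
    forall f, M f -> exists h : 'I_m.+1 -> O, forall i, f i = \sum_s h s * G s i.
  elim: n => [|n IHn] J M G s0 i0 w wn sM MG sG cw.
    by case: w wn cw => // _ /= u; exact: (@pivot J M G s0 i0 sM MG sG u).
  have [[s [i u]]|h] := pselect (exists s i, ev (G s i) != 0); first exact: (@pivot J M G s i sM MG sG u).
  have G0 s i : ev (G s i) = 0.
    by apply/eqP/negPn/negP => u; apply: h; exists s, i.
  have M0 f i : M f -> ev (f i) = 0 by move=> Mf; exact: (ev_spans sG).
  case/lastP: w wn cw => [//|w k]; rewrite size_rcons coef_rcons => -[wn] cw.
  (* The index set grows by the letters, so that all right derivatives of an
     element are again one vector. *)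
  pose hat (f : J -> O) (ik : J * 'I_g) := Dr ik.2 (f ik.1).
  pose Mh h := exists2 f, M f & h = hat f.
  have [N0 NA NM] := sM.
  have sMh : submodule Mh.
    split.
    - by exists (fun=> 0) => //; apply/funext => -[i l]; rewrite /hat raddf0.
    - move=> _ _ [f Mf ->] [h' Mh' ->]; exists (fun i => f i + h' i); first exact: NA.
      by apply/funext => -[i l]; rewrite /hat raddfD.
    - move=> b _ [f Mf ->]; exists (fun i => b * f i); first exact: NM.
      by apply/funext => -[i l]; rewrite /hat /= Dr_mul M0// scale0r addr0.
  move=> f Mf.
  have [|||q hq] := IHn _ Mh (fun s => hat (G s)) s0 (i0, k) w wn sMh _ _ cw (hat f).
  - by move=> s; exists (G s).
  - move=> _ [f2 Mf2 ->]; have [c [nn [Mn f2E]]] := sG _ Mf2.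
    exists c, (fun l => hat (nn l)); split; first by move=> l; exists (nn l).
    move=> [i l]; rewrite /hat /= f2E raddfD /= !raddf_sum /=; congr (_ + _).
      by apply: eq_bigr => s _; rewrite Dr_scale.
    by apply: eq_bigr => s _; rewrite Dr_mul M0// scale0r addr0.
  - by exists f.
  exists q => i; rewrite (DrE (f i)) M0// scale0r add0r.
  under [RHS]eq_bigr do rewrite (DrE (G _ i)) G0 scale0r add0r mulr_sumr.
  rewrite exchange_big; apply: eq_bigr => l _ /=.
  have := hq (i, l); rewrite /hat /= => ->; rewrite mulr_suml.
  by apply: eq_bigr => s _; rewrite mulrA.
have [[s [i [w cw]]]|h] := pselect (exists s i w, coef w (F s i) != 0).
  exact: (key (size w) _ _ _ s i w).
have F0 s i : F s i = 0.
  apply: flat_germ => w; apply/eqP/negPn/negP => cw; apply: h; by exists s, i, w.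
have c0 w : forall f i, N f -> coef w (f i) = 0.
  elim: w => [|k w IH] f i Nf /=.
    by apply: (ev_spans sF) => // s; rewrite F0 raddf0.
  have [c [n [Nn ->]]] := sF _ Nf.
  rewrite big1 ?add0r ?D_coord_sum; first exact: IH.
  by move=> s _; rewrite F0 scaler0.
move=> f Nf; exists (fun=> 0) => i; rewrite big1 => [|s _]; last exact: mul0r.
by apply: flat_germ => w; exact: c0.
Qed.

End NakayamaLemma.

(** * Ranks and adjugates of matrices *)

Section MatrixRank.
Context {K : fieldType}.

Lemma rank_minor m n (M : 'M[K]_(m, n)) k : (k <= \rank M)%N ->
  exists (f : {ffun 'I_k -> 'I_m}) (h : {ffun 'I_k -> 'I_n}), \det (mxsub f h M) != 0.
Proof.
move=> kM; pose f := [ffun i => maxrankfun M (widen_ord kM i)].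
have rk : \rank (rowsub f M) = k.
  have -> : rowsub f M = rowsub (widen_ord kM) 1%:M *m rowsub (maxrankfun M) M.
    rewrite mul_rowsub_mx mul1mx.
    by apply/matrixP => i j; rewrite !mxE ffunE.
  rewrite mxrankMfree ?maxrowsub_free//.
  have -> : rowsub (widen_ord kM) 1%:M = pid_mx k :> 'M[K]_(k, \rank M).
    by apply/matrixP => i j; rewrite !mxE -val_eqE /= ltn_ord andbT.
  by rewrite rank_pid_mx.
have full : row_full (rowsub f M)^T by rewrite /row_full mxrank_tr rk.
exists f, (fullrankfun full); have := fullrowsub_unit full.
rewrite unitmxE unitfE -det_tr; congr (\det _ != 0).
by apply/matrixP => i j; rewrite !mxE.
Qed.

Lemma minor_rank m n (M : 'M[K]_(m, n)) k (f : 'I_k -> 'I_m) (h : 'I_k -> 'I_n) :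
  \det (mxsub f h M) != 0 -> (k <= \rank M)%N.
Proof.
move=> d; have u : mxsub f h M \in unitmx by rewrite unitmxE unitfE.
have e : mxsub f h M = rowsub f 1%:M *m M *m colsub h 1%:M.
  by rewrite mul_rowsub_mx mul1mx mulmx_colsub mulmx1; apply/matrixP => i j; rewrite !mxE.
apply: (@mulmx1_min_rank _ _ _ _ M (rowsub f 1%:M) (colsub h 1%:M *m invmx (mxsub f h M))).
by rewrite mulmxA -e mulmxV.
Qed.

(** Wedderburn's rank reduction. The reduced matrix kills E, whereas E is
    injective on the row space of E' M; so the row space of M is the direct sum
    of the two. *)
Lemma rank_reduction m n s (M : 'M[K]_(m, n)) (E : 'M[K]_(n, s)) (E' : 'M[K]_(s, m)) (G : 'M[K]_s) :
  E' *m M *m E *m G = 1%:M ->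
  let N := M - M *m E *m G *m (E' *m M) in \rank M = (s + \rank N)%N.
Proof.
move=> fG N; have Gf := mulmx1C fG; set L := E' *m M.
have NE : N *m E = 0.
  by rewrite /N mulmxBl -[_ *m (E' *m M) *m E]mulmxA -[M *m E *m G *m _]mulmxA Gf mulmx1 subrr.
have rL : \rank L = s.
  apply/eqP; rewrite eqn_leq rank_leq_row /=.
  apply: (@mulmx1_min_rank _ _ _ _ L 1%:M (E *m G)).
  by rewrite mul1mx mulmxA.
have dis : (L :&: N)%MS = 0.
  apply/eqP/rowV0P => v; rewrite sub_capmx => /andP[/submxP[w ->] /submxP[x e]].
  have : w *m L *m E = 0 by rewrite e -mulmxA NE mulmx0.
  rewrite -mulmxA => /(congr1 (mulmx^~ G)); rewrite mul0mx -mulmxA fG mulmx1 => ->.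
  by rewrite mul0mx.
rewrite -rL -(mxrank_disjoint_sum dis); apply/eqP; rewrite eqn_leq !mxrankS//.
  by rewrite addsmx_sub submxMl addmx_sub// -mulNmx /L mulmxA submxMl.
have -> : M = M *m E *m G *m L + N by rewrite addrC subrK.
by rewrite addmx_sub_adds// submxMl.
Qed.

End MatrixRank.

Section AdjugateConj.
Context {K : fieldType} {n : nat}.

(** After adding an indeterminate multiple of the identity, A and B have
    nonzero determinant, and the same one; there the adjugate is a multiple of
    the inverse. *)
Lemma adj_intertwine (A B V : 'M[K]_n) : V \in unitmx -> A *m V = V *m B ->
  \adj A *m V = V *m \adj B.
Proof.
move=> uV AV; pose X (M : 'M[K]_n) : 'M[{poly K}]_n := 'X%:M + map_mx polyC M.
have detX M : \det (X M) != 0.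
  have -> : X M = char_poly_mx (- M).
    by apply/matrixP => i j; rewrite !mxE polyCN opprK.
  by rewrite -/(char_poly _) monic_neq0 ?char_poly_monic.
pose W : 'M[{poly K}]_n := map_mx polyC V.
have XW : X A *m W = W *m X B.
  by rewrite mulmxDl mulmxDr -!map_mxM AV scalar_mxC.
have dW : \det W != 0 by rewrite det_map_mx polyC_eq0 -unitfE -unitmxE.
have dAB : \det (X A) = \det (X B).
  by apply: (mulIf dW); rewrite -det_mulmx XW det_mulmx mulrC.
have e : \adj (X A) *m W = W *m \adj (X B).
  suff h : \det (X A) *: (\adj (X A) *m W - W *m \adj (X B)) = 0.
    apply/matrixP => i j; have /matrixP/(_ i j) := h.
    rewrite !mxE => /eqP; rewrite mulf_eq0 (negbTE (detX A)) /= subr_eq0.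
    by move/eqP.
  have := congr1 (fun M => \adj (X A) *m M *m \adj (X B)) XW.
  rewrite !mulmxA mul_adj_mx mul_scalar_mx -[X in _ = X]mulmxA mul_mx_adj -dAB.
  by rewrite mul_mx_scalar scalerBr -!scalemxAl => ->; rewrite subrr.
have h0 (M : 'M[K]_n) : map_mx (horner_eval 0) (\adj (X M)) = \adj M.
  rewrite map_mx_adj; congr (\adj _); apply/matrixP => i j.
  rewrite /X !mxE; change (('X *+ (i == j) + (M i j)%:P).[0] = M i j).
  by rewrite hornerD hornerC hornerMn hornerX mul0rn add0r.
have h1 : map_mx (horner_eval 0) W = V.
  by apply/matrixP => i j; rewrite !mxE; exact: hornerC.
have := congr1 (map_mx (horner_eval 0)) e.
by rewrite !map_mxM !h0 h1.
Qed.

End AdjugateConj.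

(** * Block matrices with blocks of one shape *)

Section Flat.
Context {K : comNzRingType}.

Definition flat d e m n (B : 'I_d -> 'I_e -> 'M[K]_(m, n)) :
    'M[K]_(\sum_(i < d) m, \sum_(j < e) n) :=
  \mxblock_(i < d, j < e) B i j.

Lemma flat_eq d e m n (B B' : 'I_d -> 'I_e -> 'M[K]_(m, n)) :
  (forall i j, B i j = B' i j) -> flat B = flat B'.
Proof. exact: eq_mxblock. Qed.

Lemma flatE d e m n (B : 'I_d -> 'I_e -> 'M[K]_(m, n)) u v :
  flat B u v = B (tagnat.sig1 u) (tagnat.sig1 v) (tagnat.sig2 u) (tagnat.sig2 v).
Proof. exact: mxE. Qed.

Lemma flatM d e l m n p (B : 'I_d -> 'I_e -> 'M[K]_(m, n)) (D : 'I_e -> 'I_l -> 'M[K]_(n, p)) :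
  flat B *m flat D = flat (fun i k => \sum_j B i j *m D j k).
Proof. exact: mul_mxblock. Qed.

Lemma flatD d e m n (B D : 'I_d -> 'I_e -> 'M[K]_(m, n)) :
  flat (fun i j => B i j + D i j) = flat B + flat D.
Proof. exact: mxblockD. Qed.

Lemma flatB d e m n (B D : 'I_d -> 'I_e -> 'M[K]_(m, n)) :
  flat (fun i j => B i j - D i j) = flat B - flat D.
Proof. exact: mxblockB. Qed.

Lemma flat0 d e m n : flat (fun _ _ => 0) = 0 :> 'M[K]_(\sum_(i < d) m, \sum_(j < e) n).
Proof. exact: mxblock0. Qed.

Lemma flatZ d e m n c (B : 'I_d -> 'I_e -> 'M[K]_(m, n)) :
  flat (fun i j => c *: B i j) = c *: flat B.
Proof. by apply/matrixP => u v; rewrite !mxE. Qed.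

Definition fdiag d m n (B : 'M[K]_(m, n)) := flat (fun i j : 'I_d => if i == j then B else 0).

Lemma fdiagMl d e m n p (B : 'M[K]_(m, n)) (D : 'I_d -> 'I_e -> 'M[K]_(n, p)) :
  fdiag d B *m flat D = flat (fun i j => B *m D i j).
Proof.
rewrite flatM; apply: flat_eq => i j; rewrite (bigD1 i)//= eqxx big1 ?addr0// => k ki.
by rewrite eq_sym (negbTE ki) mul0mx.
Qed.

Lemma fdiagMr d e m n p (B : 'M[K]_(n, p)) (D : 'I_d -> 'I_e -> 'M[K]_(m, n)) :
  flat D *m fdiag e B = flat (fun i j => D i j *m B).
Proof.
rewrite flatM; apply: flat_eq => i j; rewrite (bigD1 j)//= eqxx big1 ?addr0// => k ki.
by rewrite (negbTE ki) mulmx0.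
Qed.

Lemma fdiagM d m n p (B : 'M[K]_(m, n)) (D : 'M[K]_(n, p)) :
  fdiag d B *m fdiag d D = fdiag d (B *m D).
Proof.
rewrite fdiagMl; apply: flat_eq => i j; case: eqP => _ //; exact: mulmx0.
Qed.

Lemma fdiag1 d m : fdiag d (1%:M : 'M[K]_m) = 1%:M.
Proof.
apply/matrixP => u v; rewrite flatE mxE.
have -> : (u == v) = (tagnat.sig1 u == tagnat.sig1 v) && (tagnat.sig2 u == tagnat.sig2 v :> nat).
  by rewrite -val_eqE /= -{1}(tagnat.sig2K u) -{1}(tagnat.sig2K v) tagnat.eq_Rank.
by case: (_ == _); rewrite mxE.
Qed.

End Flat.

(** * Lowest terms of expansions *)

Section LowestTerm.
Context {R : realType}.
Local Notation C := R[i].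

Lemma bigO_uniq l (c : C) : bigO l.+1 (fun z : C => c * z ^+ l) -> c = 0.
Proof.
move=> [d [M [d0 M0 h]]]; apply/eqP/negPn/negP => c0.
have nc := normc_gt0 c0.
have e0 : 0 < Num.min d (normc c / (M + 1)) by rewrite lt_min d0 divr_gt0// ltr_wpDl.
have [z z0] := small_scalar e0; rewrite lt_min => /andP[zd zc].
have nz := normc_gt0 z0.
have := h z zd; rewrite normcM normcX exprSr mulrA mulrAC ler_pM2r ?exprn_gt0//.
apply/negP; rewrite -ltNge; apply: (@le_lt_trans _ _ ((M + 1) * normc z)).
  by rewrite ler_wpM2r ?normc_ge0// lerDl ler01.
by rewrite mulrC -ltr_pdivlMr// ltr_wpDl.
Qed.

Lemma approx_lowest L l h (p : {poly C}) : (l < L)%N -> approx L h p ->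
  (forall i, (i < l)%N -> p`_i = 0) -> bigO l.+1 (fun z => h z - p`_l * z ^+ l).
Proof.
move=> lL hp p0.
have : approx l.+1 h (take_poly l.+1 p) by apply: approx_take; exact: bigO_leq hp.
have -> : take_poly l.+1 p = p`_l *: 'X^l.
  apply/polyP => i; rewrite coef_take_poly coefZ coefXn ltnS.
  by case: ltngtP => [/p0 ->||->]; rewrite ?mulr0 ?mulr1.
by apply: bigO_eq; exists 1 => // z _; rewrite hornerZ hornerXn.
Qed.

Lemma approx_neq0 L l h (p : {poly C}) : (l < L)%N -> approx L h p ->
  (forall i, (i < l)%N -> p`_i = 0) -> p`_l != 0 ->
  exists2 d : R, 0 < d & forall z, z != 0 -> normc z < d -> h z != 0.
Proof.
move=> lL hp p0 pl; have [d [M [d0 M0 hM]]] := approx_lowest lL hp p0.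
have nc := normc_gt0 pl.
exists (Num.min d (normc p`_l / (M + 1))); first by rewrite lt_min d0 divr_gt0// ltr_wpDl.
move=> z z0; rewrite lt_min => /andP[zd zc]; apply/eqP => hz.
have nz := normc_gt0 z0.
have := hM z zd; rewrite hz sub0r normcN normcM normcX exprSr mulrA mulrAC ler_pM2r ?exprn_gt0//.
apply/negP; rewrite -ltNge; apply: (@le_lt_trans _ _ ((M + 1) * normc z)).
  by rewrite ler_wpM2r ?normc_ge0// lerDl ler01.
by rewrite mulrC -ltr_pdivlMr// ltr_wpDl.
Qed.

(** The lowest term of a nonzero polynomial is not small. *)
Lemma approx_uniq L h (p q : {poly C}) : approx L h p -> approx L h q ->
  forall i, (i < L)%N -> p`_i = q`_i.
Proof.
move=> hp hq.
have pq : approx L (fun=> 0) (p - q).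
  have := bigOD hp (bigON hq); apply: bigO_eq; exists 1 => // z _.
  by rewrite hornerD hornerN; ring.
suff h0 : forall i, (i < L)%N -> (p - q)`_i = 0.
  by move=> i iL; have := h0 i iL; rewrite coefB => /eqP; rewrite subr_eq0 => /eqP.
elim/ltn_ind => i IH iL.
have := approx_lowest iL pq (fun j ji => IH j ji (ltn_trans ji iL)).
move=> /bigON H; apply: bigO_uniq (bigO_eq _ H); exists 1 => // z _.
by rewrite sub0r opprK.
Qed.

(** [flat_disc], rescaled. *)
Lemma flat_near h (d : R) : 0 < d ->
  (forall z0, normc z0 < d -> expands 3 (fun z => h (z0 + z))) ->
  (forall L, bigO L h) -> forall z, normc z < d -> h z = 0.
Proof.
move=> d0 hh hflat w wd.
have [->|w0] := eqVneq w 0.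
  have [e [M [e0 M0 hM]]] := hflat 1%N; apply: eq0_normc; apply/eqP.
  by rewrite eq_le normc_ge0 andbT; have := hM 0; rewrite normc0 expr1 mulr0; exact.
have scale_bigO L (k : C -> C) : bigO L k -> bigO L (fun z => k (z * w)).
  move=> [e [M [e0 M0 hM]]].
  have nw := normc_gt0 w0.
  exists (e / normc w), (M * normc w ^+ L); split; first by rewrite divr_gt0.
    by rewrite mulr_ge0 ?exprn_ge0 ?normc_ge0.
  move=> z ze; have := hM (z * w); rewrite normcM -ltr_pdivlMr// => /(_ ze).
  by rewrite exprMn [_ * normc w ^+ L]mulrC mulrA.
rewrite -[w]mul1r; apply: (@flat_disc R (fun z => h (z * w))) => //; last by rewrite normc1.
  move=> a a1; have [|p hp] := hh (a * w).
    by rewrite normcM; apply: le_lt_trans wd; rewrite ler_piMl ?normc_ge0.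
  exists (p \Po ('X * w%:P)); have := scale_bigO _ _ hp.
  apply: bigO_eq; exists 1 => // z _.
  by rewrite horner_comp hornerM hornerX hornerC mulrDl.
by move=> L; exact: scale_bigO.
Qed.

(** The contrapositive of [flat_disc] at the end 1 of the disc. *)
Lemma disc_nonzero (phi : C -> C) : (forall a, normc a <= 1 -> expands 3 (fun z => phi (a + z))) ->
  phi 1 != 0 -> forall dl : R, 0 < dl -> exists2 z, normc z < dl & phi z != 0.
Proof.
move=> hphi p1 dl dl0; apply: contrapT => hn; case/eqP: p1.
apply: flat_disc => //; last by rewrite normc1.
move=> L; exists dl, 0; split=> // z zd; rewrite mul0r.
have -> : phi z = 0; last by rewrite normc0.
by apply/eqP/negPn/negP => pz; apply: hn; exists z.
Qed.

End LowestTerm.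

Section DetLowest.
Context {A : idomainType}.

(** Take the factor X^l out of every entry. *)
Lemma det_lowest n l (T : 'M[{poly A}]_n) :
  (forall i j k, (k < l)%N -> (T i j)`_k = 0) ->
  (forall k, (k < l * n)%N -> (\det T)`_k = 0) /\
  (\det T)`_(l * n) = \det (\matrix_(i, j) (T i j)`_l).
Proof.
move=> T0; pose T' : 'M[{poly A}]_n := \matrix_(i, j) drop_poly l (T i j).
have -> : T = 'X^l *: T'.
  apply/matrixP => i j; rewrite !mxE mulrC -[LHS](poly_take_drop l).
  have -> : take_poly l (T i j) = 0.
    by apply/polyP => k; rewrite coef_take_poly coef0; case: ifP => // /T0.
  by rewrite add0r.
rewrite detZ -exprM; split=> [k kl|]; first by rewrite coefXnM kl.
rewrite coefXnM ltnn subnn -horner_coef0 -/(horner_eval 0 _) -det_map_mx.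
congr (\det _); apply/matrixP => i j; rewrite !mxE.
change ((drop_poly l (T i j)).[0] = ('X^l * drop_poly l (T i j))`_l).
by rewrite horner_coef0 coefXnM ltnn subnn.
Qed.

End DetLowest.

(** * Families with polynomial coefficients *)

Section TwoVariables.
Context {R : realType}.
Local Notation C := R[i].
Local Notation Q := {poly {poly C}}.

(** An element of Q is a polynomial in b whose coefficients are polynomials in
    a. *)
Definition pev (a b : C) : Q -> C := horner_eval a \o horner_eval b%:P.
HB.instance Definition _ a b := GRing.RMorphism.copy (pev a b) (horner_eval a \o horner_eval b%:P).

Lemma pevC a b c : pev a b c%:P%:P = c.
Proof. by rewrite /pev /= /horner_eval !hornerC. Qed.

Lemma nonroot (p : {poly C}) : p != 0 -> exists a, p.[a] != 0.
Proof.
move=> p0; apply: contrapT => /forallNP h.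
have := @max_poly_roots C p [seq (i%:R : C) | i <- iota 0 (size p)] p0.
rewrite size_map size_iota ltnn => H; have : false; last by [].
apply: H.
  by apply/allP => z _; rewrite rootE; apply/negPn/negP/h.
rewrite map_inj_uniq ?iota_uniq// => i j /eqP.
by rewrite eqr_nat => /eqP.
Qed.

Lemma pevE a b (q : Q) : pev a b q = (map_poly (horner_eval a) q).[b].
Proof. 
have := horner_map (horner_eval a) q b%:P.
by rewrite /= [X in _.[X] = _]hornerC => ->.
Qed.

Lemma pev_neq0 (q : Q) : q != 0 -> exists a b, pev a b q != 0.
Proof.
move=> q0; have [a a0] : exists a, (lead_coef q).[a] != 0 by apply: nonroot; rewrite lead_coef_eq0.
have h : map_poly (horner_eval a) q != 0.
  apply: contra a0 => /eqP/(congr1 (fun p : {poly C} => p`_(size q).-1)).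
  by rewrite coef_map coef0 => h; apply/eqP.
by have [b b0] := nonroot h; exists a, b; rewrite pevE.
Qed.

End TwoVariables.

Section Asymptotics.
Context {R : realType}.
Local Notation C := R[i].
Local Notation Q := {poly {poly C}}.
Implicit Types h : C -> C -> C -> C.

(** Functions of z, depending on parameters a and b, whose expansion at z = 0
    has coefficients polynomial in a and b. The second condition makes a
    function with zero expansion vanish near 0, by [flat_near]. *)
Definition asym h :=
  (forall L, exists P : {poly Q}, forall a b, approx L (h a b) (map_poly (pev a b) P)) /\
  (forall a b, exists2 d : R, 0 < d & forall z0, normc z0 < d ->
     expands 3 (fun z => h a b (z0 + z))).

Definition nz h := exists a b, forall d : R, 0 < d -> exists2 z, normc z < d & h a b z != 0.

Lemma asym_const c : asym (fun _ _ _ => c).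
Proof.
split=> [L|a b]; first exists c%:P%:P%:P => a b.
  by rewrite map_polyC /= pevC; exact: approx_const.
by exists 1 => // z0 _; exists c%:P; exact: approx_const.
Qed.

Lemma asymD h k : asym h -> asym k -> asym (fun a b z => h a b z + k a b z).
Proof.
move=> [h1 h2] [k1 k2]; split=> [L|a b].
  have [P hP] := h1 L; have [P' kP] := k1 L; exists (P + P') => a b.
  by rewrite rmorphD; exact: approxD.
have [d d0 hd] := h2 a b; have [e e0 ke] := k2 a b.
exists (Num.min d e); first by rewrite lt_min d0.
move=> z0; rewrite lt_min => /andP[/hd[p hp] /ke[q kq]].
by exists (p + q); exact: approxD.
Qed.

Lemma asymM h k : asym h -> asym k -> asym (fun a b z => h a b z * k a b z).
Proof.
move=> [h1 h2] [k1 k2]; split=> [L|a b].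
  have [P hP] := h1 L; have [P' kP] := k1 L; exists (P * P') => a b.
  by rewrite rmorphM; exact: approxM.
have [d d0 hd] := h2 a b; have [e e0 ke] := k2 a b.
exists (Num.min d e); first by rewrite lt_min d0.
move=> z0; rewrite lt_min => /andP[/hd hp /ke kq].
exact: expandsM.
Qed.

Lemma asym_eq h k : (forall a b z, h a b z = k a b z) -> asym h -> asym k.
Proof.
by move=> e; have -> : k = h by do 3 apply/funext => ?; rewrite e.
Qed.

Lemma asymB h k : asym h -> asym k -> asym (fun a b z => h a b z - k a b z).
Proof.
move=> hh kk; apply: asym_eq (asymD hh (asymM (asym_const (-1)) kk)) => a b z.
by rewrite mulN1r.
Qed.

Lemma asym_sum (I : Type) (r : seq I) (h : I -> C -> C -> C -> C) :
  (forall i, asym (h i)) -> asym (fun a b z => \sum_(i <- r) h i a b z).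
Proof.
move=> hh; elim: r => [|i r IH].
  by apply: asym_eq (asym_const 0) => a b z; rewrite big_nil.
by apply: asym_eq (asymD (hh i) IH) => a b z; rewrite big_cons.
Qed.

Lemma asym_prod (I : Type) (r : seq I) (h : I -> C -> C -> C -> C) :
  (forall i, asym (h i)) -> asym (fun a b z => \prod_(i <- r) h i a b z).
Proof.
move=> hh; elim: r => [|i r IH].
  by apply: asym_eq (asym_const 1) => a b z; rewrite big_nil.
by apply: asym_eq (asymM (hh i) IH) => a b z; rewrite big_cons.
Qed.

Lemma asym_det n (H : C -> C -> C -> 'M[C]_n) :
  (forall i j, asym (fun a b z => H a b z i j)) -> asym (fun a b z => \det (H a b z)).
Proof.
move=> hH; rewrite /determinant; apply: asym_sum => s; apply: asymM; first exact: asym_const.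
by apply: asym_prod => i; exact: hH.
Qed.

Lemma asym_adj n (H : C -> C -> C -> 'M[C]_n) i j :
  (forall i j, asym (fun a b z => H a b z i j)) -> asym (fun a b z => (\adj (H a b z)) i j).
Proof.
move=> hH.
apply: (@asym_eq (fun a b z => (-1) ^+ (j + i) * \det (row' j (col' i (H a b z))))).
  by move=> a b z; rewrite mxE.
apply: asymM; first exact: asym_const.
apply: asym_det => k l; apply: asym_eq (hH (lift j k) (lift i l)) => a b z.
by rewrite !mxE.
Qed.

Lemma asym_mulmx m n p (H : C -> C -> C -> 'M[C]_(m, n)) (K : C -> C -> C -> 'M[C]_(n, p)) i j :
  (forall i j, asym (fun a b z => H a b z i j)) -> (forall i j, asym (fun a b z => K a b z i j)) ->
  asym (fun a b z => (H a b z *m K a b z) i j).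
Proof.
move=> hH hK; apply: (@asym_eq (fun a b z => \sum_k H a b z i k * K a b z k j)).
  by move=> a b z; rewrite mxE.
by apply: asym_sum => k; exact: asymM.
Qed.

Lemma asym_coef h : asym h -> exists c : nat -> Q, forall L a b,
  approx L (h a b) (\poly_(l < L) pev a b (c l)).
Proof.
move=> [/choice[P hP] _]; exists (fun l => (P l.+1)`_l) => L a b.
have := approx_take (hP L a b); congr approx; apply/polyP => l.
rewrite coef_take_poly [in RHS]coef_poly; case: ltnP => // lL.
by rewrite (approx_uniq (bigO_leq lL (hP L a b)) (hP l.+1 a b) (ltnSn l)) coef_map.
Qed.

Lemma nz_coef h c : asym h ->
  (forall L a b, approx L (h a b) (\poly_(l < L) pev a b (c l))) ->
  nz h -> exists l, c l != 0.
Proof.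
move=> [_ h2] hc [a [b hab]]; apply: contrapT => /forallNP c0.
have [d d0 hd] := h2 a b.
have flat L : bigO L (h a b).
  apply: bigO_eq (hc L a b); exists 1 => // z _.
  have -> : \poly_(l < L) pev a b (c l) = 0.
    apply/polyP => l; rewrite coef_poly coef0; case: ifP => // _.
    by have /negP/negPn/eqP -> := c0 l; rewrite rmorph0.
  by rewrite horner0 subr0.
have [z zd] := hab d d0; rewrite (flat_near d0 hd flat zd) eqxx//.
Qed.

(** The polynomial q is the first nonzero coefficient. *)
Lemma nz_generic h : asym h -> nz h -> exists2 q : Q, q != 0 &
  forall a b, pev a b q != 0 ->
  exists2 d : R, 0 < d & forall z, z != 0 -> normc z < d -> h a b z != 0.
Proof.
move=> hh hn; have [c hc] := asym_coef hh.
have ex := nz_coef hh hc hn; case: (ex_minnP ex) => l cl lmin.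
exists (c l) => // a b q0.
apply: (approx_neq0 (ltnSn l) (hc l.+1 a b)) => [i il|]; rewrite coef_poly ?ltnSn//.
rewrite ltnW//; have [->|/lmin] := eqVneq (c i) 0; first by rewrite rmorph0.
by rewrite leqNgt il.
Qed.

Lemma nz_pair h k : asym h -> nz h -> asym k -> nz k -> exists a b,
  exists2 d : R, 0 < d & forall z, z != 0 -> normc z < d -> h a b z != 0 /\ k a b z != 0.
Proof.
move=> hh hn kk kn; have [q q0 hq] := nz_generic hh hn; have [q' q'0 kq] := nz_generic kk kn.
have [a [b]] := pev_neq0 (mulf_neq0 q0 q'0).
rewrite rmorphM mulf_eq0 negb_or => /andP[/hq[d d0 hd] /kq[e e0 ke]].
exists a, b, (Num.min d e); first by rewrite lt_min d0.
by move=> z z0; rewrite lt_min => /andP[zd ze]; split; [exact: hd|exact: ke].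
Qed.

End Asymptotics.

(** * Matrix families with the symmetries of a cyclic algebra *)

Section CyclicFamilies.
Context {R : realType}.
Local Notation C := R[i].
Local Notation Q := {poly {poly C}}.

Lemma poly_ext (p q : {poly C}) : (forall a, p.[a] = q.[a]) -> p = q.
Proof.
move=> h; apply/eqP; rewrite -subr_eq0; apply/negPn/negP => /nonroot[a].
by rewrite hornerD hornerN h subrr eqxx.
Qed.

Definition cj n (V M : 'M[C]_n) := V *m M *m invmx V.

Lemma cjP n (V M N : 'M[C]_n) : V \in unitmx -> N *m V = V *m M -> cj V M = N.
Proof. by move=> uV h; rewrite /cj -h mulmxK. Qed.

Lemma cjK n (V M : 'M[C]_n) : V \in unitmx -> cj V M *m V = V *m M.
Proof. by move=> uV; rewrite /cj mulmxKV. Qed.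

Lemma cjM n (V M N : 'M[C]_n) : V \in unitmx -> cj V (M *m N) = cj V M *m cj V N.
Proof. by move=> uV; apply: cjP => //; rewrite -mulmxA cjK// mulmxA cjK// mulmxA. Qed.

Lemma cjB n (V M N : 'M[C]_n) : cj V (M - N) = cj V M - cj V N.
Proof. by rewrite /cj mulmxBr mulmxBl. Qed.

Lemma cjZ n (V M : 'M[C]_n) c : cj V (c *: M) = c *: cj V M.
Proof. by rewrite /cj -scalemxAr -scalemxAl. Qed.

Lemma cj_adj n (V M : 'M[C]_n) : V \in unitmx -> cj V (\adj M) = \adj (cj V M).
Proof. by move=> uV; apply: cjP => //; apply: adj_intertwine => //; exact: cjK. Qed.

Lemma det_cj n (V M : 'M[C]_n) : V \in unitmx -> \det (cj V M) = \det M.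
Proof.
move=> uV; rewrite !det_mulmx mulrAC -det_mulmx mulmxV// det1 mul1r//.
Qed.

(** The two symmetries of a cyclic algebra; each is required near z = 0 only,
    where all values are defined. *)
Definition equivariant n (zeta : C) (V U : 'M[C]_n) (H : C -> C -> C -> 'M[C]_n) :=
  forall a b, exists2 d : R, 0 < d & forall z, normc z < d ->
    H (zeta * a) b z = cj V (H a b z) /\ H a (zeta * b) z = cj U (H a b z).

Lemma equivariant2 n zeta (V U : 'M[C]_n) (F : 'M[C]_n -> 'M[C]_n -> 'M[C]_n) H K :
  (forall M N, cj V (F M N) = F (cj V M) (cj V N)) ->
  (forall M N, cj U (F M N) = F (cj U M) (cj U N)) ->
  equivariant zeta V U H -> equivariant zeta V U K ->
  equivariant zeta V U (fun a b z => F (H a b z) (K a b z)).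
Proof.
move=> hV hU hH hK a b; have [d d0 hd] := hH a b; have [e e0 he] := hK a b.
exists (Num.min d e); first by rewrite lt_min d0.
move=> z; rewrite lt_min => /andP[/hd[-> ->] /he[-> ->]].
by rewrite hV hU.
Qed.

Variables (n : nat) (zeta : C).
Hypothesis zeta_prim : n.+1.-primitive_root zeta.
Local Notation s := n.+1.

Definition shift : 'S_s := perm (addIr (Zp1 : 'I_s)).
Definition shift_mx : 'M[C]_s := perm_mx shift.
Definition clock_mx : 'M[C]_s := diag_mx (\row_i zeta ^+ (i : 'I_s)).

Lemma zeta_neq0 : zeta != 0.
Proof.
apply/eqP => z0; have := prim_expr_order zeta_prim.
by rewrite z0 expr0n /= => /eqP; rewrite eq_sym oner_eq0.
Qed.

Lemma zetaD (i j : 'I_s) : zeta ^+ (i + j)%R = zeta ^+ i * zeta ^+ j.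
Proof. by rewrite -exprD; exact: (prim_expr_mod zeta_prim). Qed.

Lemma zeta_inj (i j : 'I_s) : zeta ^+ i = zeta ^+ j -> i = j.
Proof.
move=> /eqP; rewrite (eq_prim_root_expr zeta_prim) !modn_small// => /eqP.
exact: val_inj.
Qed.

Lemma shift_mx_unit : shift_mx \in unitmx. Proof. exact: unitmx_perm. Qed.

Lemma clock_mx_unit : clock_mx \in unitmx.
Proof.
rewrite unitmxE unitfE det_diag; apply/prodf_neq0 => i _.
by rewrite mxE expf_neq0// zeta_neq0.
Qed.

Lemma cj_shift (M : 'M[C]_s) i j : cj shift_mx M i j = M (i + Zp1) (j + Zp1).
Proof.
pose N : 'M[C]_s := \matrix_(i, j) M (i + Zp1) (j + Zp1).
rewrite (@cjP _ _ _ N) ?shift_mx_unit ?mxE// /shift_mx.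
have -> : N *m perm_mx shift = col_perm (shift^-1)%g N by rewrite col_permE invgK.
rewrite -row_permE; apply/matrixP => k l; rewrite !mxE; congr (M _ _); first by rewrite permE.
by rewrite -[RHS](permKV shift) [RHS]permE.
Qed.

Lemma cj_clock (M : 'M[C]_s) i j :
  cj clock_mx M i j = zeta ^+ i * M i j / zeta ^+ j.
Proof.
rewrite (@cjP _ _ _ (\matrix_(i, j) (zeta ^+ i * M i j / zeta ^+ j))) ?clock_mx_unit ?mxE//.
apply/matrixP => k l; rewrite mul_mx_diag mul_diag_mx !mxE.
by rewrite divfK// expf_neq0// zeta_neq0.
Qed.

(** The hypothesis on powers of zeta confines m to one cyclic diagonal, and the
    symmetry in a carries a nonzero entry along all of it: m is monomial. *)
Lemma cyclic_det (m : 'M[{poly C}]_s) (q : nat) :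
  (forall i j a, (m i j).[zeta * a] = (m (i + Zp1) (j + Zp1)).[a]) ->
  (forall i j, m i j != 0 -> zeta ^+ q * zeta ^+ j = zeta ^+ i) ->
  (exists i j, m i j != 0) -> \det m != 0.
Proof.
move=> hV hU [i0 [j0 m0]].
have mk (k : nat) : m (i0 + Zp1 *+ k) (j0 + Zp1 *+ k) != 0.
  elim: k => [|k IH]; first by rewrite !mulr0n !addr0.
  rewrite !mulrSr !addrA; apply: contra IH => /eqP e; apply/eqP.
  apply: poly_ext => a; rewrite horner0.
  by rewrite -[a](mulVKf zeta_neq0) hV e horner0.
have Zk (k : 'I_s) : k = Zp1 *+ k.
  by apply: val_inj; rewrite Zp_mulrn /= modnMml mul1n modn_small.
pose d := i0 - j0.
have mdiag j : m (d + j) j != 0.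
  have e : i0 + (j - j0) = d + j by rewrite addrA addrAC.
  by have := mk (j - j0); rewrite -Zk e [j0 + _]addrC subrK.
have moff i j : i != d + j -> m i j = 0.
  move=> ij; apply/eqP/negPn/negP => /hU e; case/eqP: ij; apply: zeta_inj.
  have e0 := hU _ _ m0; rewrite zetaD.
  have : zeta ^+ d * zeta ^+ j0 = zeta ^+ i0 by rewrite -zetaD subrK.
  rewrite -e0 => /(mulIf (expf_neq0 _ zeta_neq0)) ->.
  by rewrite e.
pose tau : 'S_s := perm (addrI d).
have : \det (row_perm tau m) != 0.
  have -> : row_perm tau m = diag_mx (\row_j m (d + j) j).
    apply/matrixP => i j; rewrite !mxE permE; have [->|ij] := eqVneq i j.
      by rewrite mulr1n.
    by rewrite mulr0n moff// (inj_eq (addrI d)).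
  rewrite det_diag; apply/prodf_neq0 => j _; rewrite mxE; exact: mdiag.
by rewrite row_permE det_mulmx mulf_eq0 negb_or => /andP[].
Qed.

(** The division property of cyclic algebras. The lowest coefficient in z, and
    then its lowest coefficient in b, inherit the symmetries; the latter is
    monomial by [cyclic_det], and its determinant is a coefficient of det H. *)
Lemma division (H : C -> C -> C -> 'M[C]_s) : (forall i j, asym (fun a b z => H a b z i j)) ->
  equivariant zeta shift_mx clock_mx H ->
  (exists i j, nz (fun a b z => H a b z i j)) -> nz (fun a b z => \det (H a b z)).
Proof.
move=> hH eH [i0 [j0 nz0]].
have /choice[c hc] : forall ij : 'I_s * 'I_s, exists c : nat -> Q, forall L a b,
    approx L (fun z => H a b z ij.1 ij.2) (\poly_(l < L) pev a b (c l)).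
  by move=> ij; exact: asym_coef.
have ex : exists l, [exists ij, c ij l != 0].
  have [l cl] := nz_coef (hH i0 j0) (hc (i0, j0)) nz0.
  by exists l; apply/existsP; exists (i0, j0).
case: (ex_minnP ex) => l /existsP[ij0 cl0] lmin.
have c_low ij k : (k < l)%N -> c ij k = 0.
  move=> kl; apply/eqP/negPn/negP => ck; have := lmin k; rewrite leqNgt kl => h.
  by have := h (introT existsP (ex_intro _ ij ck)).
have cV i j a b : pev (zeta * a) b (c (i, j) l) = pev a b (c (i + Zp1, j + Zp1) l).
  have [d d0 hd] := eH a b.
  have h1 := hc (i, j) l.+1 (zeta * a) b; have h2 := hc (i + Zp1, j + Zp1) l.+1 a b.
  have := approx_uniq (approx_eq (ex_intro2 _ _ d d0 _) h1) h2 (ltnSn l).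
  rewrite !coef_poly ltnSn; apply => z /hd[e _] /=.
  by rewrite e cj_shift.
have cU i j a b : pev a (zeta * b) (c (i, j) l) = zeta ^+ i / zeta ^+ j * pev a b (c (i, j) l).
  have [d d0 hd] := eH a b.
  have h1 := hc (i, j) l.+1 a (zeta * b).
  have h2 := approxM (approx_const l.+1 (zeta ^+ i / zeta ^+ j)) (hc (i, j) l.+1 a b).
  have := approx_uniq (approx_eq (ex_intro2 _ _ d d0 _) h1) h2 (ltnSn l).
  rewrite coefCM !coef_poly ltnSn; apply => z /hd[_ e] /=.
  by rewrite e cj_clock mulrAC.
have exq : exists q, [exists ij, (c ij l)`_q != 0].
  exists (size (c ij0 l)).-1; apply/existsP; exists ij0.
  by rewrite -lead_coefE lead_coef_eq0.
case: (ex_minnP exq) => q /existsP[[i1 j1] cq1] qmin.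
have q_low ij k : (k < q)%N -> (c ij l)`_k = 0.
  move=> kq; apply/eqP/negPn/negP => ck; have := qmin k; rewrite leqNgt kq => h.
  by have := h (introT existsP (ex_intro _ ij ck)).
pose c0 : 'M[Q]_s := \matrix_(i, j) c (i, j) l.
pose m : 'M[{poly C}]_s := \matrix_(i, j) (c (i, j) l)`_q.
have dm : \det m != 0.
  apply: (@cyclic_det m q); last by exists i1, j1; rewrite mxE.
    move=> i j a; rewrite !mxE.
    have e : map_poly (horner_eval (zeta * a)) (c (i, j) l) =
             map_poly (horner_eval a) (c (i + Zp1, j + Zp1) l).
      by apply: poly_ext => b; rewrite -!pevE.
    by have := congr1 (fun p : {poly C} => p`_q) e; rewrite !coef_map.
  move=> i j; rewrite mxE => /nonroot[a ma].
  pose p := map_poly (horner_eval a) (c (i, j) l).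
  have e : \poly_(k < size p) (zeta ^+ k * p`_k) = (zeta ^+ i / zeta ^+ j) *: p.
    apply: poly_ext => b; rewrite hornerZ horner_poly -[in RHS]pevE -cU pevE horner_coef.
    by apply: eq_bigr => k _; rewrite exprMn mulrA [p`_k * _]mulrC.
  have pq : p`_q != 0 by rewrite coef_map.
  have := congr1 (fun p : {poly C} => p`_q) e.
  rewrite coefZ coef_poly ifT; last first.
    by rewrite ltnNge; apply: contra pq => /(nth_default 0) ->.
  by move=> /(mulIf pq) ->; rewrite divfK// expf_neq0// zeta_neq0.
have dc0 : \det c0 != 0.
  have [|_ e] := @det_lowest _ s q c0; first by move=> i j k kq; rewrite mxE q_low.
  apply: contra dm => /eqP h; rewrite h coef0 in e.
  by rewrite (_ : m = \matrix_(i, j) (c0 i j)`_q) -?e//; apply/matrixP => i j; rewrite !mxE.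
have [a [b ab]] := pev_neq0 dc0.
(* The determinant starts in degree l s, so this order decides. *)
pose L := (l * s).+1.
have lL : (l < L)%N by rewrite ltnS leq_pmulr.
pose T : 'M[{poly C}]_s := \matrix_(i, j) \poly_(k < L) pev a b (c (i, j) k).
have hT : approx L (fun z => \det (H a b z)) (\det T).
  by apply: approx_det => i j; rewrite mxE; exact: hc (i, j) L a b.
have [|T0 Tl] := @det_lowest _ s l T.
  by move=> i j k kl; rewrite mxE coef_poly (ltn_trans kl lL) c_low// rmorph0.
have Tn : (\det T)`_(l * s) != 0.
  rewrite Tl; suff -> : \matrix_(i, j) (T i j)`_l = map_mx (pev a b) c0.
    by rewrite det_map_mx.
  by apply/matrixP => i j; rewrite mxE [in RHS]mxE !mxE coef_poly lL.
have [d d0 hd] := approx_neq0 (ltnSn _) hT T0 Tn.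
exists a, b => e e0.
have [z z0] := @small_scalar R (Num.min d e) ltac:(by rewrite lt_min d0).
by rewrite lt_min => /andP[zd ze]; exists z => //; exact: hd.
Qed.

End CyclicFamilies.

(** * Block elimination in cyclic families *)

Section Elimination.
Context {R : realType}.
Local Notation C := R[i].

(** The Schur complement of the block (i0, j0), multiplied by the determinant
    of that block to avoid its inverse. *)
Definition reduce d e n (h : 'I_d -> 'I_e -> 'M[C]_n) i0 j0 i j :=
  \det (h i0 j0) *: h i j - h i j0 *m \adj (h i0 j0) *m h i0 j.

Lemma rank_reduce d e n (h : 'I_d -> 'I_e -> 'M[C]_n) i0 j0 :
  \det (h i0 j0) != 0 ->
  \rank (flat h) = (n + \rank (flat (reduce h i0 j0)))%N.
Proof.
move=> f0; have fu : h i0 j0 \in unitmx by rewrite unitmxE unitfE.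
pose E : 'I_e -> 'I_1 -> 'M[C]_n := fun j _ => if j == j0 then 1%:M else 0.
pose E' : 'I_1 -> 'I_d -> 'M[C]_n := fun _ i => if i == i0 then 1%:M else 0.
pose G : 'I_1 -> 'I_1 -> 'M[C]_n := fun _ _ => invmx (h i0 j0).
have hE : flat h *m flat E = flat (fun i (_ : 'I_1) => h i j0).
  rewrite flatM; apply: flat_eq => i k; rewrite (bigD1 j0)//= /E eqxx mulmx1.
  by rewrite big1 ?addr0// => j /negbTE ->; rewrite mulmx0.
have E'h l (h' : 'I_d -> 'I_l -> 'M[C]_n) : flat E' *m flat h' = flat (fun (_ : 'I_1) j => h' i0 j).
  rewrite flatM; apply: flat_eq => i k; rewrite (bigD1 i0)//= /E' eqxx mul1mx.
  by rewrite big1 ?addr0// => j /negbTE ->; rewrite mul0mx.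
have hG : flat E' *m flat h *m flat E *m flat G = 1%:M.
  rewrite -[flat E' *m _ *m _]mulmxA hE E'h flatM -fdiag1; apply: flat_eq => i j.
  by rewrite big_ord1 !ord1 eqxx mulmxV.
apply: etrans (rank_reduction hG) _; congr addn; first exact: big_ord1.
rewrite hE E'h -!mulmxA !flatM -flatB -(mxrank_scale_nz _ f0) -flatZ; congr (\rank _).
apply: flat_eq => i j; rewrite !big_ord1 /G /reduce scalerBr; congr (_ - _).
rewrite -mulmxA scalemxAr; congr (_ *m _); rewrite scalemxAl; congr (_ *m _).
by rewrite /invmx fu scalerA mulfV// scale1r.
Qed.

Lemma freq_pigeonhole (I : finType) (P : I -> C -> Prop) :
  (forall d : R, 0 < d -> exists2 z, normc z < d & exists i, P i z) ->
  exists i, forall d : R, 0 < d -> exists2 z, normc z < d & P i z.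
Proof.
move=> h; apply: contrapT => /forallNP hn.
have /choice[dl hdl] : forall i, exists d : R, 0 < d /\ forall z, normc z < d -> ~ P i z.
  move=> i; apply: contrapT => /forallNP hi; apply: (hn i) => d d0.
  apply: contrapT => hz; apply: (hi d); split=> // z zd Pz; apply: hz; by exists z.
have [d d0 hd] : exists2 d : R, 0 < d & forall i, d <= dl i.
  suff [d d0 hd] : exists2 d : R, 0 < d & forall i, i \in enum I -> d <= dl i.
    by exists d => // i; apply: hd; rewrite mem_enum.
  elim: (enum I) => [|i s [d d0 hd]]; first by exists 1.
  exists (Num.min d (dl i)); first by rewrite lt_min d0; case: (hdl i).
  move=> j; rewrite inE ge_min => /orP[/eqP -> |/hd ->//]; by rewrite lexx orbT.
have [z zd [i Pi]] := h d d0.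
by case: (hdl i) => _ /(_ z (lt_le_trans zd (hd i))).
Qed.

Lemma nz_pigeonhole (I : finType) (h : I -> C -> C -> C -> C) a b :
  (forall d : R, 0 < d -> exists2 z, normc z < d & exists i, h i a b z != 0) ->
  exists i, nz (h i).
Proof.
by move=> /(freq_pigeonhole (P := fun i z => h i a b z != 0))[i hi]; exists i, a, b.
Qed.

Variables (n : nat) (zeta : C).
Hypothesis zeta_prim : n.+1.-primitive_root zeta.
Local Notation s := n.+1.
Local Notation V := (shift_mx n).
Local Notation U := (clock_mx n zeta).

Variables (d e : nat).
Implicit Types h : 'I_d -> 'I_e -> C -> C -> C -> 'M[C]_s.

Definition cyclic_family h :=
  (forall i j k l, asym (fun a b z => h i j a b z k l)) /\
  (forall i j, equivariant zeta V U (h i j)).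

Definition minor_nz k h := exists f : {ffun 'I_k -> _} * {ffun 'I_k -> _},
  nz (fun a b z => \det (mxsub f.1 f.2 (flat (fun i j => h i j a b z)))).

Lemma minor_asym k (f : {ffun 'I_k -> _} * {ffun 'I_k -> _}) h : cyclic_family h ->
  asym (fun a b z => \det (mxsub f.1 f.2 (flat (fun i j => h i j a b z)))).
Proof.
move=> [hh _]; apply: asym_det => u v.
by apply: asym_eq (hh _ _ _ _) => a b z; rewrite mxE flatE.
Qed.

Lemma rank_minor_nz k h a b :
  (forall dl : R, 0 < dl -> exists2 z, normc z < dl &
     (k <= \rank (flat (fun i j => h i j a b z)))%N) -> minor_nz k h.
Proof.
move=> hr; apply: (nz_pigeonhole (a := a) (b := b)) => dl /hr[z zd /rank_minor[f [g fg]]].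
by exists z => //; exists (f, g).
Qed.

Definition reduce_family h i0 j0 i j a b z := reduce (fun i j => h i j a b z) i0 j0 i j.

Lemma reduce_cyclic h i0 j0 : cyclic_family h -> cyclic_family (reduce_family h i0 j0).
Proof.
move=> [hh he]; have uV := @shift_mx_unit R n; have uU := clock_mx_unit zeta_prim.
split=> [i j k l|i j].
  apply: (@asym_eq R (fun a b z => \det (h i0 j0 a b z) * h i j a b z k l -
     (h i j0 a b z *m \adj (h i0 j0 a b z) *m h i0 j a b z) k l)).
    by move=> a b z; rewrite !mxE.
  apply: asymB.
    by apply: asymM => //; exact: asym_det.
  apply: asym_mulmx => // u v; apply: asym_mulmx => // u' v'; exact: asym_adj.
apply: (@equivariant2 R _ zeta V U (fun M N => M - N)); try by move=> M N; rewrite cjB.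
  apply: (@equivariant2 R _ zeta V U (fun M N => \det M *: N)) => // M N;
    by rewrite cjZ det_cj.
apply: (@equivariant2 R _ zeta V U mulmx) => //; try by move=> M N; rewrite cjM.
apply: (@equivariant2 R _ zeta V U (fun M N => M *m \adj N)) => // M N;
  by rewrite cjM// cj_adj.
Qed.

(** By [division], any nonzero block is a pivot that is generically invertible;
    it accounts for exactly s = n + 1 of the rank. *)
Lemma elimination k h : cyclic_family h -> minor_nz k h ->
  exists m, (k <= m * s)%N /\ minor_nz (m * s) h.
Proof.
elim/ltn_ind: k h => -[|k] IH h hc hk; first by exists 0%N.
have [f hf] := hk; have fa := minor_asym f hc.
have [ij nzij] : exists ij : ('I_d * 'I_e) * ('I_s * 'I_s),
    nz (fun a b z => h ij.1.1 ij.1.2 a b z ij.2.1 ij.2.2).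
  have [a [b hab]] := hf.
  apply: (nz_pigeonhole (a := a) (b := b)) => dl /hab[z zd fz]; exists z => //.
  apply: contrapT => /forallNP h0; case/eqP: fz.
  have -> : flat (fun i j => h i j a b z) = 0.
    rewrite -[RHS]flat0; apply: flat_eq => i j; apply/matrixP => u v; rewrite mxE.
    by have /negP/negPn/eqP := h0 ((i, j), (u, v)).
  rewrite (_ : mxsub _ _ _ = 0) ?det0//; by apply/matrixP => u v; rewrite !mxE.
case: ij nzij => [[i0 j0] [u v]] /= nzij.
have [hh he] := hc.
have nzd := division zeta_prim (hh i0 j0) (he i0 j0) (ex_intro _ u (ex_intro _ v nzij)).
have ad : asym (fun a b z => \det (h i0 j0 a b z)) by exact: asym_det.
have hrc := @reduce_cyclic h i0 j0 hc.
have [||m [km hm]] := IH (k.+1 - s)%N _ _ hrc; first by rewrite subSS ltnS leq_subr.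
  have [a [b [dl dl0 hab]]] := nz_pair fa hf ad nzd.
  apply: (rank_minor_nz (a := a) (b := b)) => dl' dl'0.
  have [z z0] := @small_scalar R (Num.min dl dl') ltac:(by rewrite lt_min dl0).
  rewrite lt_min => /andP[/(hab z z0)[/minor_rank rk dn] zd']; exists z => //.
  by rewrite leq_subLR; apply: leq_trans rk _; rewrite (rank_reduce dn).
exists m.+1; split; first by rewrite mulSn -leq_subLR.
have [f' hf'] := hm.
have [a [b [dl dl0 hab]]] := nz_pair (minor_asym f' hrc) hf' ad nzd.
apply: (rank_minor_nz (a := a) (b := b)) => dl' dl'0.
have [z z0] := @small_scalar R (Num.min dl dl') ltac:(by rewrite lt_min dl0).
rewrite lt_min => /andP[/(hab z z0)[/minor_rank rk dn] zd']; exists z => //.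
by rewrite (rank_reduce dn) mulSn leq_add2l.
Qed.

End Elimination.

(** * Interpolation by cyclic families *)

Section PrimitiveRoots.
Context {R : realType}.
Local Notation C := R[i].
Local Notation Q := {poly {poly C}}.

Lemma prim_root_exists n : exists z : C, n.+1.-primitive_root z.
Proof.
pose p : {poly C} := 'X^(n.+1) - 1; have [r Dp] := closed_field_poly_normal p.
have mp : p \is monic by rewrite monicXnsubC.
rewrite (monicP mp) scale1r in Dp.
have rn1 : all n.+1.-unity_root r by apply/allP => z; rewrite -root_prod_XsubC -Dp.
have sz : (n.+1 < (size r).+1)%N by rewrite -(size_prod_XsubC r id) -Dp size_XnsubC.
have ur : uniq r.
  by rewrite -separable.separable_prod_XsubC -Dp cyclotomic.separable_Xn_sub_1// pnatr_eq0.
by have /hasP[z _ hz] := cyclic.has_prim_root (ltn0Sn n) rn1 ur sz; exists z.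
Qed.

(** Lagrange's formula. *)
Lemma interpolation n (x v : 'I_n -> C) : injective x ->
  exists p : {poly C}, forall i, p.[x i] = v i.
Proof.
move=> xI; exists (\sum_i v i *: \prod_(j < n | j != i) ((x i - x j)^-1 *: ('X - (x j)%:P))).
move=> i; rewrite horner_sum (bigD1 i)//= hornerZ horner_prod big1 => [|j ji].
  rewrite mulr1 big1 ?addr0// => k ki; rewrite hornerZ horner_prod (bigD1 i) 1?eq_sym//=.
  by rewrite hornerZ hornerXsubC subrr mulr0 mul0r mulr0.
by rewrite hornerZ hornerXsubC mulVf// subr_eq0 (inj_eq xI) eq_sym.
Qed.

Variables (n : nat) (zeta : C).
Hypothesis zeta_prim : n.+1.-primitive_root zeta.
Local Notation s := n.+1.

(** The entry (i, j) of W is b^(i - j) times a polynomial in zeta^i a, which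
    has the two symmetries; the polynomials interpolate the entries of X at the
    powers of zeta. *)
Lemma cyclic_interpolation (X : 'M[C]_s) : exists W : 'M[Q]_s,
  [/\ map_mx (pev 1 1) W = X,
      forall a b, map_mx (pev (zeta * a) b) W = cj (shift_mx n) (map_mx (pev a b) W) &
      forall a b, map_mx (pev a (zeta * b)) W = cj (clock_mx n zeta) (map_mx (pev a b) W)].
Proof.
have /choice[kap kapE] : forall r : 'I_s, exists p : {poly C}, forall i : 'I_s,
    p.[zeta ^+ i] = X i (i - r).
  by move=> r; apply: interpolation => i j /(zeta_inj zeta_prim).
pose W : 'M[Q]_s := \matrix_(i, j)
  ((kap (i - j) \Po ((zeta ^+ i)%:P * 'X))%:P * 'X^(nat_of_ord (i - j)%R)).
have WE a b i j : pev a b (W i j) = (kap (i - j)).[zeta ^+ i * a] * b ^+ (i - j)%R.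
  rewrite mxE; change (((kap (i - j) \Po ((zeta ^+ i)%:P * 'X))%:P * 'X^(nat_of_ord (i - j)%R)).[b%:P].[a] =
    (kap (i - j)).[zeta ^+ i * a] * b ^+ (i - j)%R).
  by rewrite hornerM hornerC hornerXn hornerM horner_exp horner_comp hornerM !hornerC hornerX.
exists W; split=> [|a b|a b]; apply/matrixP => i j.
- by rewrite [LHS]mxE [LHS]WE mulr1 expr1n mulr1 kapE opprB addrCA subrr addr0.
- rewrite cj_shift [LHS]mxE [LHS]WE [RHS]mxE [RHS]WE opprD addrACA subrr addr0.
  rewrite (zetaD zeta_prim) mulrA; congr (_.[_ * _ * _] * _).
  by rewrite -[LHS]expr1 -(prim_expr_mod zeta_prim).
- rewrite (cj_clock zeta_prim) [LHS]mxE [LHS]WE mxE [pev a b _]WE exprMn.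
  have -> : zeta ^+ (i - j)%R = zeta ^+ i / zeta ^+ j.
    by rewrite -[i in RHS](subrK j) (zetaD zeta_prim (i - j) j) mulfK// expf_neq0// (zeta_neq0 zeta_prim).
  set u := zeta ^+ i; set v := (zeta ^+ j)^-1; by rewrite mulrCA [RHS]mulrAC.
Qed.

End PrimitiveRoots.

(** * Regularity of the generic rank *)

Section GermRank.
Context {R : realType} {g : nat} (t : nctopology) (y : 'I_g -> R[i]).
Local Notation C := R[i].
Local Notation Q := {poly {poly C}}.
Local Notation Y := (scalar_point y).
Local Notation O := (germ t Y).
Local Notation ncspace := (ncspace R g).

Lemma val_line_expands L (a : O) n (X W : 'I_g -> 'M[C]_n.+1) : dom a (ncpoint X) ->
  forall i j : 'I_n.+1, expands L (fun z => val a (ncpoint (fun k => X k + z *: W k)) i j).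
Proof.
move=> aX i j; have [sD oD _] := dom_nbhd a.
exact: (@line_expands R g t (dom a) (val a) sD oD (@val_intertwining _ _ _ _ a)
  (@ncval_bounded _ _ _ _ (germ_repr a)) L n X W aX i j).
Qed.

Definition lin n (W : 'I_g -> 'M[C]_n.+1) (z : C) : 'I_g -> 'M[C]_n.+1 :=
  fun k => (y k)%:M + z *: W k.

Lemma lin_near n (W : 'I_g -> 'M[C]_n.+1) (e : R) : 0 < e ->
  exists2 d : R, 0 < d & forall z, normc z < d -> sball y e (ncpoint (lin W z)).
Proof. by move=> /(line_near (fun k => (y k)%:M) W)[d d0 hd]; exists d. Qed.

Definition doms d e (A : 'I_d -> 'I_e -> O) : set ncspace :=
  [set p | forall i j, dom (A i j) p].

Lemma tev_doms d e (A : 'I_d -> 'I_e -> O) : tev t y (doms A).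
Proof. by apply: tev_all => i; apply: tev_all => j; exact: tev_dom. Qed.

Definition fval d e (A : 'I_d -> 'I_e -> O) n (X : 'I_g -> 'M[C]_n.+1) :=
  flat (fun i j => val (A i j) (ncpoint X) : 'M[C]_n.+1).

Section Rank.
Variables (d e : nat) (A : 'I_d -> 'I_e -> O).

Lemma minor_expands L n (X W : 'I_g -> 'M[C]_n.+1) k
    (f : 'I_k -> 'I_(\sum_(i < d) n.+1)) (h : 'I_k -> 'I_(\sum_(i < e) n.+1)) :
  doms A (ncpoint X) ->
  expands L (fun z => \det (mxsub f h (fval A (fun j => X j + z *: W j)))).
Proof.
move=> AX.
have /choice[P hP] : forall uv : 'I_k * 'I_k, exists p, approx L
    (fun z => mxsub f h (fval A (fun j => X j + z *: W j)) uv.1 uv.2) p.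
  move=> [u v]; pose i := tagnat.sig1 (f u); pose j := tagnat.sig1 (h v).
  have [p hp] := @val_line_expands L (A i j) n X W (AX i j) (tagnat.sig2 (f u)) (tagnat.sig2 (h v)).
  by exists p; apply: approx_eq hp; exists 1 => // z _; rewrite mxE /fval flatE.
exists (\det (\matrix_(u, v) P (u, v))); apply: approx_det => u v.
by rewrite mxE; exact: hP (u, v).
Qed.

Lemma lin1 n (X : 'I_g -> 'M[C]_n.+1) : lin (fun k => X k - (y k)%:M) 1 = X.
Proof. by apply/funext => k; rewrite /lin scale1r addrC subrK. Qed.

Lemma linD n (W : 'I_g -> 'M[C]_n.+1) a z :
  lin W (a + z) = (fun k => lin W a k + z *: W k).
Proof. by apply/funext => k; rewrite /lin scalerDl addrA. Qed.

(** A minor is a function on the disc that joins y to X. *)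
Lemma ray_minor n (X : 'I_g -> 'M[C]_n.+1) k
    (f : 'I_k -> 'I_(\sum_(i < d) n.+1)) (h : 'I_k -> 'I_(\sum_(i < e) n.+1)) :
  star_core y (doms A) (ncpoint X) -> \det (mxsub f h (fval A X)) != 0 ->
  forall dl : R, 0 < dl -> exists2 z, normc z < dl &
    \det (mxsub f h (fval A (lin (fun k => X k - (y k)%:M) z))) != 0.
Proof.
move=> sX fX; apply: disc_nonzero; last by rewrite lin1.
move=> a a1; have := @minor_expands 3 n (lin (fun k => X k - (y k)%:M) a)
  (fun k => X k - (y k)%:M) k f h (sX a a1).
by under [in X in X -> _]eq_fun do rewrite -linD.
Qed.

(** Rank k is reached arbitrarily close to y; by analyticity this means
    generically. *)
Definition often n k := forall dl : R, 0 < dl -> exists X : 'I_g -> 'M[C]_n.+1,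
  sball y dl (ncpoint X) /\ (k <= \rank (fval A X))%N.

(** On star-shaped neighborhoods no point exceeds the generic rank, however far
    it is from y. *)
Lemma star_often n (X : 'I_g -> 'M[C]_n.+1) k :
  star_core y (doms A) (ncpoint X) -> (k <= \rank (fval A X))%N -> often n k.
Proof.
move=> sX /rank_minor[f [h fh]] dl dl0.
have [dz dz0 hdz] := lin_near (fun k => X k - (y k)%:M) dl0.
have [z zd /minor_rank rk] := ray_minor sX fh dz0.
by exists (lin (fun k => X k - (y k)%:M) z); split=> //; exact: hdz.
Qed.

Lemma star_doms : tev t y (star_core y (doms A)).
Proof.
have [U nU UA] := tev_doms A; have [V nV VU] := star_core_nbhd nU.
by exists V => // p /VU sp z z1; exact/UA/sp.
Qed.

Lemma tev_near n (P : set ncspace) : tev t y P -> exists2 dl : R, 0 < dl &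
  forall X : 'I_g -> 'M[C]_n.+1, sball y dl (ncpoint X) -> P (ncpoint X).
Proof.
move=> [U [sU oU UY] UP]; have [dl dl0 sub] := ncopen_near oU (ypt_in n sU UY).
by exists dl => // X hX; apply/UP/sub; exists X.
Qed.

Lemma pev_hom a b n (W : 'I_g -> 'M[Q]_n) l (f : O) :
  map_mx (pev a b) (hom (fun c => c%:P%:P) W l f) = hom id (fun k => map_mx (pev a b) (W k)) l f.
Proof.
elim: l f => [|l IH] f /=.
  by rewrite map_scalar_mx /= pevC.
by rewrite map_mx_sum; apply: eq_bigr => k _; rewrite map_mxM IH.
Qed.

(** Put X - y into a cyclic family W(a, b). The values of A at y + z W(a, b)
    form a matrix of cyclic families because nc functions intertwine, and a
    minor that is nonzero at a = b = z = 1 is not identically zero for z near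
    0, by [ray_minor]; so [elimination] applies. *)
Theorem regularity n k : often n k -> exists m, (k <= m * n.+1)%N /\ often n (m * n.+1).
Proof.
move=> hk; have [dl dl0 near] := @tev_near n _ star_doms.
have [X [Xd /rank_minor[f [h fh]]]] := hk dl dl0.
have sX := near X Xd.
have [zeta zp] := @prim_root_exists R n.
have /choice[W hW] := fun k => cyclic_interpolation zp (X k - (y k)%:M).
pose Wab a b k := map_mx (pev a b) (W k).
pose H i j a b z : 'M[C]_n.+1 := val (A i j) (ncpoint (lin (Wab a b) z)).
have cH : cyclic_family zeta H.
  split=> [i j u v|i j a b].
    split=> [L|a b].
      exists (\poly_(l < L) hom (fun c => c%:P%:P) W l (A i j) u v) => a b.
      have := @taylor R g t y L n (Wab a b) (A i j) u v.
      congr approx; apply/polyP => l; rewrite coef_map !coef_poly /=.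
      case: ifP => _; last by rewrite rmorph0.
      by rewrite -pev_hom mxE.
    have [dz dz0 hdz] := tev_line (Wab a b) (tev_dom (A i j)).
    exists dz => // z0 /hdz Dz.
    have := @val_line_expands 3 (A i j) n (lin (Wab a b) z0) (Wab a b) Dz u v.
    by under [in X in X -> _]eq_fun do rewrite -linD.
  have [d1 d10 h1] := tev_line (Wab (zeta * a) b) (tev_dom (A i j)).
  have [d2 d20 h2] := tev_line (Wab a (zeta * b)) (tev_dom (A i j)).
  have [d3 d30 h3] := tev_line (Wab a b) (tev_dom (A i j)).
  exists (Num.min d1 (Num.min d2 d3)); first by rewrite !lt_min d10 d20.
  move=> z; rewrite !lt_min => /and3P[/h1 D1 /h2 D2 /h3 D3].
  have key V (W' : 'I_g -> 'M[C]_n.+1) : V \in unitmx -> (forall k, W' k = cj V (Wab a b k)) ->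
      dom (A i j) (ncpoint (lin W' z)) -> 
      val (A i j) (ncpoint (lin W' z)) = cj V (H i j a b z) :> 'M[C]_n.+1.
    move=> uV eV D'; apply/esym/cjP => //.
    apply: (@val_intertwining R g t y (A i j) (ncpoint (lin W' z)) (ncpoint (lin (Wab a b) z)) D' D3 V) => l.
    rewrite /nccomp /= /lin eV mulmxDl mulmxDr -scalemxAl -scalemxAr cjK//.
    by rewrite scalar_mxC.
  have k1 l : Wab (zeta * a) b l = cj (shift_mx n) (Wab a b l) by case: (hW l) => _ eV _; exact: eV.
  have k2 l : Wab a (zeta * b) l = cj (clock_mx n zeta) (Wab a b l) by case: (hW l) => _ _ eU; exact: eU.
  split; first exact: (key _ _ (@shift_mx_unit R n) k1 D1).
  exact: (key _ _ (clock_mx_unit zp) k2 D2).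
have mH : minor_nz k H.
  exists (f, h); exists 1, 1 => dz dz0.
  have [z zd hz] := ray_minor sX fh dz0; exists z; first exact: zd.
  have eW : Wab 1 1 = (fun k => X k - (y k)%:M) by apply/funext => l; case: (hW l).
  suff -> : (fun i j => H i j 1 1 z) = (fun i j =>
      val (A i j) (ncpoint (lin (fun k => X k - (y k)%:M) z)) : 'M[C]_n.+1) by exact: hz.
  by rewrite /H eW.
have [m [km [f' [a [b hab]]]]] := elimination zp cH mH.
exists m; split=> // e' e'0; have [dz dz0 hdz] := lin_near (Wab a b) e'0.
have [z zd hz] := hab dz dz0; exists (lin (Wab a b) z); split; first exact: hdz.
exact: minor_rank hz.
Qed.

End Rank.
End GermRank.

(** * Block matrices at direct sums *)

Section FlatBlocks.
Context {K : fieldType}.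

Local Notation inl1 m n := (row_mx (1%:M : 'M[K]_m) (0 : 'M[K]_(m, n))).
Local Notation inr1 m n := (row_mx (0 : 'M[K]_(n, m)) (1%:M : 'M[K]_n)).
Local Notation prl1 m n := (col_mx (1%:M : 'M[K]_m) (0 : 'M[K]_(n, m))).
Local Notation prr1 m n := (col_mx (0 : 'M[K]_(m, n)) (1%:M : 'M[K]_n)).

Section OneBlock.
Variables (d e m n : nat).
Variables (B1 : 'I_d -> 'I_e -> 'M[K]_m) (Z : 'I_d -> 'I_e -> 'M[K]_(m, n)).
Variable (B2 : 'I_d -> 'I_e -> 'M[K]_n).
Let M := flat (fun i j => block_mx (B1 i j) (Z i j) 0 (B2 i j)).

Lemma flat_upper : fdiag d (inl1 m n) *m M =
  flat B1 *m fdiag e (inl1 m n) + flat Z *m fdiag e (inr1 m n).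
Proof.
rewrite /M fdiagMl !fdiagMr -flatD; apply: flat_eq => i j.
rewrite mul_row_block !mul_mx_row !mulmx1 !mulmx0 !mul1mx !mul0mx !addr0.
by rewrite add_row_mx addr0 add0r.
Qed.

Lemma flat_lower : fdiag d (inr1 m n) *m M = flat B2 *m fdiag e (inr1 m n).
Proof.
rewrite /M fdiagMl !fdiagMr; apply: flat_eq => i j.
by rewrite mul_row_block !mul_mx_row !mulmx1 !mulmx0 !mul1mx !mul0mx !add0r.
Qed.

End OneBlock.

Lemma inl_prl e m n : fdiag e (inl1 m n) *m fdiag e (prl1 m n) = 1%:M.
Proof. by rewrite fdiagM mul_row_col mulmx0 addr0 mulmx1 fdiag1. Qed.

Lemma inl_prr e m n : fdiag e (inl1 m n) *m fdiag e (prr1 m n) = 0.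
Proof.
rewrite fdiagM mul_row_col mulmx0 mul0mx addr0.
by rewrite -[RHS]flat0; apply: flat_eq => i j; rewrite if_same.
Qed.

Lemma inr_prl e m n : fdiag e (inr1 m n) *m fdiag e (prl1 m n) = 0.
Proof.
rewrite fdiagM mul_row_col mulmx0 mul0mx addr0.
by rewrite -[RHS]flat0; apply: flat_eq => i j; rewrite if_same.
Qed.

Lemma inr_prr e m n : fdiag e (inr1 m n) *m fdiag e (prr1 m n) = 1%:M.
Proof. by rewrite fdiagM mul_row_col mul0mx add0r mulmx1 fdiag1. Qed.

Lemma prl_inl_prr_inr e m n : fdiag e (prl1 m n) *m fdiag e (inl1 m n) +
  fdiag e (prr1 m n) *m fdiag e (inr1 m n) = 1%:M.
Proof.
rewrite !fdiagM -fdiag1 -flatD; apply: flat_eq => i j; case: eqP => _; last exact: addr0.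
rewrite !mul_col_row !mulmx1 !mulmx0 add_block_mx !addr0 add0r.
by rewrite -scalar_mx_block.
Qed.

Lemma rank_flat_dsum d e m n (B1 : 'I_d -> 'I_e -> 'M[K]_m) (B2 : 'I_d -> 'I_e -> 'M[K]_n) :
  \rank (flat (fun i j => block_mx (B1 i j) 0 0 (B2 i j))) =
  (\rank (flat B1) + \rank (flat B2))%N.
Proof.
rewrite -rank_diag_block_mx.
set M := flat _; set P := block_mx (flat B1) 0 0 (flat B2).
pose J l := col_mx (fdiag l (inl1 m n)) (fdiag l (inr1 m n)).
pose J' l := row_mx (fdiag l (prl1 m n)) (fdiag l (prr1 m n)).
have JJ l : J' l *m J l = 1%:M by rewrite mul_row_col prl_inl_prr_inr.
have JP : J d *m M = P *m J e.
  rewrite mul_col_mx /M flat_upper flat_lower flat0 mul0mx addr0.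
  by rewrite mul_block_col !mul0mx addr0 add0r.
have J'J l : J l *m J' l = 1%:M.
  by rewrite mul_col_row inl_prl inl_prr inr_prl inr_prr -scalar_mx_block.
apply/eqP; rewrite eqn_leq; apply/andP; split.
  have -> : M = J' d *m P *m J e by rewrite -mulmxA -JP mulmxA JJ mul1mx.
  exact: leq_trans (mxrankM_maxl _ _) (mxrankM_maxr _ _).
have -> : P = J d *m M *m J' e by rewrite JP -mulmxA J'J mulmx1.
exact: leq_trans (mxrankM_maxl _ _) (mxrankM_maxr _ _).
Qed.

(** The product with the cokernel of L computes T modulo the row space of L. *)
Lemma rank_coker r l n (T : 'M[K]_(r, n)) (L : 'M[K]_(l, n)) :
  (\rank (T + L)%MS + \rank (kermx (T *m cokermx L)))%N = (r + \rank L)%N.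
Proof.
have e1 : (\rank (T *m cokermx L) + \rank (kermx (T *m cokermx L)))%N = r.
  by rewrite mxrank_ker subnKC// rank_leq_row.
have e2 : \rank (T + L)%MS = (\rank (T *m cokermx L) + \rank L)%N.
  rewrite -(mxrank_mul_ker (T + L)%MS (cokermx L)); congr addn.
    apply: eqmx_rank; apply/andP; split.
      rewrite addsmxMr addsmx_sub submx_refl /=.
      by rewrite (_ : L *m cokermx L = 0) ?sub0mx//; apply/eqP; rewrite -submxE.
    by rewrite submxMr// addsmxSl.
  apply: eqmx_rank; apply/andP; split.
    apply/row_subP => i; have := row_sub i ((T + L) :&: kermx (cokermx L))%MS.
    by rewrite sub_capmx => /andP[_ /sub_kermxP h]; rewrite submxE h.
  rewrite sub_capmx addsmxSr /=; apply/sub_kermxP/eqP; by rewrite -submxE.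
by rewrite e2 addnAC e1 addnC.
Qed.

End FlatBlocks.

Section Stack.
Context {T : Type} {d m : nat}.

Definition stack (a : 'I_d -> T) (b : 'I_m -> T) (i : 'I_(d + m)) : T :=
  match fintype.split i with inl k => a k | inr k => b k end.

Lemma stackl a b k : stack a b (lshift m k) = a k.
Proof. by rewrite /stack -[lshift _ _]/(unsplit (inl k)) unsplitK. Qed.

Lemma stackr a b k : stack a b (rshift d k) = b k.
Proof. by rewrite /stack -[rshift _ _]/(unsplit (inr k)) unsplitK. Qed.

End Stack.

Section FlatSelect.
Context {K : fieldType}.

Definition bsel (d' d n : nat) (f : 'I_d' -> 'I_d) : 'M[K]_(_, _) :=
  flat (fun i k => if k == f i then 1%:M else 0 : 'M[K]_n).

Lemma bselM d' d e m n (f : 'I_d' -> 'I_d) (B : 'I_d -> 'I_e -> 'M[K]_(m, n)) :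
  bsel m f *m flat B = flat (fun i j => B (f i) j).
Proof.
rewrite /bsel flatM; apply: flat_eq => i j; rewrite (bigD1 (f i))//= eqxx mul1mx.
by rewrite big1 ?addr0// => k /negbTE ->; rewrite mul0mx.
Qed.

Lemma submx_mxrows d e n p q (B : 'I_d -> 'I_e -> 'M[K]_(n, p)) (S : 'M[K]_(q, _)) :
  (forall i, (\mxrow_j B i j <= S)%MS) -> (flat B <= S)%MS.
Proof.
move=> h; apply/row_subP => u; rewrite /flat row_mxblock.
rewrite (_ : \mxrow_j _ = row (tagnat.sig2 u) (\mxrow_j B (tagnat.sig1 u) j)).
  exact: submx_trans (row_sub _ _) (h _).
by apply/rowP => l; rewrite !mxE.
Qed.

Lemma mxrow_sub_flat d e n p (B : 'I_d -> 'I_e -> 'M[K]_(n, p)) i :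
  (\mxrow_j B i j <= flat B)%MS.
Proof.
have -> : \mxrow_j B i j = (\mxrow_k (if k == i then 1%:M else 0 : 'M[K]_n)) *m flat B.
  rewrite /flat mul_mxrow_mxblock; apply: eq_mxrow => j.
  rewrite (bigD1 i)//= eqxx mul1mx big1 ?addr0// => k /negbTE ->; exact: mul0mx.
exact: submxMl.
Qed.

End FlatSelect.

(** * Points of maximal rank *)

Section GenericRank.
Context {R : realType} {g : nat} (t : nctopology) (y : 'I_g -> R[i]).
Local Notation C := R[i].
Local Notation Y := (scalar_point y).
Local Notation O := (germ t Y).
Local Notation ncspace := (ncspace R g).

Definition fvalp d e (A : 'I_d -> 'I_e -> O) (p : ncspace) :=
  flat (fun i j => val (A i j) p : 'M[C]_(ncsize p)).

Definition rval e (G : 'I_e -> O) (p : ncspace) :=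
  \mxrow_(j < e) (val (G j) p : 'M[C]_(ncsize p)).

Section DirectSums.
Variables (d e : nat) (A : 'I_d -> 'I_e -> O).

Lemma rank_dsum p q : doms A p -> doms A q -> doms A (dsum p q) ->
  \rank (fvalp A (dsum p q)) = (\rank (fvalp A p) + \rank (fvalp A q))%N.
Proof.
move=> Ap Aq Apq; rewrite -rank_flat_dsum; congr (\rank _); apply: flat_eq => i j.
exact: (dsum_val (@val_intertwining R g t y (A i j)) (Ap i j) (Aq i j) (Apq i j)).
Qed.

Lemma ncsize_dsum p q : ncsize (@dsum R g p q) = (ncsize p + ncsize q)%N.
Proof. by []. Qed.

Lemma ncsize_copies p k : ncsize (@copies R g p k) = (k.+1 * ncsize p)%N.
Proof. by elim: k => [|k IH]; rewrite ?mul1n// [copies _ _]/= ncsize_dsum IH mulSn. Qed.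

Lemma copies_in (Omega : set ncspace) p k : ncset Omega -> Omega p -> Omega (copies p k).
Proof. by move=> sO Op; elim: k => //= k IH; exact: sO. Qed.

Lemma rank_copies (Omega : set ncspace) p k : ncset Omega -> Omega `<=` doms A -> Omega p ->
  \rank (fvalp A (copies p k)) = (k.+1 * \rank (fvalp A p))%N.
Proof.
move=> sO OA Op; elim: k => [|k IH]; first by rewrite mul1n.
have Oc := copies_in k sO Op.
rewrite mulSn -IH [copies _ _]/=; apply: rank_dsum; apply: OA => //; exact: sO.
Qed.

(** A direct sum of copies is as close to y as the point itself. *)
Lemma often_copies n k l : often A n k -> often A (l.+1 * n.+1).-1 (l.+1 * k).
Proof.
move=> hk; apply/(_ : forall N, N.+1 = (l.+1 * n.+1)%N -> often A N (l.+1 * k)); last by [].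
move=> N eN dl dl0.
have [U [sU oU UY] UA] := tev_doms A.
have [d1 d10 near] := @tev_near R g t y n U (ex_intro2 _ _ U (And3 sU oU UY) (fun=> id)).
have [X [Xd rk]] := hk (Num.min dl d1) ltac:(by rewrite lt_min dl0).
have UX : U (ncpoint X).
  by apply: near => j; apply: lt_le_trans (Xd j) _; rewrite ge_min lexx orbT.
have sX : sball y dl (ncpoint X).
  by move=> j; apply: lt_le_trans (Xd j) _; rewrite ge_min lexx.
have := copies_in l (@sball_dsum R g y dl) sX.
have := rank_copies l sU UA UX; have := ncsize_copies (ncpoint X) l.
case: (copies _ _) => N' X'; rewrite /ncsize /= -eN => -[eN']; subst N'.
move=> er sX'; exists X'; split=> //.
by rewrite [X in (_ <= X)%N]er leq_mul2l rk orbT.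
Qed.

Lemma often_ypt n : often A n 0.
Proof. by move=> dl dl0; exists (fun k => (y k)%:M); split=> //; exact: ypt_sball. Qed.

(** By [regularity] the generic ratios of rank and size have integer upper
    bounds that are attained, and these are bounded by d; so the largest ratio
    is an attained integer. *)
Lemma generic_rank : exists nu : nat,
  (forall n k, often A n k -> (k <= nu * n.+1)%N) /\ exists n, often A n (nu * n.+1).
Proof.
have exP : exists m, `[< exists n, often A n (m * n.+1) >].
  by exists 0%N; apply/asboolP; exists 0%N; exact: often_ypt.
have ubP m : `[< exists n, often A n (m * n.+1) >] -> (m <= d)%N.
  move=> /asboolP[n /(_ 1 ltr01)[X [_ rk]]].
  have := leq_trans rk (rank_leq_row _).
  by rewrite sum_nat_const card_ord leq_pmul2r.
case: (ex_maxnP exP ubP) => nu /asboolP hnu numax; exists nu; split=> // n k hk.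
have [m [km hm]] := regularity hk; apply: leq_trans km _.
by rewrite leq_pmul2r// numax//; apply/asboolP; exists n.
Qed.

End DirectSums.

Section Closure.
Variables (d e : nat) (A : 'I_d -> 'I_e -> O) (nu n0 : nat).
Hypothesis nu_max : forall n k, often A n k -> (k <= nu * n.+1)%N.
Hypothesis nu_often : often A n0 (nu * n0.+1).

Definition good p := \rank (fvalp A p) = (nu * ncsize p)%N.

(** The rows that depend on those of A at every point of maximal rank. Since
    row spaces of values are compared, they form a left submodule. *)
Definition closure_rows (G : 'I_e -> O) :=
  tev t y [set p | good p -> (rval G p <= fvalp A p)%MS].

Lemma star_rank p : star_core y (doms A) p -> (\rank (fvalp A p) <= nu * ncsize p)%N.
Proof. by case: p => n X sp; apply: nu_max; exact: (star_often sp). Qed.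

Lemma closure_rows_submodule : submodule closure_rows.
Proof.
split.
- apply: tevS (val0 t y) => p e0 _; rewrite /rval.
  rewrite (_ : \mxrow_j _ = 0) ?sub0mx//.
  by apply/matrixP => u v; rewrite !mxE [val 0 p]e0 mxE.
- move=> F G nF nG.
  apply: tevS (tevI (tevI nF nG) (tev_all (fun j => valD (F j) (G j)))) => p [[hF hG] hv] gp.
  rewrite /rval (_ : \mxrow_j _ = rval F p + rval G p).
    by apply: addmx_sub; [exact: hF|exact: hG].
  by rewrite /rval -mxrowD; apply: eq_mxrow => j; exact: hv.
- move=> b F nF.
  apply: tevS (tevI nF (tev_all (fun j => valM b (F j)))) => p [hF hv] gp.
  rewrite /rval (_ : \mxrow_j _ = val b p *m rval F p).
    by apply: submx_trans (submxMl _ _) (hF gp).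
  by rewrite /rval mul_mxrow; apply: eq_mxrow => j; exact: hv.
Qed.

Lemma closure_rows_self i : closure_rows (A i).
Proof. by apply: tevT => p _; exact: mxrow_sub_flat. Qed.

(** At good points the new rows are redundant. If the rank were larger
    somewhere, then, after passing to copies, it would be larger close to y in
    a size with good points close to y. On the line through two such points,
    the product of a minor of the larger rank and a minor of A vanishes, but
    neither factor does. *)
Lemma closure_rank m (F : 'I_m -> 'I_e -> O) : (forall s, closure_rows (F s)) ->
  tev t y [set p | (\rank (fvalp (stack A F) p) <= nu * ncsize p)%N].
Proof.
move=> nF; set B := stack A F.
have tev0 := tevI (tevI (star_doms A) (star_doms B)) (tev_all nF).
have [Om [sO oO OY] sub] := tev0.
have sA : Om `<=` star_core y (doms A) by move=> p /sub[[]].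
have sB : Om `<=` star_core y (doms B) by move=> p /sub[[]].
have sBd : Om `<=` doms B by move=> p /sB/star_core_sub.
have goodB p : Om p -> (nu * ncsize p <= \rank (fvalp A p))%N ->
    (\rank (fvalp B p) <= nu * ncsize p)%N.
  move=> Op rk; have gp : good p by apply/eqP; rewrite eqn_leq rk star_rank//; exact: sA.
  rewrite -gp mxrankS//; apply: submx_mxrows => i.
  have [_ hF] := sub _ Op.
  rewrite /B /stack; case: (fintype.split i) => k; first exact: mxrow_sub_flat.
  exact: (hF k gp).
exists Om => // q Oq; rewrite /= leqNgt; apply/negP => rq.
pose N := (n0.+1 * ncsize q).-1.
have eN : N.+1 = (n0.+1 * ncsize q)%N by rewrite prednK// muln_gt0.
have oB : often B N (nu * N.+1).+1.
  have := rank_copies n0 sO sBd Oq; have := ncsize_copies q n0.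
  have := copies_in n0 sO Oq; case: (copies q n0) => N' X' OX' eN' er.
  have eNN : N' = N by apply/eqP; rewrite -eqSS eN -eN'.
  subst N'; apply: (star_often (sB _ OX')).
  apply: leq_trans (_ : (n0.+1 * (nu * ncsize q).+1 <= _)%N).
    by rewrite eN mulnCA [leqRHS]mulnS -[leqLHS]add1n leq_add2r.
  by rewrite [X in (_ <= X)%N]er leq_mul2l rq orbT.
have oA : often A N (nu * N.+1).
  have e1 : N = ((tag q).+1 * n0.+1).-1 by rewrite /N mulnC.
  by rewrite eN [(n0.+1 * _)%N]mulnC mulnCA e1; exact: often_copies.
have [dl dl0 near] := @tev_near R g t y N Om (ex_intro2 _ _ Om (And3 sO oO OY) (fun=> id)).
have dl3 : 0 < dl / 3 by rewrite divr_gt0.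
have [X [Xd /rank_minor[f [h fh]]]] := oB _ dl3.
have [X' [X'd /rank_minor[f' [h' fh']]]] := oA _ dl3.
pose W k := X' k - X k.
have Oline z : normc z <= 1 -> Om (ncpoint (fun k => X k + z *: W k)).
  move=> z1; apply: near => k; rewrite /nccomp /=.
  have -> : X k + z *: W k - (y k)%:M = (X k - (y k)%:M) +
      z *: ((X' k - (y k)%:M) - (X k - (y k)%:M)).
    by rewrite addrAC /W; congr (_ + _ *: _); rewrite opprB addrA subrK.
  apply: le_lt_trans (opnormD _ _) _.
  have -> : dl = dl / 3 + (dl / 3 + dl / 3) by field.
  apply: ltrD; first exact: Xd.
  apply: le_lt_trans (opnormZ_le _ _) _.
  apply: le_lt_trans (ler_piMl (opnorm_ge0 _) z1) _.
  apply: le_lt_trans (opnormD _ _) _; apply: ltrD; first exact: X'd.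
  by apply: le_lt_trans (opnormN _) _; exact: Xd.
pose phi z := \det (mxsub f h (fval B (fun k => X k + z *: W k))).
pose psi z := \det (mxsub f' h' (fval A (fun k => X k + z *: W k))).
have phi0 : phi 0 != 0.
  rewrite /phi (_ : (fun k => _) = X)//; apply/funext => k.
  by rewrite scale0r addr0.
have psi1 : psi 1 != 0.
  rewrite /psi (_ : (fun k => _) = X')//; apply/funext => k.
  by rewrite scale1r /W addrC subrK.
have OX : Om (ncpoint X).
  by have := Oline 0; rewrite normc0 (_ : (fun k => _) = X); [apply; exact: ler01|apply/funext => k; rewrite scale0r addr0].
have phi_exp : expands 3 (fun z => phi (0 + z)).
  have := @minor_expands R g t y _ _ B 3 N X W _ f h (sBd _ OX).
  by congr expands; apply/funext => z; rewrite /phi add0r.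
have [e1 e10 he1] := expands_near (isT : (0 < 3)%N) phi_exp (normc_gt0 phi0).
have m0 : 0 < Num.min 1 e1 by rewrite lt_min ltr01.
have [|z zd /minor_rank rk] := disc_nonzero _ psi1 m0.
  move=> a a1; have Oa := star_core_sub (sA _ (Oline a a1)).
  have := @minor_expands R g t y _ _ A 3 N (fun k => X k + a *: W k) W _ f' h' Oa.
  congr expands; apply/funext => z; rewrite /psi; congr (\det (mxsub _ _ (fval _ _))).
  by apply/funext => k; rewrite scalerDl addrA.
move: zd; rewrite lt_min => /andP[z1 ze].
have Oz := Oline z (ltW z1).
have : phi z != 0.
  apply/eqP => pz; have := he1 z; rewrite subr0 => /(_ ze).
  by rewrite pz sub0r normcN ltxx.
move=> /minor_rank; rewrite ltnNge => /negP; apply.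
exact: (goodB _ Oz rk).
Qed.

End Closure.
End GenericRank.

(** * Independent rows and the factorization *)

Section IndependentRows.
Context {R : realType} {g : nat} (t : nctopology) (y : 'I_g -> R[i]).
Local Notation C := R[i].
Local Notation Y := (scalar_point y).
Local Notation O := (germ t Y).
Local Notation ncspace := (ncspace R g).
Local Notation x := (@coord R g t y).
Local Notation ev := (@ev R g t y).

(** The corner block displays the left derivatives at y. *)
Lemma val_ut (a : O) (p : ncspace) (z : 'I_g -> 'M[C]_(1, ncsize p))
    (q := @ut R g Y p z) :
  (forall k, dom (D k a) Y /\ dom (D k a) p /\ dom (D k a) q) ->
  val a p = (ev a)%:M + \sum_k (nccomp p k - (y k)%:M) *m val (D k a) p ->
  val a q = (ev a)%:M + \sum_k (nccomp q k - (y k)%:M) *m val (D k a) q ->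
  val a q = block_mx (ev a)%:M (\sum_k z k *m val (D k a) p) 0 (val a p)
    :> 'M[C]_(1 + ncsize p).
Proof.
move=> hD ep eq; rewrite [LHS]eq.
have -> : ((ev a)%:M : 'M[C]_(ncsize q)) =
    block_mx (ev a)%:M 0 0 (ev a)%:M :> 'M[C]_(1 + ncsize p).
  exact: (@scalar_mx_block _ 1 (ncsize p)).
have es k : (nccomp q k - (y k)%:M) *m val (D k a) q =
   block_mx 0 (z k *m val (D k a) p) 0 ((nccomp p k - (y k)%:M) *m val (D k a) p)
   :> 'M[C]_(1 + ncsize p).
  have [DY [Dp Dq]] := hD k.
  have e1 : nccomp q k - (y k)%:M = block_mx 0 (z k) 0 (nccomp p k - (y k)%:M) :> 'M[C]_(1 + ncsize p).
    have -> : ((y k)%:M : 'M[C]_(ncsize q)) = block_mx (y k)%:M 0 0 (y k)%:M :> 'M[C]_(1 + ncsize p).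
      exact: (@scalar_mx_block _ 1 (ncsize p)).
    rewrite [LHS](_ : _ = block_mx (y k)%:M (z k) 0 (nccomp p k) - block_mx (y k)%:M 0 0 (y k)%:M)//.
    by rewrite opp_block_mx add_block_mx !oppr0 !addr0 subrr.
  have e2 := ut_val (@val_intertwining R g t y (D k a)) DY Dp Dq.
  apply: etrans (congr2 (@mulmx C _ (1 + ncsize p) _) e1 e2) _.
  by rewrite mulmx_block !mul0mx !mulmx0 !add0r.
have -> : \sum_k (nccomp q k - (y k)%:M) *m val (D k a) q =
   block_mx 0 (\sum_k z k *m val (D k a) p) 0 (\sum_k (nccomp p k - (y k)%:M) *m val (D k a) p)
   :> 'M[C]_(1 + ncsize p).
  under eq_bigr do rewrite es.
  elim/big_ind3 : _ => //; first by rewrite block_mx0.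
  move=> A1 B1 C1 A2 B2 C2 -> ->.
  by apply: etrans (@add_block_mx _ 1 (ncsize p) 1 (ncsize p) _ _ _ _ _ _ _ _) _; rewrite !addr0.
apply: etrans (@add_block_mx _ 1 (ncsize p) 1 (ncsize p) _ _ _ _ _ _ _ _) _.
by rewrite !addr0 add0r -ep.
Qed.

Section Bound.
Variables (d e : nat) (A : 'I_d -> 'I_e -> O) (nu n0 : nat).
Hypothesis nu_max : forall n k, often A n k -> (k <= nu * n.+1)%N.
Hypothesis nu_often : often A n0 (nu * n0.+1).
Local Notation N := (closure_rows A nu).

(** Linear independence over the complex numbers modulo the maximal ideal times
    the closure of A. *)
Definition independent_mod m (F : 'I_m -> 'I_e -> O) :=
  forall c : 'I_m -> C,
    (exists n : 'I_g -> 'I_e -> O, (forall k, N (n k)) /\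
       forall j, \sum_s c s *: F s j = \sum_k x k * n k j) -> forall s, c s = 0.

Variables (m : nat) (F : 'I_m -> 'I_e -> O).
Hypothesis NF : forall s, N (F s).

Definition top_right (p : ncspace) (z : 'I_g -> 'M[C]_(1, ncsize p)) s j : 'M[C]_(1, ncsize p) :=
  \sum_k z k *m val (D k (F s j)) p.

(** The rows that F contributes to the value at [[y, z], [0, p]], through the
    first row of that point. *)
Definition top_rows p z := row_mx (flat (fun s j => (ev (F s j))%:M : 'M[C]_1)) (flat (@top_right p z)).

Definition low_rows (p : ncspace) := row_mx (0 : 'M[C]_(_, \sum_(j < e) 1)) (fvalp A p).

(** The combinations of these rows that fall into the row space of A(p). *)
Definition relations p z := kermx (top_rows z *m cokermx (low_rows p)).

Lemma relationsP n p z (u : 'M[C]_(n, _)) :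
  (u <= @relations p z)%MS = (u *m top_rows z <= low_rows p)%MS.
Proof. by rewrite [RHS]submxE -mulmxA; apply/sub_kermxP/eqP. Qed.

Let B := stack A F.

Definition region : set ncspace := [set p | [/\ doms A p, doms B p,
   (forall i j k, dom (D k (B i j)) p),
   (forall i j, val (B i j) p = (ev (B i j))%:M +
      \sum_k (nccomp p k - (y k)%:M) *m val (D k (B i j)) p) &
   (\rank (fvalp A p) <= nu * ncsize p)%N /\ (\rank (fvalp B p) <= nu * ncsize p)%N]].

Lemma tev_region : tev t y region.
Proof.
have h1 := tev_all (fun i => tev_all (fun j => tev_all (fun k => tev_dom (D k (B i j))))).
have h2 := tev_all (fun i => tev_all (fun j => val_left (B i j))).
have h3 := tevI (star_doms A) (closure_rank nu_max nu_often NF).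
apply: tevS (tevI (tevI (tev_doms B) h1) (tevI h2 h3)) => p [[h4 h5] [h6 [h7 h8]]].
split=> //; first exact: (star_core_sub h7).
by split=> //; exact: (star_rank nu_max h7).
Qed.

Variable Om : set ncspace.
Hypotheses (nOm : ncnbhd t Y Om) (Om_region : Om `<=` region).

(** The value at [[y, cz], [0, p]] has rank at most nu (1 + size p), of which
    the lower rows account for nu (size p); so at most nu of the top rows are
    independent modulo the lower ones. *)
Lemma rank_relations p (z : 'I_g -> 'M[C]_(1, ncsize p)) : Om p -> good A nu p ->
  (m <= nu + \rank (relations z))%N.
Proof.
move=> Op gp; have [sO oO OY] := nOm.
have [dl dl0 hdl] := @ut_open R g t Om Y p z sO oO OY Op.
have [c c0 cd] := small_scalar dl0.
set q := @ut R g Y p (fun k => c *: z k); have Oq : Om q by exact: hdl.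
have [_ bY DY _ _] := Om_region OY; have [_ bp Dp vp _] := Om_region Op.
have [_ bq Dq vq [_ rq]] := Om_region Oq.
pose Z i j : 'M[C]_(1, ncsize p) := \sum_k (c *: z k) *m val (D k (B i j)) p.
have qE : fvalp B q = flat (fun i j => block_mx (ev (B i j))%:M (Z i j) 0 (val (B i j) p : 'M[C]_(ncsize p))).
  by apply: flat_eq => i j; apply: val_ut => //.
pose il := fdiag e (row_mx (1%:M : 'M[C]_1) (0 : 'M[C]_(1, ncsize p))).
pose ir := fdiag e (row_mx (0 : 'M[C]_(ncsize p, 1)) (1%:M : 'M[C]_(ncsize p))).
pose Rt := row_mx (fdiag e (col_mx (1%:M : 'M[C]_1) (0 : 'M[C]_(ncsize p, 1))))
  (c^-1 *: fdiag e (col_mx (0 : 'M[C]_(1, ncsize p)) (1%:M : 'M[C]_(ncsize p)))).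
have ilR : il *m Rt = row_mx 1%:M 0 by rewrite mul_mx_row -scalemxAr inl_prl inl_prr scaler0.
have irR : ir *m Rt = row_mx 0 (c^-1)%:M by rewrite mul_mx_row -scalemxAr inr_prl inr_prr scalemx1.
have hT : (top_rows z <= fvalp B q *m Rt)%MS.
  have -> : top_rows z = bsel 1 (@rshift d m) *m fdiag (d + m)
      (row_mx (1%:M : 'M[C]_1) (0 : 'M[C]_(1, ncsize p))) *m (fvalp B q *m Rt).
    rewrite qE -mulmxA [fdiag _ _ *m (_ *m _)]mulmxA flat_upper -/il -/ir.
    rewrite mulmxDl -!mulmxA ilR irR mulmxDr !mulmxA !bselM.
    rewrite !mul_mx_row !mulmx0 mulmx1 add_row_mx addr0 add0r mul_mx_scalar -flatZ.
    congr row_mx; apply: flat_eq => s j; first by rewrite /B stackr.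
    rewrite /Z /top_right scaler_sumr; apply: eq_bigr => k _.
    by rewrite /B stackr -scalemxAl scalerA mulVf// scale1r.
  exact: submxMl.
have hL : (low_rows p <= fvalp B q *m Rt)%MS.
  have -> : low_rows p = c *: (bsel (ncsize p) (@lshift d m) *m fdiag (d + m)
      (row_mx (0 : 'M[C]_(ncsize p, 1)) (1%:M : 'M[C]_(ncsize p)))) *m (fvalp B q *m Rt).
    rewrite -scalemxAl qE -mulmxA [fdiag _ _ *m (_ *m _)]mulmxA flat_lower -/ir -mulmxA irR.
    rewrite mulmxA bselM mul_mx_row mulmx0 mul_mx_scalar scale_row_mx scaler0 scalerA.
    rewrite mulfV// scale1r; congr row_mx; apply: flat_eq => i j.
    by rewrite /B stackl.
  exact: submxMl.
have rTL : (\rank (top_rows z + low_rows p)%MS <= nu * (1 + ncsize p))%N.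
  apply: leq_trans rq; apply: leq_trans (mxrankM_maxl _ Rt).
  by apply: mxrankS; rewrite addsmx_sub hT.
have rL : \rank (low_rows p) = (nu * ncsize p)%N by rewrite rank_row_0mx gp.
have e1 := rank_coker (top_rows z) (low_rows p); rewrite -/(relations z) rL in e1.
have sm : (\sum_(s < m) 1)%N = m by rewrite sum_nat_const card_ord muln1.
rewrite -(leq_add2r (nu * ncsize p)) -[X in (X + _ <= _)%N]sm -e1 addnAC leq_add2r.
by apply: leq_trans rTL _; rewrite mulnDr muln1.
Qed.

(** A relation at a direct sum is a relation at each summand; hence relations
    at a point where they are fewest hold at all points. *)
Lemma relations_dsum p p' (z : 'I_g -> 'M[C]_(1, ncsize p)) (z' : 'I_g -> 'M[C]_(1, ncsize p')) :
  Om p -> Om p' ->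
  let zz := (fun k => row_mx (z k) (z' k)) : 'I_g -> 'M[C]_(1, ncsize (dsum p p')) in
  (relations zz <= relations z)%MS /\ (relations zz <= relations z')%MS.
Proof.
move=> Op Op' zz; have [sO _ _] := nOm; have Oq := sO _ _ Op Op'.
have [ap bp Dp _ _] := Om_region Op; have [ap' bp' Dp' _ _] := Om_region Op'.
have [aq bq Dq _ _] := Om_region Oq.
have hu := @relationsP _ (dsum p p') zz (relations zz); rewrite submx_refl in hu; move/esym in hu.
have ZE s j : top_right zz s j = row_mx (top_right z s j) (top_right z' s j) :> 'M[C]_(1, ncsize p + ncsize p').
  rewrite /top_right.
  have es k : zz k *m val (D k (F s j)) (dsum p p') =
     row_mx (z k *m val (D k (F s j)) p) (z' k *m val (D k (F s j)) p') :> 'M[C]_(1, ncsize p + ncsize p').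
    have Bs : B (rshift d s) j = F s j by rewrite /B stackr.
    have Ds p1 := (fun Dp1 : forall i j k, dom (D k (B i j)) p1 => Dp1 (rshift d s) j k).
    have := Ds _ Dp; have := Ds _ Dp'; have := Ds _ Dq; rewrite Bs => D1 D2 D3.
    have e2 := dsum_val (@val_intertwining R g t y (D k (F s j))) D3 D2 D1.
    apply: etrans (congr1 (@mulmx C _ (ncsize p + ncsize p') _ (row_mx (z k) (z' k))) e2) _.
    apply: etrans (@mul_row_block _ 1 (ncsize p) (ncsize p') (ncsize p) (ncsize p') _ _ _ _ _ _) _.
    by rewrite !mulmx0 addr0 add0r.
  under eq_bigr do rewrite es.
  elim/big_ind3 : _ => //; first by rewrite row_mx0.
  by move=> A1 B1 C1 A2 B2 C2 -> ->; exact: (@add_row_mx _ 1 (ncsize p) (ncsize p')).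
have TE : top_rows zz = row_mx (flat (fun s j => (ev (F s j))%:M : 'M[C]_1))
    (flat (fun s j => row_mx (top_right z s j) (top_right z' s j))).
  by congr row_mx; apply: flat_eq.
have AE : fvalp A (dsum p p') = flat (fun i j => block_mx (val (A i j) p : 'M[C]_(ncsize p)) 0 0 (val (A i j) p' : 'M[C]_(ncsize p'))).
  apply: flat_eq => i j.
  exact: (dsum_val (@val_intertwining R g t y (A i j)) (ap i j) (ap' i j) (aq i j)).
have half r (z1 : 'I_g -> 'M[C]_(1, ncsize r)) (S : 'M[C]_(ncsize p + ncsize p', ncsize r)) :
    (forall s j, row_mx (top_right z s j) (top_right z' s j) *m S = top_right z1 s j) ->
    (forall i j, block_mx (val (A i j) p : 'M[C]_(ncsize p)) 0 0 (val (A i j) p' : 'M[C]_(ncsize p')) *m S =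
       S *m val (A i j) r) ->
    (relations zz <= relations z1)%MS.
  move=> hz hA; rewrite relationsP.
  pose P := block_mx (1%:M : 'M[C]_(\sum_(j < e) 1)) 0 0 (fdiag e S).
  have -> : top_rows z1 = top_rows zz *m P.
    rewrite TE mul_row_block !mulmx0 addr0 add0r mulmx1 fdiagMr; congr row_mx.
    by apply: flat_eq => s j; exact/esym/hz.
  rewrite mulmxA; apply: submx_trans (submxMr P hu) _.
  have -> : low_rows (dsum p p') *m P = fdiag d S *m low_rows r.
    rewrite /low_rows AE mul_row_block !mulmx0 mul0mx addr0 add0r mul_mx_row mulmx0.
    by congr row_mx; rewrite fdiagMr fdiagMl; apply: flat_eq => i j; exact: hA.
  exact: submxMl.
split.
  apply: (half p z (col_mx 1%:M 0)) => [s j|i j].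
    by rewrite mul_row_col mulmx1 mulmx0 addr0.
  by rewrite mul_block_col mul_col_mx mul1mx !mulmx1 !mulmx0 !mul0mx !addr0.
apply: (half p' z' (col_mx 0 1%:M)) => [s j|i j].
  by rewrite mul_row_col mulmx1 mulmx0 add0r.
by rewrite mul_block_col mul_col_mx mul1mx !mulmx1 !mulmx0 !mul0mx !add0r.
Qed.

End Bound.
End IndependentRows.

Section Generation.
Context {R : realType} {g : nat} (t : nctopology) (y : 'I_g -> R[i]).
Local Notation C := R[i].
Local Notation Y := (scalar_point y).
Local Notation O := (germ t Y).
Local Notation ncspace := (ncspace R g).
Local Notation x := (@coord R g t y).
Local Notation ev := (@ev R g t y).

Variables (d e : nat) (A : 'I_d -> 'I_e -> O) (nu n0 : nat).
Hypothesis nu_max : forall n k, often A n k -> (k <= nu * n.+1)%N.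
Hypothesis nu_often : often A n0 (nu * n0.+1).
Local Notation N := (closure_rows A nu).

Lemma row_combination r n (u : 'rV[C]_(\sum_(s < r) 1)) (B : 'I_r -> 'I_e -> 'M[C]_(1, n)) :
  u *m flat B = \mxrow_j (\sum_s (submxrow u s) 0 0 *: B s j).
Proof.
rewrite -{1}[u]submxrowK /flat mul_mxrow_mxblock; apply: eq_mxrow => j.
by apply: eq_bigr => s _; rewrite {1}[submxrow u s]mx11_scalar mul_scalar_mx.
Qed.

(** With more than nu rows, some nonzero relation u holds at all good points p
    and all z. It says that f = sum_s u_s F_s vanishes at y and that its left
    derivatives belong to the closure of A, against independence. *)
Theorem independent_bound m (F : 'I_m -> 'I_e -> O) :
  (forall s, N (F s)) -> independent_mod A nu F -> (m <= nu)%N.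
Proof.
move=> NF indF; rewrite leqNgt; apply/negP => num.
have [Om nOm sub] := tev_region nu_max nu_often NF.
have tOm : tev t y Om by exists Om.
have [sO oO OY] := nOm.
pose adm r := exists p (z : 'I_g -> 'M[C]_(1, ncsize p)),
  [/\ Om p, good A nu p & \rank (relations A F z) = r].
have exr : exists r, `[< adm r >].
  have [dl dl0 near] := @tev_near R g t y n0 Om tOm.
  have [X [Xd rk]] := nu_often dl0.
  have OX := near X Xd; have [_ _ _ _ [rX _]] := sub _ OX.
  exists (\rank (@relations R g t y d e A m F (ncpoint X) (fun=> 0))); apply/asboolP.
  by exists (ncpoint X), (fun=> 0); split=> //; apply/eqP; rewrite eqn_leq rX.
case: (ex_minnP exr) => r /asboolP[p [z [Op gp rE]]] rmin.
have rpos : relations A F z != 0.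
  rewrite -mxrank_eq0 -lt0n; have := rank_relations nOm sub z Op gp.
  by move=> h; have := leq_trans num h; rewrite -[X in (X < _)%N]addn0 ltn_add2l.
have /rowV0Pn[u uK u0] := rpos.
have hu p' (z' : 'I_g -> 'M[C]_(1, ncsize p')) : Om p' -> good A nu p' ->
    (u *m top_rows F z' <= low_rows A p')%MS.
  move=> Op' gp'; rewrite -relationsP.
  have [s1 s2] := relations_dsum nOm sub z z' Op Op'.
  apply: submx_trans uK (submx_trans _ s2).
  have Od := sO _ _ Op Op'.
  have [ap _ _ _ _] := sub _ Op; have [ap' _ _ _ _] := sub _ Op'; have [ad _ _ _ _] := sub _ Od.
  have gd : good A nu (dsum p p').
    by rewrite /good (rank_dsum ap ap' ad) gp gp' -mulnDr.
  pose zz : 'I_g -> 'M[C]_(1, ncsize (dsum p p')) := fun k => row_mx (z k) (z' k).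
  have rm : (r <= \rank (relations A F zz))%N.
    by apply: rmin; apply/asboolP; exists (dsum p p'), zz; split; [exact: Od|exact: gd|exact: erefl].
  by have := geq_leqif (mxrank_leqif_sup s1); rewrite rE => <-; exact: rm.
pose c s : C := (submxrow u s) 0 0.
pose f j : O := \sum_s c s *: F s j.
have hu1 p' (z' : 'I_g -> 'M[C]_(1, ncsize p')) : Om p' -> good A nu p' ->
    (forall j, ev (f j) = 0) /\
    (\mxrow_j (\sum_s c s *: top_right F z' s j)%R <= fvalp A p')%MS.
  move=> Op' gp'; have := hu p' z' Op' gp'.
  rewrite /top_rows /low_rows mul_mx_row !row_combination => /submxP[w].
  rewrite mul_mx_row mulmx0 => /eq_row_mx[e1 e2]; split; last by rewrite e2 submxMl.
  move=> j; have := congr1 (fun M => submxrow M j) e1.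
  rewrite mxrowK submxrow0 => /matrixP/(_ 0 0); rewrite summxE mxE => e3.
  rewrite /f rmorph_sum /= -[RHS]e3; apply: eq_bigr => s _.
  by rewrite evZ [RHS]mxE [X in _ = _ * X]mxE eqxx mulr1n.
have ev0 j : ev (f j) = 0 by case: (hu1 p z Op gp).
have c0 : forall s, c s = 0.
  apply: indF; exists (fun k j => D k (f j)); split; last first.
    by move=> j; rewrite -/(f j) [LHS]DE ev0 scale0r add0r.
  move=> k.
  have h1 := tev_all (fun j => val_sum (fun s => c s *: D k (F s j))).
  have h2 := tev_all (fun j => tev_all (fun s => valZ (c s) (D k (F s j)))).
  apply: tevS (tevI tOm (tevI h1 h2)) => p' [Op' [h3 h4]] gp'.
  apply/row_subP => al.
  (* With z the al-th unit row in direction k, the top row is the al-th row of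
     the k-th derivative. *)
  pose z' : 'I_g -> 'M[C]_(1, ncsize p') := fun l => if l == k then delta_mx 0 al else 0.
  have [_] := hu1 p' z' Op' gp'; congr (_ <= _)%MS.
  apply/rowP => v; rewrite !mxE.
  set j := tagnat.sig1 v.
  have -> : val (D k (f j)) p' = \sum_s c s *: val (D k (F s j)) p'.
    rewrite /f raddf_sum /=.
    have -> : \sum_s D k (c s *: F s j) = \sum_s c s *: D k (F s j).
      by apply: eq_bigr => s _; rewrite D_scale.
    rewrite [LHS]h3; apply: eq_bigr => s _; exact: h4.
  rewrite !summxE; apply: eq_bigr => s _; rewrite !mxE; congr (_ * _).
  rewrite /top_right (bigD1 k)//= /z' eqxx big1 ?addr0 => [|l /negbTE ->]; last exact: mul0mx.
  by rewrite -rowE mxE.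
case/eqP: u0; rewrite -[u]submxrowK.
have -> : submxrow u = fun=> 0.
  by apply/funext => s; rewrite [submxrow u s]mx11_scalar -/(c s) c0 raddf0.
exact: mxrow0.
Qed.

(** A maximal independent family spans the closure of A modulo the maximal
    ideal, hence generates it by [nakayama], and the closure contains the rows
    of A. *)
Theorem factors_generic :
  exists2 m, (m <= nu)%N & factors_through (\matrix_(i, j) A i j) m.
Proof.
pose P m := `[< exists F : 'I_m -> 'I_e -> O, (forall s, N (F s)) /\ independent_mod A nu F >].
have exP : exists m, P m.
  by exists 0%N; apply/asboolP; exists (fun _ _ => 0); split=> [[]|c _ []].
have ubP m : P m -> (m <= nu)%N.
  by move=> /asboolP[F [NF indF]]; exact: independent_bound indF.
case: (ex_maxnP exP ubP) => m /asboolP[F [NF indF]] mmax; exists m.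
  exact: independent_bound indF.
have sN := closure_rows_submodule A nu.
have spF : spans_mod N F.
  move=> f Nf; apply: contrapT => nspan.
  have : P m.+1; last by move/mmax; rewrite ltnn.
  apply/asboolP.
  pose F' : 'I_m.+1 -> 'I_e -> O := fun s => if unlift ord0 s is Some s' then F s' else f.
  exists F'; split.
    by move=> s; rewrite /F'; case: unliftP => [s' _|_].
  have F'0 : F' ord0 = f by rewrite /F' unlift_none.
  have F'S s : F' (lift ord0 s) = F s by rewrite /F' liftK.
  move=> c [n [Nn hn]].
  have hn' j : c ord0 *: f j + \sum_s c (lift ord0 s) *: F s j = \sum_k x k * n k j.
    by rewrite -hn big_ord_recl F'0; congr (_ + _); apply: eq_bigr => s _; rewrite F'S.
  have [c0|c0] := eqVneq (c ord0) 0.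
    have cS := indF (fun s => c (lift ord0 s)).
    have {}cS : forall s, c (lift ord0 s) = 0.
      by apply: cS; exists n; split=> // j; rewrite -hn' c0 scale0r add0r.
    by move=> s; case: (unliftP ord0 s) => [s' ->|->].
  exfalso; apply: nspan.
  exists (fun s => - (c ord0)^-1 * c (lift ord0 s)), (fun k j => ((c ord0)^-1)%:A * n k j); split.
    by move=> k; case: sN => _ _; apply.
  move=> j; have := congr1 (fun a => (c ord0)^-1 *: a) (hn' j).
  rewrite scalerDr scalerA mulVf// scale1r => e1.
  have -> : f j = (c ord0)^-1 *: (\sum_k x k * n k j) -
      (c ord0)^-1 *: (\sum_s c (lift ord0 s) *: F s j).
    by rewrite -e1 addrK.
  rewrite addrC !scaler_sumr -sumrN; congr (_ + _); apply: eq_bigr => k _.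
    by rewrite scalerA mulNr scaleNr.
  by rewrite mulr_algl scalerAr.
have gen := nakayama sN NF spF.
have /choice[h hE] := fun i => gen _ (closure_rows_self A nu i).
exists (\matrix_(i, s) h i s), (\matrix_(s, j) F s j).
apply/matrixP => i j; rewrite !mxE hE; apply: eq_bigr => s _; by rewrite !mxE.
Qed.

End Generation.

Lemma factors_rank (R : realType) (g : nat) (t : nctopology) (y : 'I_g -> R[i])
    (d e r : nat) (A : 'M[germ t (scalar_point y)]_(d, e)) :
  factors_through A r ->
  tev t y [set p | (\rank (fvalp (fun i j => A i j) p) <= r * ncsize p)%N].
Proof.
move=> [B [D ->]].
have h1 := tev_all (fun i => tev_all (fun j => val_sum (fun k => B i k * D k j))).
have h2 := tev_all (fun i => tev_all (fun k => tev_all (fun j => valM (B i k) (D k j)))).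
apply: tevS (tevI h1 h2) => p [h3 h4] /=.
have -> : fvalp (fun i j => (B *m D) i j) p =
    fvalp (fun i k => B i k) p *m fvalp (fun k j => D k j) p.
  rewrite flatM; apply: flat_eq => i j; rewrite mxE [LHS]h3.
  by apply: eq_bigr => k _; exact: h4.
apply: leq_trans (mxrankM_maxr _ _) _; apply: leq_trans (rank_leq_row _) _.
by rewrite sum_nat_const card_ord.
Qed.

Theorem theorem2 (R : realType) (g : nat) (t : nctopology) (y : 'I_g -> R[i])
    (d e : nat) (A : 'M[germ t (scalar_point y)]_(d, e))
    (F : 'M[anafun t (scalar_point y)]_(d, e)) :
  (forall i j, germ_of (F i j) = A i j) ->
  exists Omega0 : set (ncspace R g), ncnbhd t (scalar_point y) Omega0 /\
    forall Omega : set (ncspace R g),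
      ncnbhd t (scalar_point y) Omega -> Omega `<=` Omega0 ->
      (forall i j, Omega `<=` ncdom (F i j)) ->
      is_max [set (\rank (eval_mx F X))%:R / (ncsize X)%:R | X in Omega]
        ((inner_rank A)%:R : rat).
Proof.
move=> FA; pose a i j := A i j.
have [nu [nu_max [n0 nu_often]]] := generic_rank a.
have [m mnu fm] := factors_generic nu_max nu_often.
have {}fm : factors_through A m.
  by have -> : A = \matrix_(i, j) a i j by apply/matrixP => i j; rewrite mxE.
have [fr rmin] : factors_through A (inner_rank A) /\
    forall k, factors_through A k -> (inner_rank A <= k)%N.
  rewrite /inner_rank; case: ex_minnP => r /asboolP fr rmin; split=> // k fk.
  by apply: rmin; apply/asboolP.
set r := inner_rank A in fr rmin *.
have rnu : (r <= nu)%N := leq_trans (rmin m fm) mnu.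
have hF := tev_all (fun i => tev_all (fun j => val_germ_of (F i j))).
have [Om0 nOm0 sub] := tevI (factors_rank fr) hF.
exists Om0; split=> // Om nOm OmS _.
have evalE X : Om X -> eval_mx F X = fvalp a X.
  move=> /OmS/sub[_ hX]; apply: flat_eq => i j.
  by rewrite /a -FA; apply/esym; exact: hX.
have ub X : Om X -> (\rank (eval_mx F X) <= r * ncsize X)%N.
  by move=> OX; rewrite evalE//; case: (sub _ (OmS _ OX)).
have size_gt0 (X : ncspace R g) : 0 < (ncsize X)%:R :> rat by rewrite ltr0n.
split.
  have tOm : tev t y Om by exists Om.
  have [dl dl0 near] := @tev_near R g t y n0 Om tOm.
  have [X [Xd rk]] := nu_often dl dl0; have OX := near X Xd.
  exists (ncpoint X) => //.
  have -> : \rank (eval_mx F (ncpoint X)) = (r * ncsize (ncpoint X))%N.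
    apply/eqP; rewrite eqn_leq ub//= evalE//; apply: leq_trans rk.
    by rewrite leq_mul2r rnu orbT.
  by rewrite natrM mulfK// gt_eqF.
move=> _ [X OX <-]; rewrite ler_pdivrMr// -natrM ler_nat; exact: ub.
Qed.
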